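(* Let $N>1$ be an integer, let $\sigma^2>0$, let $\boldsymbol{K}=K_1+iK_2$ with $K_1,K_2\in\mathbb{R}$ constants, and let $S_N(z)=\sum_{j=0}^{N}\eta_jf_j(z)$, where $\eta_j=a_j+ib_j$, the real random variables $a_0,\dots,a_N,b_0,\dots,b_N$ are mutually independent and normal with mean zero and common variance $\sigma^2$, and $f_j$ ($0\le j\le N$) are holomorphic functions on $\mathbb{C}$ that are real-valued on the real line. Put $$B_0(z)=\sum_{j=0}^N|f_j(z)|^2,\qquad B_1(z)=\sum_{j=0}^N\overline{f_j(z)}f_j'(z),\qquad B_2(z)=\sum_{j=0}^N|f_j'(z)|^2.$$ Let $T\subset\mathbb{C}$ be compact with $B_0(z)>0$ for all $z\in T$, and let $N_{\boldsymbol{K}}^{S_N}(T)$ be the number of solutions $z\in T$, counted with multiplicity, of $S_N(z)=\boldsymbol{K}$. Then $$E\bigl(N_{\boldsymbol{K}}^{S_N}(T)\bigr)=\int_Th_{N,\boldsymbol{K}}(z)\,dx\,dy\qquad(z=x+iy),$$ where $$h_{N,\boldsymbol{K}}(z)=\frac{1}{\pi B_0(z)}\exp\left(-\frac{K_1^2+K_2^2}{2\sigma^2B_0(z)}\right)\left\{B_2(z)-\left(\frac{|B_1(z)|}{B_0(z)}\right)^2\left(B_0(z)-\frac{K_1^2+K_2^2}{2\sigma^2}\right)\right\}.$$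
   Context: $E$ denotes expectation. The function $h_{N,\boldsymbol{K}}$ is called the expected density of the complex zeros of $S_N(z)=\boldsymbol{K}$. *)

(* Defs.v *)
From HB Require Import structures.
From mathcomp Require Import all_boot all_order all_algebra.
From mathcomp Require Import all_classical all_reals all_analysis measurable_realfun.
From mathcomp Require Import complex.

Set Implicit Arguments.
Unset Strict Implicit.
Unset Printing Implicit Defensive.

Import Order.TTheory GRing.Theory Num.Theory.
Import numFieldNormedType.Exports.

Local Open Scope ring_scope.
Local Open Scope complex_scope.
Local Open Scope classical_set_scope.

Section ComplexAnalysis.
Variable R : realType.
Implicit Types (f g : R[i] -> R[i]) (z K : R[i]) (T : set R[i]).

(* The real-valued modulus; the norm of the field R[i] takes values in R[i]. *)
Definition cmod z : R := ComplexField.Normc.normc z.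

(* [R[i]^o] is R[i] as a normed module over itself, so that [derivable],
   [derive1] and [compact] refer to the complex derivative and to the usual
   topology of the plane. *)
Definition entire f : Prop :=
  forall z, derivable (f : R[i]^o -> R[i]^o) z 1.

Definition cderiv f : R[i] -> R[i] := derive1 (f : R[i]^o -> R[i]^o).

Definition ccompact T : Prop := compact (T : set R[i]^o).

(* Order of vanishing of g at z: the number of consecutive derivatives
   g, g', g'', ... that vanish at z, +oo if they all do. *)
Definition zero_mult g z : \bar R :=
  ereal_sup [set (m%:R : R)%:E | m in
    [set m : nat | forall k, (k < m)%N -> iter k cderiv g z = 0]].

Definition num_solutions g K T : \bar R :=
  \esum_(z in T `&` [set z | g z = K]) zero_mult (fun w => g w - K) z.

Definition plane (p : R * R) : R[i] := p.1 +i* p.2.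

Definition integral_dxdy T (h : R[i] -> R) : \bar R :=
  (\int[lebesgue_measure \x lebesgue_measure]_(p in plane @^-1` T)
     (h (plane p))%:E)%E.

End ComplexAnalysis.

Section Probability.
Context d (Omega : measurableType d) (R : realType) (P : probability Omega R).

Definition mutually_independent (I : finType) (X : I -> {RV P >-> R}) : Prop :=
  forall (J : {set I}) (A : I -> set R), (forall i, measurable (A i)) ->
    P (\bigcap_(i in [set` J]) X i @^-1` A i)
    = (\prod_(i in J) P (X i @^-1` A i))%E.

(* m is the mean and s ^+ 2 the variance; the law is compared on Borel sets. *)
Definition is_normal (X : {RV P >-> R}) (m s : R) : Prop :=
  forall A : set R, measurable A -> distribution P X A = normal_prob m s A.

Definition joint_family (J : Type) (a b : J -> {RV P >-> R}) (k : J + J) :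
    {RV P >-> R} :=
  match k with inl j => a j | inr j => b j end.

End Probability.

Section RandomSum.
Context d (Omega : measurableType d) (R : realType) (P : probability Omega R).
Variables (N : nat) (f : 'I_N.+1 -> R[i] -> R[i]).

Definition random_sum (a b : 'I_N.+1 -> {RV P >-> R}) (w : Omega) (z : R[i]) :
    R[i] :=
  \sum_(j < N.+1) (a j w +i* b j w) * f j z.

Definition B0 (z : R[i]) : R := \sum_(j < N.+1) cmod (f j z) ^+ 2.

Definition B1 (z : R[i]) : R[i] := \sum_(j < N.+1) (f j z)^* * cderiv (f j) z.

Definition B2 (z : R[i]) : R := \sum_(j < N.+1) cmod (cderiv (f j) z) ^+ 2.

Definition expected_density (sigma K1 K2 : R) (z : R[i]) : R :=
  (pi * B0 z)^-1
  * expR (- ((K1 ^+ 2 + K2 ^+ 2) / (2 * sigma ^+ 2 * B0 z)))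
  * (B2 z - (cmod (B1 z) / B0 z) ^+ 2
            * (B0 z - (K1 ^+ 2 + K2 ^+ 2) / (2 * sigma ^+ 2))).

End RandomSum.

(* Main.v *)
Require Import Defs.
From HB Require Import structures.
From mathcomp Require Import all_boot all_order all_algebra.
From mathcomp Require Import all_classical all_reals all_analysis measurable_realfun.
From mathcomp Require Import complex ring lra.

Set Implicit Arguments.
Unset Strict Implicit.
Unset Printing Implicit Defensive.

Import Order.TTheory GRing.Theory Num.Theory.
Import numFieldNormedType.Exports.

Local Open Scope ring_scope.
Local Open Scope complex_scope.
Local Open Scope classical_set_scope.

(** The proof is potential-theoretic. For an entire function g that is not
    identically zero, the Laplacian of log |g| is 2 pi times the sum of the
    Dirac masses at the zeros of g: for every twice differentiable phi with
    compact support,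

      sum of phi over the zeros of g
        = (2 pi)^-1 times the integral of (Laplacian phi) log |g|

    ([integral_lap_ln_cmod]). This combines a factorization of g, in a disk, as
    a finite product of factors (w - a) times a zero-free entire function
    ([entire_finite_factor], a consequence of Cauchy's formula), the fact that
    the logarithm is a fundamental solution of the Laplace equation
    ([lap_lndist]), and Green's identity for the zero-free factor, the logarithm
    of whose modulus is harmonic ([harmonic_ln_cmod]).

    The formula is linear in log |g|, so that for g = S_N - K the expectation can
    be taken under the integral ([fubini_potential]). Only the law of the single
    value S_N(z) matters: it is the centred complex Gaussian law of variance
    V = 2 sigma^2 B0(z) ([value_law]), and E log |S_N(z) - K| = L(V) for a
    function L of one variable, [gpot]. The Gaussian densities solve the heat
    equation, hence L' (V) is a quarter of the integral of the Laplacian of a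
    Gaussian against the logarithmic kernel, which is explicit:
    L' (V) = exp (- |K|^2 / V) / (2 V) ([gpot_is_derive]). The chain rule, with
    the Cauchy-Riemann equations for the f_j, then shows that the Laplacian of
    z |-> L (2 sigma^2 B0(z)) is 2 pi times the density of the statement, and
    Green's identity moves the Laplacian from phi to L ([green_mean_log]).
    Therefore E (sum of phi over the solutions) is the integral of phi times the
    density, for every phi supported where B0 > 0.

    Finally the indicator of T is the pointwise limit of such functions phi_n,
    with values in [0, 1] and supported in one compact subset of {B0 > 0}
    ([test_functions]), and dominated convergence applies on both sides. The
    event where S_N is identically equal to K needs separate care: the count is
    infinite there and the integrals above vanish, but the event has probability
    zero as soon as T contains a point, because S_N has a density at that
    point. Off this event the count is the limit of the integrals above, and
    this is also why it is measurable ([measurable_count]). *)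

(** * Complex differentiability *)

Section ComplexDerivative.
Variable R : realType.
Local Notation C := R[i].
Implicit Types (f g : C -> C) (z w h l k : C).

Lemma cmodE z : `|z| = (cmod z)%:C.
Proof. by case: z. Qed.

Lemma cmod_ge0 z : 0 <= cmod z.
Proof. by rewrite -ler0c -cmodE normr_ge0. Qed.

Lemma cmodD z w : cmod (z + w) <= cmod z + cmod w.
Proof. exact: le_normcD. Qed.

Lemma cmodN z : cmod (- z) = cmod z.
Proof. exact: normcN. Qed.

Lemma cmodM z w : cmod (z * w) = cmod z * cmod w.
Proof. exact: ComplexField.Normc.normcM. Qed.

Lemma cmodV z : cmod z^-1 = (cmod z)^-1.
Proof. exact: ComplexField.Normc.normcV. Qed.

Lemma cmodX z n : cmod (z ^+ n) = cmod z ^+ n.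
Proof.
elim: n => [|n IH]; first exact: ComplexField.Normc.normc1.
by rewrite !exprS cmodM IH.
Qed.

Lemma cmod0 : cmod (0 : C) = 0.
Proof. exact: ComplexField.Normc.normc0. Qed.

Lemma cmod_eq0 z : (cmod z == 0) = (z == 0).
Proof.
apply/eqP/eqP => [|->]; last exact: cmod0.
exact: ComplexField.Normc.eq0_normc.
Qed.

Lemma cmod_gt0 z : (0 < cmod z) = (z != 0).
Proof. by rewrite lt0r cmod_eq0 cmod_ge0 andbT. Qed.

Lemma cmod_real (x : R) : cmod x%:C = `|x|.
Proof. by rewrite /cmod/= expr0n addr0 sqrtr_sqr. Qed.

Lemma sqr_cmod z : cmod z ^+ 2 = complex.Re z ^+ 2 + complex.Im z ^+ 2.
Proof. by case: z => x y /=; rewrite sqr_sqrtr// addr_ge0// sqr_ge0. Qed.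

Lemma ge_Re_cmod z : `|complex.Re z| <= cmod z.
Proof.
rewrite -(@ler_pXn2r _ 2)// ?nnegrE ?cmod_ge0//.
by rewrite sqr_cmod real_normK ?num_real// lerDl sqr_ge0.
Qed.

Lemma ge_Im_cmod z : `|complex.Im z| <= cmod z.
Proof.
rewrite -(@ler_pXn2r _ 2)// ?nnegrE ?cmod_ge0//.
by rewrite sqr_cmod real_normK ?num_real// lerDr sqr_ge0.
Qed.

Lemma le_cmod_ReIm z : cmod z <= `|complex.Re z| + `|complex.Im z|.
Proof.
rewrite -(@ler_pXn2r _ 2)// ?nnegrE ?cmod_ge0 ?addr_ge0//.
rewrite sqr_cmod sqrrD !real_normK ?num_real//.
by rewrite -addrA lerD2l lerDr mulrn_wge0// mulr_ge0.
Qed.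

Lemma ler_cmodB z w : cmod z - cmod w <= cmod (z - w).
Proof. by rewrite lerBlDr -{1}(subrK w z) cmodD. Qed.

(** The explicit form of complex differentiability used in the Cauchy theory:
    it compares real numbers only, whereas the norm of [R[i]] is complex. *)
Definition cdiff f z l := forall e : R, 0 < e ->
  exists2 d : R, 0 < d &
    forall h, cmod h < d -> cmod (f (z + h) - f z - l * h) <= e * cmod h.

Lemma near_cmodP z (P : C -> Prop) :
  (\forall w \near (z : C^o), P w) <->
  (exists2 d : R, 0 < d & forall w, cmod (z - w) < d -> P w).
Proof.
split.
- move=> /nbhs_ballP[[d d']/=]; rewrite -ball_normE /= => d0 H.
  have /andP[/eqP/= d'0 d0'] : (d' == 0) && (0 < d) by move: d0; rewrite ltcE.
  exists d => // w zw; apply: H => /=.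
  by rewrite cmodE d'0 ltcR.
- move=> [d d0 H]; apply/nbhs_ballP; exists d%:C => /=; first by rewrite ltcR.
  by move=> w; rewrite -ball_normE /= cmodE ltcR => /H.
Qed.

Lemma cvg_dnbhs0_cmodP (g : C^o -> C^o) l :
  g @ (0 : C^o)^' --> (l : C^o) <->
  (forall e : R, 0 < e -> exists2 d : R, 0 < d &
    forall h, h != 0 -> cmod h < d -> cmod (l - g h) < e).
Proof.
have E := @cvgrPdist_lt C C^o C^o (0 : C^o)^' (dnbhs_filter _) g (l : C^o).
split => [/(proj1 E) H e e0|H].
  have := H e%:C; rewrite ltcR => /(_ e0) /near_cmodP[d d0 {}H].
  exists d => // h h0 hd.
  by have := H h; rewrite sub0r cmodN cmodE ltcR; apply.
apply: (proj2 E) => -[e e']; rewrite ltcE /= => /andP[/eqP -> e0].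
have [d d0 {}H] := H e e0; apply/near_cmodP; exists d => // h.
rewrite sub0r cmodN => hd h0; rewrite cmodE (_ : e +i* 0 = e%:C)// ltcR.
exact: H.
Qed.

Lemma is_derive_cdiff f z l :
  is_derive (z : C^o) 1 (f : C^o -> C^o) l <-> cdiff f z l.
Proof.
set q := fun h : C^o => h^-1 *: (f (h *: 1 + z) - f z).
have qE h : h != 0 -> cmod (f (z + h) - f z - l * h) = cmod (l - q h) * cmod h.
  move=> h0; rewrite -cmodM -cmodN; congr cmod.
  rewrite /q mulrBl opprB [h *: 1]mulr1 [_ *: _]mulrC mulfVK//.
  by rewrite (addrC h).
split.
- move=> [df dl] e e0.
  have /cvg_dnbhs0_cmodP cvl : q @ (0 : C^o)^' --> (l : C^o).
    by rewrite -dl; exact: df.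
  have [d d0 H] := cvl e e0; exists d => // h hd.
  have [->|h0] := eqVneq h 0; first by rewrite addr0 subrr mulr0 subr0 cmod0 mulr0.
  by rewrite qE// ler_pM2r ?cmod_gt0// ltW// H.
- move=> H.
  have cvl : q @ (0 : C^o)^' --> (l : C^o).
    apply/cvg_dnbhs0_cmodP => e e0.
    have [d d0 {}H] := H (e/2) (divr_gt0 e0 (ltr0n _ 2)).
    exists d => // h h0 /H; rewrite qE// ler_pM2r ?cmod_gt0// => /le_lt_trans; apply; lra.
  have df : derivable (f : C^o -> C^o) z 1 by apply/cvg_ex; exists l.
  split; first exact: df.
  have P0 : ProperFilter (0 : C^o)^' := Proper_dnbhs_numFieldType (0 : C).
  exact: (@cvg_unique C^o (@norm_hausdorff C C^o) _ (fmap_proper_filter q P0) _ _ df cvl).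
Qed.

Lemma cderiv_cdiff f z l : cdiff f z l -> cderiv f z = l.
Proof. by move=> /is_derive_cdiff[_ <-]; rewrite /cderiv derive1E. Qed.

Lemma entireP f : entire f <-> forall z, cdiff f z (cderiv f z).
Proof.
split=> [H z|H z]; last by have /is_derive_cdiff[] := H z.
apply/is_derive_cdiff; rewrite /cderiv derive1E; exact/derivableP/H.
Qed.

Lemma cdiff_entire f g : (forall z, cdiff f z (g z)) -> entire f.
Proof. by move=> H; apply/entireP => z; rewrite (cderiv_cdiff (H z)). Qed.

Lemma cderivE f g : (forall z, cdiff f z (g z)) -> cderiv f = g.
Proof. by move=> H; apply/funext => z; exact: cderiv_cdiff. Qed.

Lemma cdiff_cst k z : cdiff (fun=> k) z 0.
Proof. by apply/is_derive_cdiff; exact: is_derive_cst. Qed.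

Lemma cdiff_id z : cdiff id z 1.
Proof. by apply/is_derive_cdiff; exact: is_derive_id. Qed.

Lemma cdiffD f g z a b : cdiff f z a -> cdiff g z b ->
  cdiff (fun w => f w + g w) z (a + b).
Proof.
move=> /is_derive_cdiff Hf /is_derive_cdiff Hg.
by apply/is_derive_cdiff; exact: is_deriveD.
Qed.

Lemma cdiffM f g z a b : cdiff f z a -> cdiff g z b ->
  cdiff (fun w => f w * g w) z (f z * b + a * g z).
Proof.
move=> /is_derive_cdiff Hf /is_derive_cdiff Hg.
apply/is_derive_cdiff; rewrite [a * _]mulrC; have := @is_deriveM C C^o f g z 1 a b Hf Hg. by rewrite [f z *: b + g z *: a]/(f z * b + g z * a).
Qed.

Lemma cdiffZ f z a k : cdiff f z a -> cdiff (fun w => k * f w) z (k * a).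
Proof.
by move=> Hf; have := cdiffM (cdiff_cst k z) Hf; rewrite mul0r addr0.
Qed.

Lemma cdiffN f z a : cdiff f z a -> cdiff (fun w => - f w) z (- a).
Proof.
by move=> /is_derive_cdiff Hf; apply/is_derive_cdiff; exact: is_deriveN.
Qed.

Lemma cdiffB f g z a b : cdiff f z a -> cdiff g z b ->
  cdiff (fun w => f w - g w) z (a - b).
Proof. by move=> Hf Hg; exact: cdiffD Hf (cdiffN Hg). Qed.

Lemma cdiff_sum (I : Type) (r : seq I) (F : I -> C -> C) (G : I -> C) z :
  (forall i, cdiff (F i) z (G i)) ->
  cdiff (fun w => \sum_(i <- r) F i w) z (\sum_(i <- r) G i).
Proof.
move=> H; elim: r => [|i r IH].
  rewrite big_nil (_ : (fun _ => _) = fun=> 0); first exact: cdiff_cst.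
  by apply/funext => w; rewrite big_nil.
rewrite big_cons (_ : (fun _ => _) = fun w => F i w + \sum_(j <- r) F j w).
  exact: cdiffD.
by apply/funext => w; rewrite big_cons.
Qed.

Lemma cdiff_continuous f z l : cdiff f z l ->
  forall e : R, 0 < e -> exists2 d : R, 0 < d &
    forall h, cmod h < d -> cmod (f (z + h) - f z) < e.
Proof.
move=> H e e0; have [d d0 Hd] := H 1 ltr01.
have l1 : 0 < cmod l + 1 by rewrite ltr_wpDl// cmod_ge0.
exists (Num.min d (e / (cmod l + 1))); first by rewrite lt_min d0 divr_gt0.
move=> h; rewrite lt_min ltr_pdivlMr// => /andP[/Hd {}Hd he].
rewrite -(subrK (l * h) (f (z + h) - f z)).
apply: le_lt_trans (cmodD _ _) (le_lt_trans _ he).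
by rewrite cmodM; apply: le_trans (lerD Hd (lexx _)) _; rewrite mul1r mulrDr mulr1 addrC (mulrC (cmod l)).
Qed.

Lemma cdiffV f z a : f z != 0 -> cdiff f z a ->
  cdiff (fun w => (f w)^-1) z (- a / f z ^+ 2).
Proof.
move=> fz0 /is_derive_cdiff df; apply/is_derive_cdiff.
have d1 := @ex_derive _ _ _ _ _ _ _ df.
have := @derivableV C C^o (f : C^o -> C^o) z 1 fz0 d1.
have := @deriveV C C^o (f : C^o -> C^o) z 1 fz0 d1.
rewrite (@derive_val _ _ _ _ _ _ _ df) => e1 e2.
split=> //. rewrite e1 /=. by rewrite [_ *: _]mulrC mulNr mulrN.
Qed.

End ComplexDerivative.

(** * Antiderivatives and line integrals *)

Section LineIntegral.
Variable R : realType.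
Local Notation C := R[i].
Implicit Types (f g : C -> C) (z w l k p v : C) (q Q : R -> C).

Lemma near_normP (x : R) (P : R -> Prop) :
  (\forall y \near x, P y) <->
  (exists2 d : R, 0 < d & forall h, `|h| < d -> P (x + h)).
Proof.
split.
- move=> /nbhs_ballP[d /= d0 H]; exists d => // h hd; apply: H.
  by rewrite -ball_normE /= opprD addNKr normrN.
- move=> [d d0 H]; apply/nbhs_ballP; exists d => //= y.
  rewrite -ball_normE /= distrC => yx.
  by rewrite -(subrKC x y); exact: H.
Qed.

Lemma rdiff_is_derive (F : R -> R) (x a : R) :
  (forall e : R, 0 < e -> exists2 d : R, 0 < d &
     forall h, `|h| < d -> `|F (x + h) - F x - a * h| <= e * `|h|) ->
  is_derive x 1 F a.
Proof.
move=> H.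
have cvl : (fun h => h^-1 *: (F (h *: 1 + x) - F x)) @ 0^' --> a.
  apply/cvgrPdist_lt => e e0.
  have [d d0 {}H] := H (e/2) (divr_gt0 e0 (ltr0n _ 2)).
  apply/nbhs_ballP; exists d => //= h; rewrite -ball_normE /= sub0r normrN => /H Hh h0.
  rewrite -(ltr_pM2r (_ : 0 < `|h|)) ?normr_gt0//.
  have -> : `|a - h^-1 *: (F (h *: 1 + x) - F x)| * `|h| = `|F (x + h) - F x - a * h|.
    rewrite -normrM -normrN; congr (`|_|).
    rewrite mulrBl opprB [h *: 1]mulr1 [_ *: _]mulrC mulfVK//.
    by rewrite (addrC h).
  apply: le_lt_trans Hh _; rewrite ltr_pM2r ?normr_gt0//; lra.
have df : derivable F x 1 by apply/cvg_ex; exists a.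
split; first exact: df.
exact: (@cvg_unique _ (@Rhausdorff R) _ (fmap_proper_filter _ _) _ _ df cvl).
Qed.

Lemma cdiff_line f p v (t : R) l : cdiff f (p + t%:C * v) l ->
  is_derive t 1 (fun s => complex.Re (f (p + s%:C * v))) (complex.Re (l * v)) /\
  is_derive t 1 (fun s => complex.Im (f (p + s%:C * v))) (complex.Im (l * v)).
Proof.
move=> H.
have K (e : R) : 0 < e -> exists2 d : R, 0 < d & forall h : R, `|h| < d ->
    cmod (f (p + (t + h)%:C * v) - f (p + t%:C * v) - l * v * h%:C) <= e * `|h|.
  move=> e0; have v1 : 0 < cmod v + 1 by rewrite ltr_wpDl// cmod_ge0.
  have [d d0 Hd] := H (e / (cmod v + 1)) (divr_gt0 e0 v1).
  exists (d / (cmod v + 1)); first exact: divr_gt0.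
  move=> h; rewrite ltr_pdivlMr// => hd.
  have hv : cmod (h%:C * v) <= `|h| * (cmod v + 1).
    by rewrite cmodM cmod_real ler_wpM2l// lerDl.
  have := Hd (h%:C * v) (le_lt_trans hv hd).
  have -> : p + t%:C * v + h%:C * v = p + (t + h)%:C * v.
    by rewrite -addrA -mulrDl -rmorphD.
  rewrite mulrA (mulrAC l) => /le_trans; apply.
  apply: le_trans (ler_wpM2l _ hv) _; first by rewrite divr_ge0// ltW.
  by rewrite mulrCA mulfVK ?gt_eqF// mulrC.
split; apply: rdiff_is_derive => e /K[d d0 Hd]; exists d => // h /Hd.
- apply: le_trans; apply: le_trans (ge_Re_cmod _).
  move: (l * v) (f _) (f _) => [l1 l2] [a1 a2] [b1 b2] /=.
  by rewrite mulr0 subr0.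
- apply: le_trans; apply: le_trans (ge_Im_cmod _).
  move: (l * v) (f _) (f _) => [l1 l2] [a1 a2] [b1 b2] /=.
  by rewrite mulr0 add0r.
Qed.

Lemma is_derive_continuous (F : R -> R) (a : R -> R) :
  (forall x : R, is_derive x 1 F (a x)) -> continuous F.
Proof.
move=> H x; have [dF _] := H x.
by apply: differentiable_continuous; apply/derivable1_diffP.
Qed.

(* Each half-line [-M, +oo[ carries the antiderivative vanishing at -M; the
   normalisation at 0 makes these local choices agree. *)
Lemma continuous_antiderivative (F : R -> R) : continuous F ->
  exists G : R -> R, forall x : R, is_derive x 1 G (F x).
Proof.
move=> cF.
pose mu := @lebesgue_measure R.
pose I M x := \int[mu]_(t in `[- M, x]) F t.
have iF a b : mu.-integrable `[a, b] (EFin \o F).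
  apply: continuous_compact_integrable; first exact: segment_compact.
  exact: continuous_subspaceT.
have IB M x y : - M <= x -> x <= y -> I M y - I M x = \int[mu]_(t in `]x, y]) F t.
  by move=> Mx xy; apply: Rintegral_itvB => //; rewrite bnd_simp.
have same M M' x : `|x| <= M -> M <= M' -> I M x - I M 0 = I M' x - I M' 0.
  move=> xM MM'; have M0 : 0 <= M by apply: le_trans xM.
  have Mx : - M <= x by move: xM; rewrite ler_norml => /andP[].
  have [x0|x0] := leP 0 x.
    by rewrite !IB//; lra.
  rewrite -[LHS]opprB -[RHS]opprB !IB ?(ltW x0)//; lra.
pose G x := I (`|x| + 1) x - I (`|x| + 1) 0; exists G => x.
pose M := `|x| + 3.
have GI y : `|y - x| < 1 -> G y = I M y - I M 0.
  move=> yx; apply: same; first by rewrite lerDl.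
  by have := lerB_dist y x; rewrite /M; lra.
have xM : - M < x by have := ler_norm (- x); rewrite normrN /M; lra.
have [dI dIE] := continuous_FTC1_closed (ltr_pwDr ltr01 (lexx x)) (iF _ _) xM (cF x).
have nGI : {near x, (fun y => I M y - I M 0) =1 G}.
  by apply/near_normP; exists 1 => // e e1; rewrite GI// addrC addKr.
apply: near_eq_is_derive nGI _.
have dI' : is_derive x 1 (I M) (F x).
  by apply: DeriveDef; [exact: dI | rewrite -derive1E].
rewrite -[F x]subr0.
exact: (is_deriveB dI' (is_derive_cst (I M 0) x (1 : R))).
Qed.


Definition ccont q : Prop :=
  and (continuous (fun t => complex.Re (q t)))
    (continuous (fun t => complex.Im (q t))).

Definition cprim q Q : Prop := forall t : R,
  is_derive t 1 (fun s => complex.Re (Q s)) (complex.Re (q t)) /\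
  is_derive t 1 (fun s => complex.Im (Q s)) (complex.Im (q t)).

Lemma ccont_cprim q : ccont q -> exists Q, cprim q Q.
Proof.
move=> [/continuous_antiderivative[F HF] /continuous_antiderivative[G HG]].
by exists (fun t => F t +i* G t) => t; split; [exact: HF|exact: HG].
Qed.

(** [cint q a b] is the integral of [q] from [a] to [b], read off from an
    antiderivative: additivity over adjacent intervals, of any orientation, is
    then immediate. *)
Definition cint q (a b : R) : C :=
  let Q := xget (fun=> 0) [set Q | cprim q Q] in Q b - Q a.

Lemma is_derive_eq_sub (F G f : R -> R) (a b : R) :
  (forall x : R, is_derive x 1 F (f x)) -> (forall x : R, is_derive x 1 G (f x)) ->
  F b - F a = G b - G a.
Proof.
move=> HF HG.
have H (x : R) : is_derive x 1 (F - G) 0.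
  by rewrite -(subrr (f x)); exact: is_deriveB (HF x) (HG x).
have E : F b - G b = F a - G a := is_derive_0_is_cst b a H.
by rewrite -(subrK (G b) (F b)) E; ring.
Qed.

Lemma cintE q Q a b : cprim q Q -> cint q a b = Q b - Q a.
Proof.
move=> HQ; rewrite /cint; set P := xget _ _.
have HP : cprim q P by rewrite /P; case: xgetP => [P' _ //|/(_ Q) /(_ HQ) []].
have HR := @is_derive_eq_sub (fun s => complex.Re (P s)) (fun s => complex.Re (Q s)) _ a b (fun x => (HP x).1) (fun x => (HQ x).1).
have HI := @is_derive_eq_sub (fun s => complex.Im (P s)) (fun s => complex.Im (Q s)) _ a b (fun x => (HP x).2) (fun x => (HQ x).2).
move: HR HI; case: (P b) (P a) (Q b) (Q a) => [? ?] [? ?] [? ?] [? ?] /= HR HI.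
by apply/eqP; rewrite eq_complex /= HR HI !eqxx.
Qed.

Lemma cint_chasles q a b c : cint q a b + cint q b c = cint q a c.
Proof. by rewrite /cint; set P := xget _ _; ring. Qed.

Lemma cprimD q Q q' Q' : cprim q Q -> cprim q' Q' ->
  cprim (fun t => q t + q' t) (fun t => Q t + Q' t).
Proof.
move=> HQ HQ' t; have [a b] := HQ t; have [a' b'] := HQ' t; split.
- rewrite (_ : (fun _ => _) = (fun s => complex.Re (Q s)) + (fun s => complex.Re (Q' s))).
    by rewrite (_ : complex.Re _ = complex.Re (q t) + complex.Re (q' t)); [exact: is_deriveD|case: (q t); case: (q' t)].
  by apply/funext => s /=; rewrite /= -[RHS]/(complex.Re (Q s) + complex.Re (Q' s)); case: (Q s); case: (Q' s).
- rewrite (_ : (fun _ => _) = (fun s => complex.Im (Q s)) + (fun s => complex.Im (Q' s))).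
    by rewrite (_ : complex.Im _ = complex.Im (q t) + complex.Im (q' t)); [exact: is_deriveD|case: (q t); case: (q' t)].
  by apply/funext => s /=; rewrite /= -[RHS]/(complex.Im (Q s) + complex.Im (Q' s)); case: (Q s); case: (Q' s).
Qed.

Lemma cprimZ k q Q : cprim q Q -> cprim (fun t => k * q t) (fun t => k * Q t).
Proof.
move=> HQ t; have [a b] := HQ t; case: k => k1 k2.
have E1 s : complex.Re ((k1 +i* k2) * Q s) = (k1 *: (fun s => complex.Re (Q s)) - k2 *: (fun s => complex.Im (Q s))) s.
  by rewrite -[RHS]/(k1 * complex.Re (Q s) - k2 * complex.Im (Q s)); case: (Q s).
have E2 s : complex.Im ((k1 +i* k2) * Q s) = (k1 *: (fun s => complex.Im (Q s)) + k2 *: (fun s => complex.Re (Q s))) s.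
  by rewrite -[RHS]/(k1 * complex.Im (Q s) + k2 * complex.Re (Q s)); case: (Q s).
split.
- rewrite (funext E1) (_ : complex.Re _ = k1 *: complex.Re (q t) - k2 *: complex.Im (q t)); last by case: (q t).
  by apply: is_deriveB; exact: is_deriveZ.
- rewrite (funext E2) (_ : complex.Im _ = k1 *: complex.Im (q t) + k2 *: complex.Re (q t)); last by case: (q t).
  by apply: is_deriveD; exact: is_deriveZ.
Qed.

Lemma cintD q q' a b : ccont q -> ccont q' ->
  cint (fun t => q t + q' t) a b = cint q a b + cint q' a b.
Proof.
move=> /ccont_cprim[Q HQ] /ccont_cprim[Q' HQ'].
by rewrite (cintE _ _ HQ) (cintE _ _ HQ') (cintE _ _ (cprimD HQ HQ')); ring.
Qed.

Lemma cintZ k q a b : ccont q -> cint (fun t => k * q t) a b = k * cint q a b.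
Proof.
move=> /ccont_cprim[Q HQ].
by rewrite (cintE _ _ HQ) (cintE _ _ (cprimZ k HQ)); ring.
Qed.

Lemma cint_le q a b M : a <= b -> ccont q ->
  (forall t, a <= t <= b -> cmod (q t) <= M) -> cmod (cint q a b) <= 2 * M * (b - a).
Proof.
move=> ab /ccont_cprim[Q HQ] HM; rewrite (cintE _ _ HQ).
have key (F f : R -> R) : (forall x : R, is_derive x 1 F (f x)) ->
    (forall t, a <= t <= b -> `|f t| <= M) -> `|F b - F a| <= M * (b - a).
  move=> HF HfM; have [|c + ->] := MVT_segment ab (fun x _ => HF x).
    exact/continuous_subspaceT/(is_derive_continuous HF).
  rewrite in_itv /= => /HfM; rewrite normrM (ger0_norm (_ : 0 <= b - a)) ?subr_ge0//.
  by move=> cM; apply: ler_wpM2r => //; rewrite subr_ge0.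
apply: le_trans (le_cmod_ReIm _) _.
have K1 := key _ _ (fun x => (HQ x).1) (fun t ht => le_trans (ge_Re_cmod _) (HM t ht)).
have K2 := key _ _ (fun x => (HQ x).2) (fun t ht => le_trans (ge_Im_cmod _) (HM t ht)).
move: K1 K2; case: (Q b) (Q a) => [? ?] [? ?] /= K1 K2; lra.
Qed.

End LineIntegral.

(** * Goursat's theorem *)

Section Goursat.
Variable R : realType.
Local Notation C := R[i].
Implicit Types (f g : C -> C) (z w l k p v : C).

Definition ccontinuous f := forall z (e : R), 0 < e ->
  exists2 d : R, 0 < d & forall h : C, cmod h < d -> cmod (f (z + h) - f z) < e.

Lemma hlineE (t y : R) : t +i* y = 0 +i* y + t%:C * 1 :> C.
Proof. by rewrite mulr1; apply/eqP; rewrite eq_complex /= add0r addr0 !eqxx. Qed.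

Lemma vlineE (x t : R) : x +i* t = x%:C + t%:C * 'i :> C.
Proof.
by apply/eqP; rewrite eq_complex /= !(mulr0, mul0r, mulr1, addr0, add0r, subr0) !eqxx.
Qed.

Lemma cdiff_hline f (t y : R) l : cdiff f (t +i* y) l ->
  is_derive t 1 (fun s => complex.Re (f (s +i* y))) (complex.Re l) /\
  is_derive t 1 (fun s => complex.Im (f (s +i* y))) (complex.Im l).
Proof.
rewrite (hlineE t) => /cdiff_line; rewrite mulr1.
have -> : (fun s => complex.Re (f (s +i* y))) = (fun s => complex.Re (f (0 +i* y + s%:C * 1))).
  by apply/funext => s; rewrite -hlineE.
have -> : (fun s => complex.Im (f (s +i* y))) = (fun s => complex.Im (f (0 +i* y + s%:C * 1))).
  by apply/funext => s; rewrite -hlineE.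
by [].
Qed.

Lemma cdiff_vline f (x t : R) l : cdiff f (x +i* t) l ->
  is_derive t 1 (fun s => complex.Re (f (x +i* s))) (complex.Re ('i * l)) /\
  is_derive t 1 (fun s => complex.Im (f (x +i* s))) (complex.Im ('i * l)).
Proof.
rewrite (vlineE x t) => /cdiff_line; rewrite mulrC.
have -> : (fun s => complex.Re (f (x +i* s))) = (fun s => complex.Re (f (x%:C + s%:C * 'i))).
  by apply/funext => s; rewrite -vlineE.
have -> : (fun s => complex.Im (f (x +i* s))) = (fun s => complex.Im (f (x%:C + s%:C * 'i))).
  by apply/funext => s; rewrite -vlineE.
by [].
Qed.

Lemma ccont_line f p v : (forall (t e : R), 0 < e ->
    exists2 d : R, 0 < d & forall h : C, cmod h < d ->
      cmod (f (p + t%:C * v + h) - f (p + t%:C * v)) < e) ->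
  ccont (fun t => f (p + t%:C * v)).
Proof.
move=> H.
have K (t e : R) : 0 < e -> exists2 d : R, 0 < d & forall h : R, `|h| < d ->
    cmod (f (p + (t + h)%:C * v) - f (p + t%:C * v)) < e.
  move=> e0; have v1 : 0 < cmod v + 1 by rewrite ltr_wpDl// cmod_ge0.
  have [d d0 Hd] := H t e e0.
  exists (d / (cmod v + 1)); first exact: divr_gt0.
  move=> h; rewrite ltr_pdivlMr// => hd.
  have hv : cmod (h%:C * v) <= `|h| * (cmod v + 1).
    by rewrite cmodM cmod_real ler_wpM2l// lerDl.
  have := Hd (h%:C * v) (le_lt_trans hv hd).
  have -> // : p + t%:C * v + h%:C * v = p + (t + h)%:C * v.
  by rewrite -addrA -mulrDl -rmorphD.
split=> t; apply/cvgrPdist_lt => e /(K t)[d d0 Hd]; apply/near_normP; exists d => // h /Hd;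
  apply: le_lt_trans; rewrite distrC.
- apply: le_trans (ge_Re_cmod _); rewrite le_eqVlt; apply/orP; left; apply/eqP; congr (`|_|).
  by case: (f _) (f _) => [? ?] [? ?].
- apply: le_trans (ge_Im_cmod _); rewrite le_eqVlt; apply/orP; left; apply/eqP; congr (`|_|).
  by case: (f _) (f _) => [? ?] [? ?].
Qed.

Lemma ccont_hline f y : ccontinuous f -> ccont (fun t => f (t +i* y)).
Proof.
move=> H; rewrite (_ : (fun _ => _) = fun t => f (0 +i* y + t%:C * 1)).
  by apply: ccont_line => t; exact: H.
by apply/funext => t; rewrite -hlineE.
Qed.

Lemma ccont_vline f x : ccontinuous f -> ccont (fun t => f (x +i* t)).
Proof.
move=> H; rewrite (_ : (fun _ => _) = fun t => f (x%:C + t%:C * 'i)).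
  by apply: ccont_line => t; exact: H.
by apply/funext => t; rewrite -vlineE.
Qed.

Lemma ccontinuousD f g : ccontinuous f -> ccontinuous g ->
  ccontinuous (fun w => f w + g w).
Proof.
move=> Hf Hg z e e0; have e2 : 0 < e / 2 by rewrite divr_gt0.
have [a a0 Ha] := Hf z _ e2; have [b b0 Hb] := Hg z _ e2.
exists (Num.min a b); first by rewrite lt_min a0.
move=> h; rewrite lt_min => /andP[/Ha ha /Hb hb].
by rewrite opprD addrACA; apply: le_lt_trans (cmodD _ _) _; lra.
Qed.

Lemma cdiff_ccontinuous f (f' : C -> C) :
  (forall z, cdiff f z (f' z)) -> ccontinuous f.
Proof. by move=> H z; exact: cdiff_continuous (H z). Qed.

Definition hint f (y a b : R) : C := cint (fun t => f (t +i* y)) a b.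
Definition vint f (x a b : R) : C := cint (fun t => f (x +i* t)) a b.

(** The integral of [f dz] along the boundary of [x1,x2] x [y1,y2]. *)
Definition rint f (x1 x2 y1 y2 : R) : C :=
  hint f y1 x1 x2 + 'i * vint f x2 y1 y2 - hint f y2 x1 x2 - 'i * vint f x1 y1 y2.

Lemma rint_splitx f m x1 x2 y1 y2 :
  rint f x1 x2 y1 y2 = rint f x1 m y1 y2 + rint f m x2 y1 y2.
Proof.
rewrite /rint /hint -!(cint_chasles _ x1 m x2); ring.
Qed.

Lemma rint_splity f m x1 x2 y1 y2 :
  rint f x1 x2 y1 y2 = rint f x1 x2 y1 m + rint f x1 x2 m y2.
Proof.
rewrite /rint /vint -!(cint_chasles _ y1 m y2); ring.
Qed.

Definition bcont f (x1 x2 y1 y2 : R) :=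
  [/\ ccont (fun t => f (t +i* y1)), ccont (fun t => f (t +i* y2)),
      ccont (fun t => f (x1 +i* t)) & ccont (fun t => f (x2 +i* t))].

Lemma ccontinuous_bcont f x1 x2 y1 y2 : ccontinuous f -> bcont f x1 x2 y1 y2.
Proof. by move=> cf; split; [exact: ccont_hline..|exact: ccont_vline|exact: ccont_vline]. Qed.

Lemma rintD f g x1 x2 y1 y2 : bcont f x1 x2 y1 y2 -> bcont g x1 x2 y1 y2 ->
  rint (fun w => f w + g w) x1 x2 y1 y2 = rint f x1 x2 y1 y2 + rint g x1 x2 y1 y2.
Proof.
move=> [? ? ? ?] [? ? ? ?]; rewrite /rint /hint /vint.
by rewrite !cintD//; ring.
Qed.

Lemma rintZ k f x1 x2 y1 y2 : bcont f x1 x2 y1 y2 ->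
  rint (fun w => k * f w) x1 x2 y1 y2 = k * rint f x1 x2 y1 y2.
Proof.
move=> [? ? ? ?]; rewrite /rint /hint /vint.
by rewrite !cintZ//; ring.
Qed.

Lemma rint_antiderivative f g x1 x2 y1 y2 :
  ccont (fun t => g (x1 +i* t)) -> ccont (fun t => g (x2 +i* t)) ->
  (forall t, cdiff f (t +i* y1) (g (t +i* y1))) ->
  (forall t, cdiff f (t +i* y2) (g (t +i* y2))) ->
  (forall t, cdiff f (x1 +i* t) (g (x1 +i* t))) ->
  (forall t, cdiff f (x2 +i* t) (g (x2 +i* t))) ->
  rint g x1 x2 y1 y2 = 0.
Proof.
move=> c1 c2.
have hE y : (forall t, cdiff f (t +i* y) (g (t +i* y))) ->
    hint g y x1 x2 = f (x2 +i* y) - f (x1 +i* y).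
  by move=> Hg; apply: (@cintE _ _ (fun t => f (t +i* y))) => t; exact: cdiff_hline.
have vE x : ccont (fun t => g (x +i* t)) -> (forall t, cdiff f (x +i* t) (g (x +i* t))) ->
    'i * vint g x y1 y2 = f (x +i* y2) - f (x +i* y1).
  by move=> cg Hg; rewrite -cintZ//; apply: (@cintE _ _ (fun t => f (x +i* t))) => t; exact: cdiff_vline.
by move=> H1 H2 H3 H4; rewrite /rint !hE// !vE//; ring.
Qed.

Lemma rint_le f x1 x2 y1 y2 M : x1 <= x2 -> y1 <= y2 -> bcont f x1 x2 y1 y2 ->
  (forall x y, x1 <= x <= x2 -> y1 <= y <= y2 ->
     (x == x1) || (x == x2) || (y == y1) || (y == y2) -> cmod (f (x +i* y)) <= M) ->
  cmod (rint f x1 x2 y1 y2) <= 4 * M * (x2 - x1 + (y2 - y1)).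
Proof.
move=> x12 y12 [? ? ? ?] HM.
have ci : cmod ('i : C) = 1 by rewrite /cmod /= expr0n add0r expr1n sqrtr1.
have h1 : cmod (hint f y1 x1 x2) <= 2 * M * (x2 - x1).
  by apply: cint_le => // t tx; apply: HM => //; rewrite ?eqxx ?orbT ?lexx.
have h2 : cmod (hint f y2 x1 x2) <= 2 * M * (x2 - x1).
  by apply: cint_le => // t tx; apply: HM => //; rewrite ?eqxx ?orbT ?lexx ?andbT.
have h3 : cmod ('i * vint f x1 y1 y2) <= 2 * M * (y2 - y1).
  rewrite cmodM ci mul1r.
  by apply: cint_le => // t tx; apply: HM => //; rewrite ?eqxx ?orbT ?lexx.
have h4 : cmod ('i * vint f x2 y1 y2) <= 2 * M * (y2 - y1).
  rewrite cmodM ci mul1r.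
  by apply: cint_le => // t tx; apply: HM => //; rewrite ?eqxx ?orbT ?lexx ?andbT.
rewrite /rint; move: h1 h2 h3 h4.
move: (hint f y1 x1 x2) (hint f y2 x1 x2) ('i * vint f x1 y1 y2) ('i * vint f x2 y1 y2).
move=> a b c d ha hb hc hd.
have t1 := cmodD (a + d - b) (- c); have t2 := cmodD (a + d) (- b).
have t3 := cmodD a d; rewrite !cmodN in t1 t2; lra.
Qed.

(** Goursat's bisection: a rectangle with nonzero boundary integral contains
    one of half the size with at least a quarter of that integral, and at the
    limit point the first order expansion of [f] leaves too little. *)
Lemma goursat f x1 x2 y1 y2 : x1 <= x2 -> y1 <= y2 -> ccontinuous f ->
  (forall x y, x1 <= x <= x2 -> y1 <= y <= y2 -> exists l, cdiff f (x +i* y) l) ->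
  rint f x1 x2 y1 y2 = 0.
Proof.
move=> x12 y12 cf df.
pose A n := (x2 - x1) / 2 ^+ n; pose B n := (y2 - y1) / 2 ^+ n.
have AS n : A n = A n.+1 + A n.+1.
  by rewrite /A exprS invfM; move: (2 ^- n) => u; field.
have BS n : B n = B n.+1 + B n.+1.
  by rewrite /B exprS invfM; move: (2 ^- n) => u; field.
have A0 n : 0 <= A n by rewrite divr_ge0 ?subr_ge0// exprn_ge0.
have B0 n : 0 <= B n by rewrite divr_ge0 ?subr_ge0// exprn_ge0.
pose rr n (p : R * R) := rint f p.1 (p.1 + A n) p.2 (p.2 + B n).
have step n (p : R * R) : exists p' : R * R,
    [/\ p.1 <= p'.1 <= p.1 + A n.+1, p.2 <= p'.2 <= p.2 + B n.+1 &
        cmod (rr n p) <= 4 * cmod (rr n.+1 p')].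
  case: p => x y; have a0 := A0 n.+1; have b0 := B0 n.+1.
  have E : rr n (x, y) = rr n.+1 (x, y) + rr n.+1 (x, y + B n.+1) +
      (rr n.+1 (x + A n.+1, y) + rr n.+1 (x + A n.+1, y + B n.+1)).
    rewrite /rr /= (AS n) (BS n) (rint_splitx f (x + A n.+1)).
    rewrite (rint_splity f (y + B n.+1) x) (rint_splity f (y + B n.+1) (x + A n.+1)).
    by rewrite !addrA.
  have t := cmodD (rr n.+1 (x, y) + rr n.+1 (x, y + B n.+1))
      (rr n.+1 (x + A n.+1, y) + rr n.+1 (x + A n.+1, y + B n.+1)).
  have t1 := cmodD (rr n.+1 (x, y)) (rr n.+1 (x, y + B n.+1)).
  have t2 := cmodD (rr n.+1 (x + A n.+1, y)) (rr n.+1 (x + A n.+1, y + B n.+1)).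
  rewrite -E in t.
  have [c1|c1] := leP (cmod (rr n (x, y))) (4 * cmod (rr n.+1 (x, y))).
    by exists (x, y); split=> //=; rewrite lexx lerDl.
  have [c2|c2] := leP (cmod (rr n (x, y))) (4 * cmod (rr n.+1 (x, y + B n.+1))).
    by exists (x, y + B n.+1); split=> //=; rewrite ?lexx lerDl ?andbT.
  have [c3|c3] := leP (cmod (rr n (x, y))) (4 * cmod (rr n.+1 (x + A n.+1, y))).
    by exists (x + A n.+1, y); split=> //=; rewrite ?lexx lerDl ?andbT.
  exists (x + A n.+1, y + B n.+1); split=> //=; rewrite ?lexx ?lerDl ?andbT//; lra.
have [nxt Hn] := choice (fun np : nat * (R * R) => step np.1 np.2).
pose P := fix P n := if n is m.+1 then nxt (m, P m) else (x1, y1).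
have PS n : [/\ (P n).1 <= (P n.+1).1 <= (P n).1 + A n.+1,
    (P n).2 <= (P n.+1).2 <= (P n).2 + B n.+1 &
        cmod (rr n (P n)) <= 4 * cmod (rr n.+1 (P n.+1))] by exact: (Hn (n, P n)).
have nest n m : [/\ (P n).1 <= (P (n + m)%N).1, (P (n + m)%N).1 + A (n + m)%N <= (P n).1 + A n,
   (P n).2 <= (P (n + m)%N).2 & (P (n + m)%N).2 + B (n + m)%N <= (P n).2 + B n].
  elim: m => [|m [h1 h2 h3 h4]]; first by rewrite addn0 !lexx.
  have [/andP[? ?] /andP[? ?] _] := PS (n + m)%N; have := AS (n + m)%N; have := BS (n + m)%N.
  by rewrite addnS => ? ?; split; lra.
have nest2 n m : (P n).1 <= (P m).1 + A m /\ (P n).2 <= (P m).2 + B m.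
  have [h1 h2 h3 h4] := nest n m; have [k1 k2 k3 k4] := nest m n.
  rewrite addnC in k1 k2 k3 k4.
  have := A0 (n + m)%N; have := B0 (n + m)%N; split; lra.
pose xs := sup (range (fun n => (P n).1)); pose ys := sup (range (fun n => (P n).2)).
have xsP n : (P n).1 <= xs <= (P n).1 + A n.
  apply/andP; split.
    apply: ub_le_sup; last by exists n.
    by exists ((P 0%N).1 + A 0%N) => _ [k _ <-]; have [] := nest2 k 0%N.
  apply: ge_sup; first by exists (P 0%N).1, 0%N.
  by move=> _ [k _ <-]; have [] := nest2 k n.
have ysP n : (P n).2 <= ys <= (P n).2 + B n.
  apply/andP; split.
    apply: ub_le_sup; last by exists n.
    by exists ((P 0%N).2 + B 0%N) => _ [k _ <-]; have [] := nest2 k 0%N.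
  apply: ge_sup; first by exists (P 0%N).2, 0%N.
  by move=> _ [k _ <-]; have [] := nest2 k n.
have A00 : A 0%N = x2 - x1 by rewrite /A expr0 divr1.
have B00 : B 0%N = y2 - y1 by rewrite /B expr0 divr1.
have [l dl] : exists l, cdiff f (xs +i* ys) l.
  apply: df.
    by have := xsP 0%N; rewrite A00 /=; lra.
  by have := ysP 0%N; rewrite B00 /=; lra.
have rrn n : cmod (rr 0%N (P 0%N)) <= 4 ^+ n * cmod (rr n (P n)).
  elim: n => [|n IH]; first by rewrite expr0 mul1r.
  have [_ _ h] := PS n; apply: le_trans IH _; rewrite exprSr -mulrA.
  by apply: ler_wpM2l => //; exact: exprn_ge0.
have S0 : 0 <= x2 - x1 + (y2 - y1) by lra.
have AB n : A n + B n = (x2 - x1 + (y2 - y1)) / 2 ^+ n by rewrite /A /B -mulrDl.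
have small : forall e : R, 0 < e ->
    cmod (rr 0%N (P 0%N)) <= 4 * (x2 - x1 + (y2 - y1)) ^+ 2 * e.
  move=> e e0; have [d d0 Hd] := dl _ e0.
  have [n nd] : exists n, A n + B n < d.
    have := @cvg_expr R (2^-1); rewrite ger0_norm// invf_lt1// ltr1n => /(_ isT).
    move=> /cvgrPdist_lt /(_ (d / (x2 - x1 + (y2 - y1) + 1))).
    rewrite divr_gt0 ?ltr_wpDl// => /(_ isT)[n _ /(_ n (leqnn n))] /=.
    rewrite sub0r normrN ger0_norm ?exprn_ge0// ltr_pdivlMr ?ltr_wpDl// exprVn => h.
    exists n; rewrite AB; apply: le_lt_trans h.
    by rewrite mulrC ler_wpM2l ?invr_ge0 ?exprn_ge0// lerDl.
  apply: le_trans (rrn n) _.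
  pose zs : C := xs +i* ys; pose g w := f zs + l * (w - zs).
  pose er w := f w - g w.
  have cg : ccontinuous g.
    apply: (@cdiff_ccontinuous _ (fun=> 0 + l * (1 - 0))) => w.
    apply: cdiffD; first exact: cdiff_cst.
    by apply: cdiffZ; apply: cdiffB; [exact: cdiff_id|exact: cdiff_cst].
  have cer : ccontinuous er.
    apply: ccontinuousD => //.
    move=> z e' e0'; have [d' d0' H] := cg z e' e0'; exists d' => // h /H.
    by rewrite -cmodN opprD.
  have -> : rr n (P n) = rint er (P n).1 ((P n).1 + A n) (P n).2 ((P n).2 + B n).
    rewrite /rr (_ : f = fun w => er w + g w); last by apply/funext => w; rewrite /er subrK.
    rewrite rintD; [|exact: ccontinuous_bcont..].
    rewrite [X in _ + X](_ : _ = 0) ?addr0//.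
    have dG w : cdiff (fun w => f zs * w + l / 2 * ((w - zs) * (w - zs))) w (g w).
      have -> : g w = f zs * 1 + l / 2 * ((w - zs) * (1 - 0) + (1 - 0) * (w - zs)).
        by rewrite /g; field.
      apply: cdiffD; first by apply: cdiffZ; exact: cdiff_id.
      apply: cdiffZ.
      by apply: cdiffM; apply: cdiffB; [exact: cdiff_id|exact: cdiff_cst|exact: cdiff_id|exact: cdiff_cst].
    by apply: (@rint_antiderivative _ g) => *; [exact: ccont_vline|exact: ccont_vline|exact: dG..].
  have erle x y : (P n).1 <= x <= (P n).1 + A n -> (P n).2 <= y <= (P n).2 + B n ->
      cmod (er (x +i* y)) <= e * (A n + B n).
    move=> hx hy; pose h : C := (x - xs) +i* (y - ys).
    have hE : x +i* y = zs + h by apply/eqP; rewrite eq_complex /= !subrKC !eqxx.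
    have hAB : cmod h <= A n + B n.
      apply: le_trans (le_cmod_ReIm _) _; rewrite /h /=.
      move: (xsP n) (ysP n) hx hy => /andP[? ?] /andP[? ?] /andP[? ?] /andP[? ?].
      by apply: lerD; rewrite ler_norml; apply/andP; split; lra.
    have := Hd h (le_lt_trans hAB nd); rewrite hE /er /g.
    rewrite (addrC zs h) addrK (addrC h) opprD addrA => /le_trans; apply.
    by apply: ler_wpM2l; [exact: ltW|].
  have := rint_le _ _ (ccontinuous_bcont _ _ _ _ cer) (fun x y hx hy _ => erle x y hx hy); rewrite !lerDl => /(_ (A0 n) (B0 n)).
  have subDK (a b : R) : a + b - a = b by rewrite addrC addKr.
  rewrite !subDK => h.
  apply: le_trans (ler_wpM2l _ h) _; first exact: exprn_ge0.
  rewrite !AB (_ : 4 ^+ n = 2 ^+ n * 2 ^+ n :> R); last first.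
    by rewrite -exprMn; congr (_ ^+ _); ring.
  have : 2 ^+ n != 0 :> R by rewrite expf_neq0.
  move: (2 ^+ n) => u u0; rewrite le_eqVlt; apply/orP; left; apply/eqP; field.
  exact: u0.
have r0 : rint f x1 x2 y1 y2 = rr 0%N (P 0%N).
  by rewrite /rr /= A00 B00 !subrKC.
apply/eqP; rewrite r0 -cmod_eq0 eq_le cmod_ge0 andbT.
apply/ler_addgt0Pr => e e0; rewrite add0r.
set S := 4 * (x2 - x1 + (y2 - y1)) ^+ 2.
have S1 : 0 < S + 1 by rewrite ltr_wpDl// mulr_ge0// sqr_ge0.
apply: le_trans (small (e / (S + 1)) (divr_gt0 e0 S1)) _.
rewrite -/S mulrCA -[leRHS]mulr1 ler_wpM2l ?(ltW e0)// ler_pdivrMr// mul1r; lra.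
Qed.

End Goursat.

(** * Cauchy's formula for a rectangle *)

Section CauchyFormula.
Variable R : realType.
Local Notation C := R[i].
Implicit Types (f g : C -> C) (z w l k p v a : C).

Lemma cdiff_near f g z l (d : R) : 0 < d ->
  (forall h : C, cmod h < d -> f (z + h) = g (z + h)) -> cdiff g z l -> cdiff f z l.
Proof.
move=> d0 fg H e e0; have [d' d'0 Hd] := H e e0.
exists (Num.min d d'); first by rewrite lt_min d0.
move=> h; rewrite lt_min => /andP[hd /Hd].
by rewrite fg// -[z in f z]addr0 fg ?cmod0// addr0.
Qed.

(** A single point of mere continuity is harmless: it can be enclosed in a
    square of arbitrarily small perimeter. *)
Lemma goursat_except f a x1 x2 y1 y2 : ccontinuous f ->
  (forall w, w != a -> exists l, cdiff f w l) ->
  x1 < complex.Re a < x2 -> y1 < complex.Im a < y2 -> rint f x1 x2 y1 y2 = 0.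
Proof.
case: a => a b cf df /= /andP[xa ax] /andP[yb By].
have dfx x y : x != a -> exists l, cdiff f (x +i* y) l.
  by move=> xa'; apply: df; rewrite eq_complex /= negb_and xa'.
have dfy x y : y != b -> exists l, cdiff f (x +i* y) l.
  by move=> yb'; apply: df; rewrite eq_complex /= negb_and yb' orbT.
pose M := cmod (f (a +i* b)) + 1.
have [d d0 Hd] := cf (a +i* b) 1 ltr01.
pose m := Num.min (d / 2) (Num.min (Num.min (a - x1) (x2 - a)) (Num.min (b - y1) (y2 - b))).
have m0 : 0 < m by rewrite !lt_min !subr_gt0 xa ax yb By divr_gt0.
have small s : 0 < s -> s < m -> cmod (rint f x1 x2 y1 y2) <= 16 * M * s.
  move=> s0; rewrite !lt_min => /andP[sd /andP[/andP[s1 s2] /andP[s3 s4]]].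
  rewrite (rint_splitx f (a - s)) (rint_splitx f (a + s) (a - s)).
  rewrite (@goursat _ f x1) ?add0r; [|lra|lra|exact: cf|]; last first.
    by move=> x y xx _; apply: dfx; rewrite lt_eqF//; lra.
  rewrite [X in _ + X](@goursat _ f) ?addr0; [|lra|lra|exact: cf|]; last first.
    by move=> x y xx _; apply: dfx; rewrite gt_eqF//; lra.
  rewrite (rint_splity f (b - s)) (rint_splity f (b + s) _ _ (b - s)).
  rewrite (@goursat _ f _ _ y1) ?add0r; [|lra|lra|exact: cf|]; last first.
    by move=> x y _ yy; apply: dfy; rewrite lt_eqF//; lra.
  rewrite [X in _ + X](@goursat _ f) ?addr0; [|lra|lra|exact: cf|]; last first.
    by move=> x y _ yy; apply: dfy; rewrite gt_eqF//; lra.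
  apply: le_trans (rint_le (M := M) _ _ _ _) _; [lra|lra|exact: ccontinuous_bcont| |lra].
  move=> x y /andP[xx1 xx2] /andP[yy1 yy2] _.
  have := Hd ((x - a) +i* (y - b)).
  have -> : a +i* b + ((x - a) +i* (y - b)) = x +i* y.
    by apply/eqP; rewrite eq_complex /= !subrKC !eqxx.
  have hh : cmod ((x - a) +i* (y - b)) < d.
    apply: le_lt_trans (le_cmod_ReIm _) _ => /=.
    apply: (@le_lt_trans _ _ (s + s)); last lra.
    by apply: lerD; rewrite ler_norml; apply/andP; split; lra.
  move=> /(_ hh); rewrite /M -{2}(subrK (f (a +i* b)) (f (x +i* y))).
  by have := cmodD (f (x +i* y) - f (a +i* b)) (f (a +i* b)); lra.
have M0 : 0 < M by rewrite ltr_wpDl// cmod_ge0.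
apply/eqP; rewrite -cmod_eq0 eq_le cmod_ge0 andbT.
apply/ler_addgt0Pr => e e0; rewrite add0r.
pose s := Num.min (m / 2) (e / (16 * M)).
have s0 : 0 < s by rewrite lt_min !divr_gt0// mulr_gt0.
apply: le_trans (small s s0 _) _.
  by apply: (@le_lt_trans _ _ (m / 2)); [rewrite ge_min lexx|lra].
by rewrite mulrC -ler_pdivlMr ?mulr_gt0// ge_min lexx orbT.
Qed.

Lemma cdiff_ccont_h f y : (forall t : R, exists l, cdiff f (t +i* y) l) ->
  ccont (fun t => f (t +i* y)).
Proof.
move=> H; rewrite (_ : (fun _ => _) = fun t => f (0 +i* y + t%:C * 1)).
  apply: ccont_line => t e e0; rewrite -hlineE; have [l Hl] := H t.
  by have [d d0 Hd] := cdiff_continuous Hl e0; exists d.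
by apply/funext => t; rewrite -hlineE.
Qed.

Lemma cdiff_ccont_v f x : (forall t : R, exists l, cdiff f (x +i* t) l) ->
  ccont (fun t => f (x +i* t)).
Proof.
move=> H; rewrite (_ : (fun _ => _) = fun t => f (x%:C + t%:C * 'i)).
  apply: ccont_line => t e e0; rewrite -vlineE; have [l Hl] := H t.
  by have [d d0 Hd] := cdiff_continuous Hl e0; exists d.
by apply/funext => t; rewrite -vlineE.
Qed.

Lemma entire_ccontinuous f : entire f -> ccontinuous f.
Proof. by move=> /entireP H; exact: cdiff_ccontinuous H. Qed.

Section Rectangle.
Variables x1 x2 y1 y2 : R.
Hypotheses (x12 : x1 < x2) (y12 : y1 < y2).

Definition inside z := (x1 < complex.Re z < x2) && (y1 < complex.Im z < y2).

Definition margin z : R := Num.min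
  (Num.min (complex.Re z - x1) (x2 - complex.Re z))
  (Num.min (complex.Im z - y1) (y2 - complex.Im z)).

Definition sides w := [|| complex.Re w == x1, complex.Re w == x2,
  complex.Im w == y1 | complex.Im w == y2].

Lemma margin_gt0 z : (0 < margin z) = inside z.
Proof. by rewrite /margin /inside !lt_min !subr_gt0. Qed.

Lemma margin_le z w : sides w -> margin z <= cmod (w - z).
Proof.
have h1 := ge_Re_cmod (w - z); have h2 := ge_Im_cmod (w - z).
case: w z h1 h2 => [u v] [x y] h1 h2 => /or4P[] /eqP /= wE; rewrite wE in h1 h2 *.
- by apply: le_trans h1; rewrite /margin /= !ge_min distrC ler_norm.
- by apply: le_trans h1; rewrite /margin /= !ge_min ler_norm orbT.
- by apply: le_trans h2; rewrite /margin /= !ge_min distrC ler_norm !orbT.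
- by apply: le_trans h2; rewrite /margin /= !ge_min ler_norm !orbT.
Qed.

Lemma sides_neq z w : inside z -> sides w -> w - z != 0.
Proof.
move=> iz sw; rewrite -cmod_gt0; apply: lt_le_trans (margin_le z sw).
by rewrite margin_gt0.
Qed.

Lemma inside_near z h : inside z -> cmod h < margin z -> inside (z + h).
Proof.
move=> iz; rewrite !lt_min => /andP[/andP[h1 h2] /andP[h3 h4]].
have a := ge_Re_cmod h; have b := ge_Im_cmod h.
case: z h iz h1 h2 h3 h4 a b => [x y] [u v] /= iz h1 h2 h3 h4.
rewrite !ler_norml /inside /= => /andP[? ?] /andP[? ?].
by apply/andP; split; apply/andP; split; lra.
Qed.

Lemma sides_bcont g : (forall w, sides w -> exists l, cdiff g w l) ->
  bcont g x1 x2 y1 y2.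
Proof.
by move=> H; split; [apply: cdiff_ccont_h|apply: cdiff_ccont_h|apply: cdiff_ccont_v|apply: cdiff_ccont_v];
  move=> t; apply: H; rewrite /sides /= eqxx ?orbT.
Qed.

Local Notation I g := (rint g x1 x2 y1 y2).

Lemma eq_rint f g : (forall w, sides w -> f w = g w) -> I f = I g.
Proof.
move=> fg; rewrite /rint /hint /vint.
have E1 : (fun t => f (t +i* y1)) = (fun t => g (t +i* y1)).
  by apply/funext => t; apply: fg; rewrite /sides /= eqxx ?orbT.
have E2 : (fun t => f (t +i* y2)) = (fun t => g (t +i* y2)).
  by apply/funext => t; apply: fg; rewrite /sides /= eqxx ?orbT.
have E3 : (fun t => f (x1 +i* t)) = (fun t => g (x1 +i* t)).
  by apply/funext => t; apply: fg; rewrite /sides /= eqxx ?orbT.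
have E4 : (fun t => f (x2 +i* t)) = (fun t => g (x2 +i* t)).
  by apply/funext => t; apply: fg; rewrite /sides /= eqxx ?orbT.
by rewrite E1 E2 E3 E4.
Qed.

(** The Cauchy transform of the boundary values of [f]. *)
Definition ctrans n f z := I (fun w => f w * ((w - z) ^+ n)^-1).

Lemma cdiffX f z l n : cdiff f z l ->
  cdiff (fun w => f w ^+ n) z (n%:R * f z ^+ n.-1 * l).
Proof.
move=> Hf; elim: n => [|n IH]; first by rewrite !mul0r; exact: cdiff_cst.
have := cdiffM Hf IH; rewrite (_ : (fun w => f w * f w ^+ n) = fun w => f w ^+ n.+1).
  congr cdiff; rewrite -[n.+1%:R]natr1; case: n {IH} => [|n] /=; rewrite ?expr0 ?exprS; ring.
by apply/funext => w; rewrite exprS.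
Qed.

Lemma cdiff_subz z w : cdiff (fun w => w - z) w 1.
Proof. by rewrite -[1]subr0; apply: cdiffB; [exact: cdiff_id|exact: cdiff_cst]. Qed.

Lemma cdiff_kernel n z w : w - z != 0 ->
  cdiff (fun w => ((w - z) ^+ n)^-1) w (- (n%:R * (w - z) ^+ n.-1) / ((w - z) ^+ n) ^+ 2).
Proof.
move=> wz; have := cdiffX n (cdiff_subz z w); rewrite mulr1 => /cdiffV; apply.
by rewrite expf_neq0.
Qed.

Lemma ctrans_bcont n f z : entire f -> inside z ->
  bcont (fun w => f w * ((w - z) ^+ n)^-1) x1 x2 y1 y2.
Proof.
move=> /entireP ef iz; apply: sides_bcont => w sw; eexists; apply: cdiffM; first exact: ef.
by apply: cdiff_kernel; exact: sides_neq.
Qed.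

Lemma cint_mvt (q : R -> C) (s t : R) : s <= t -> ccont q ->
  (exists2 c, s <= c <= t & complex.Re (cint q s t) = complex.Re (q c) * (t - s)) /\
  (exists2 c, s <= c <= t & complex.Im (cint q s t) = complex.Im (q c) * (t - s)).
Proof.
move=> st /ccont_cprim[Q HQ]; rewrite (cintE _ _ HQ).
have key (F g : R -> R) : (forall x : R, is_derive x 1 F (g x)) ->
    exists2 c, s <= c <= t & F t - F s = g c * (t - s).
  move=> HF; have [|c + E] := MVT_segment st (fun x _ => HF x).
    exact/continuous_subspaceT/(is_derive_continuous HF).
  by rewrite in_itv /= => cst; exists c.
split.
  have [c cst E] := key _ _ (fun x => (HQ x).1); exists c => //; rewrite -E.
  by case: (Q t) (Q s) => [? ?] [? ?].
have [c cst E] := key _ _ (fun x => (HQ x).2); exists c => //; rewrite -E.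
by case: (Q t) (Q s) => [? ?] [? ?].
Qed.

(** Seen from an interior point the argument increases along each side, so
    the imaginary part of the winding integral is positive. *)
Lemma winding_neq0 z : inside z -> ctrans 1 (fun=> 1) z != 0.
Proof.
move=> iz; have ec : entire (fun=> 1 : C) by apply: (cdiff_entire (g := fun=> 0)) => w; exact: cdiff_cst.
have [b1 b2 b3 b4] := ctrans_bcont 1 ec iz.
suff : 0 < complex.Im (ctrans 1 (fun=> 1) z) by apply: contraTneq => ->; rewrite /= ltxx.
have [_ [c1 c1P E1]] := cint_mvt (ltW x12) b1.
have [_ [c2 c2P E2]] := cint_mvt (ltW x12) b2.
have [[c3 c3P E3] _] := cint_mvt (ltW y12) b3.
have [[c4 c4P E4] _] := cint_mvt (ltW y12) b4.
have -> : complex.Im (ctrans 1 (fun=> 1) z) =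
    complex.Im (hint (fun w => 1 * ((w - z) ^+ 1)^-1) y1 x1 x2)
    + complex.Re (vint (fun w => 1 * ((w - z) ^+ 1)^-1) x2 y1 y2)
    - complex.Im (hint (fun w => 1 * ((w - z) ^+ 1)^-1) y2 x1 x2)
    - complex.Re (vint (fun w => 1 * ((w - z) ^+ 1)^-1) x1 y1 y2).
  rewrite /ctrans /rint.
  move: (hint _ y1 _ _) (hint _ y2 _ _) (vint _ x1 _ _) (vint _ x2 _ _).
  by move=> [? ?] [? ?] [? ?] [? ?] /=; ring.
rewrite /hint /vint E1 E2 E3 E4 !mul1r !expr1.
have nz w : sides w -> 0 < complex.Re (w - z) ^+ 2 + complex.Im (w - z) ^+ 2.
  by move=> sw; rewrite -sqr_cmod exprn_gt0// cmod_gt0 sides_neq.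
have n1 := nz (c1 +i* y1); have n2 := nz (c2 +i* y2).
have n3 := nz (x1 +i* c3); have n4 := nz (x2 +i* c4).
rewrite /sides /= !eqxx !orbT /= in n1 n2 n3 n4.
case: z iz {ec b1 b2 b3 b4 E1 E2 E3 E4 nz} n1 n2 n3 n4 => a b.
move=> /andP[/andP[/= ? ?] /andP[/= ? ?]] n1 n2 n3 n4.
rewrite /=.
have H (p q r : R) : 0 < p -> 0 < q -> 0 < r -> 0 < p / q * r.
  by move=> *; rewrite mulr_gt0// divr_gt0.
have := H (b - y1) _ (x2 - x1) _ (n1 isT) _; have := H (y2 - b) _ (x2 - x1) _ (n2 isT) _.
have := H (a - x1) _ (y2 - y1) _ (n3 isT) _; have := H (x2 - a) _ (y2 - y1) _ (n4 isT) _.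
rewrite !subr_gt0 => /(_ _ _)/wrap[//|//|k4] /(_ _ _)/wrap[//|//|k3] /(_ _ _)/wrap[//|//|k2] /(_ _ _)/wrap[//|//|k1].
lra.
Qed.

Lemma cauchy_formula f z : entire f -> inside z ->
  f z * ctrans 1 (fun=> 1) z = ctrans 1 f z.
Proof.
move=> ef iz; have /entireP df := ef.
have ec : entire (fun=> 1 : C) by apply: (cdiff_entire (g := fun=> 0)) => w; exact: cdiff_cst.
pose q w := if w == z then cderiv f z else (f w - f z) / (w - z).
have dq w : w != z -> exists l, cdiff q w l.
  move=> wz; have wz0 : w - z != 0 by rewrite subr_eq0.
  have : exists l, cdiff (fun w => (f w - f z) / (w - z)) w l.
    eexists; apply: cdiffM; first by apply: cdiffB; [exact: df|exact: cdiff_cst].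
    exact: (@cdiffV _ (fun w => w - z) w 1 wz0 (cdiff_subz z w)).
  move=> [l Hl]; exists l; apply: (cdiff_near (d := cmod (w - z))) Hl; first by rewrite cmod_gt0.
  move=> h hw; rewrite /q ifN//; apply: contraTneq hw => <-.
  by rewrite opprD addNKr cmodN ltxx.
have cq : ccontinuous q.
  move=> w e e0; have [->|wz] := eqVneq w z; last first.
    by have [l Hl] := dq w wz; exact: cdiff_continuous Hl _ e0.
  have [d d0 Hd] := df z _ (divr_gt0 e0 (ltr0n _ 2)); exists d => // h hd.
  rewrite /q eqxx; have [->|h0] := eqVneq h 0; first by rewrite addr0 eqxx subrr cmod0.
  rewrite ifN; last by rewrite -subr_eq0 addrC addKr.
  have := Hd h hd; rewrite (_ : z + h - z = h); last by rewrite addrC addKr.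
  rewrite -[X in cmod X](_ : ((f (z + h) - f z) / h - cderiv f z) * h = _); last first.
    by rewrite mulrBl mulfVK.
  by rewrite cmodM ler_pM2r ?cmod_gt0// => /le_lt_trans; apply; lra.
have [iz1 iz2] := andP iz.
have := goursat_except cq dq iz1 iz2.
rewrite (@eq_rint q (fun w => f w * ((w - z) ^+ 1)^-1 + - f z * (1 * ((w - z) ^+ 1)^-1))).
  have bf := ctrans_bcont 1 ef iz; have b1 := ctrans_bcont 1 ec iz.
  have b2 : bcont (fun w => - f z * (1 * ((w - z) ^+ 1)^-1)) x1 x2 y1 y2.
    have ec' : entire (fun=> - f z : C).
      by apply: (cdiff_entire (g := fun=> 0)) => w; exact: cdiff_cst.
    have := ctrans_bcont 1 ec' iz.
    by rewrite (_ : (fun w => _) = fun w => - f z * (1 * ((w - z) ^+ 1)^-1))//; apply/funext => w; rewrite mul1r.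
  by rewrite (rintD bf b2) (rintZ _ b1) mulNr => /eqP; rewrite subr_eq0 => /eqP.
move=> w sw; have := sides_neq iz sw; rewrite subr_eq0 /q => /negPf ->.
by rewrite expr1 mul1r -mulrDl.
Qed.

End Rectangle.
End CauchyFormula.

(** * Derivatives and zeros of entire functions *)

Section EntireFunctions.
Variable R : realType.
Local Notation C := R[i].
Implicit Types (f g u : C -> C) (z w l p v a : C).

Lemma entire_cst (k : C) : entire (fun=> k).
Proof. by apply: (cdiff_entire (g := fun=> 0)) => w; exact: cdiff_cst. Qed.

Lemma ccont_bounded (q : R -> C) (s t : R) : s <= t -> ccont q ->
  exists M : R, forall r, s <= r <= t -> cmod (q r) <= M.
Proof.
move=> st [c1 c2].
have cF : {within `[s, t], continuous (fun r => `|complex.Re (q r)| + `|complex.Im (q r)|)}.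
  apply: continuous_subspaceT => r.
  apply: cvgD; apply: cvg_norm; [exact: c1|exact: c2].
have [c _ cM] := EVT_max st cF; eexists => r rst.
by apply: le_trans (le_cmod_ReIm _) _; apply: cM; rewrite in_itv.
Qed.

Section Rectangle.
Variables x1 x2 y1 y2 : R.
Hypotheses (x12 : x1 < x2) (y12 : y1 < y2).
Local Notation inside := (inside x1 x2 y1 y2).
Local Notation margin := (margin x1 x2 y1 y2).
Local Notation ctrans := (ctrans x1 x2 y1 y2).

Lemma boundary_bounded f : entire f -> exists2 M : R, 0 <= M &
  forall x y, x1 <= x <= x2 -> y1 <= y <= y2 ->
     (x == x1) || (x == x2) || (y == y1) || (y == y2) -> cmod (f (x +i* y)) <= M.
Proof.
move=> /entire_ccontinuous cf.
have [M1 H1] := ccont_bounded (ltW x12) (ccont_hline y1 cf).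
have [M2 H2] := ccont_bounded (ltW x12) (ccont_hline y2 cf).
have [M3 H3] := ccont_bounded (ltW y12) (ccont_vline x1 cf).
have [M4 H4] := ccont_bounded (ltW y12) (ccont_vline x2 cf).
have M0 : 0 <= M1 by apply: le_trans (H1 x1 _); [exact: cmod_ge0|rewrite lexx ltW].
exists (Num.max (Num.max M1 M2) (Num.max M3 M4)); first by rewrite !le_max M0.
move=> x y hx hy /orP[/orP[/orP[]|]|] /eqP e; rewrite e !le_max.
- by rewrite (H3 _ hy) !orbT.
- by rewrite (H4 _ hy) !orbT.
- by rewrite (H1 _ hx).
- by rewrite (H2 _ hx) orbT.
Qed.

Lemma kernel_expansion n (d : R) : (n == 1) || (n == 2) -> 0 < d ->
  exists2 K : R, 0 <= K & forall v h : C, d <= cmod v -> cmod h <= d / 2 ->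
    cmod (((v - h) ^+ n)^-1 - (v ^+ n)^-1 - n%:R * h * (v ^+ n.+1)^-1)
      <= K * cmod h ^+ 2.
Proof.
move=> n12 d0.
have ab (v h : C) : d <= cmod v -> cmod h <= d / 2 ->
    [/\ (v - h)^-1 - v^-1 = h * (v - h)^-1 * v^-1, cmod (v - h)^-1 <= 2 / d & cmod v^-1 <= 1 / d].
  move=> dv hd.
  have v0 : v != 0 by rewrite -cmod_gt0; apply: lt_le_trans dv.
  have vh : d / 2 <= cmod (v - h) by have := ler_cmodB v h; lra.
  have vh0 : v - h != 0 by rewrite -cmod_gt0; apply: lt_le_trans vh; rewrite divr_gt0.
  split; first by field; rewrite ?v0 ?vh0.
    by rewrite cmodV -invf_div lef_pV2// posrE ?divr_gt0// (lt_le_trans _ vh)// divr_gt0.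
  by rewrite cmodV div1r lef_pV2// posrE (lt_le_trans _ dv).
case/orP: n12 => /eqP ->.
- exists (2 / d * (1 / d) ^+ 2); first by rewrite mulr_ge0 ?exprn_ge0 ?divr_ge0// ltW.
  move=> v h dv hd; have [E ha hb] := ab v h dv hd.
  rewrite !expr1 -exprVn.
  move: E ha hb; move: (v - h)^-1 v^-1 => {}a b E ha hb.
  have -> : a - b - 1 * h * b ^+ 2 = h ^+ 2 * (a * b ^+ 2).
    have -> : a - b - 1 * h * b ^+ 2 = h * b * (a - b).
      by rewrite mul1r E; move: E => /eqP; rewrite subr_eq => /eqP {1}->; ring.
    by rewrite E; ring.
  rewrite cmodM cmodX mulrC ler_wpM2r ?exprn_ge0 ?cmod_ge0// cmodM cmodX.
  by apply: ler_pM; rewrite ?exprn_ge0 ?cmod_ge0// lerXn2r// nnegrE ?cmod_ge0// divr_ge0// ltW.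
- exists (2 / d * (1 / d) ^+ 2 * (2 / d + 2 * (1 / d))).
    have d1 : 0 <= 1 / d by rewrite divr_ge0// ltW.
    have d2 : 0 <= 2 / d by rewrite divr_ge0// ltW.
    by apply: mulr_ge0; [apply: mulr_ge0; rewrite ?exprn_ge0|apply: addr_ge0 => //; apply: mulr_ge0].
  move=> v h dv hd; have [E ha hb] := ab v h dv hd.
  rewrite -!exprVn.
  move: E ha hb; move: (v - h)^-1 v^-1 => {}a b E ha hb.
  have -> : a ^+ 2 - b ^+ 2 - 2%:R * h * b ^+ 3 = h ^+ 2 * (a * b ^+ 2 * (a + 2 * b)).
    have -> : a ^+ 2 - b ^+ 2 - 2%:R * h * b ^+ 3 = (a - b) * (a + b) - 2 * h * b ^+ 3 by ring.
    rewrite E (_ : _ - _ = h * b * (a - b) * (a + 2 * b)); last by ring.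
    by rewrite E; ring.
  rewrite cmodM cmodX mulrC ler_wpM2r ?exprn_ge0 ?cmod_ge0// cmodM (cmodM a) cmodX.
  have d1 : 0 <= 1 / d by rewrite divr_ge0// ltW.
  apply: ler_pM; rewrite ?mulr_ge0 ?exprn_ge0 ?cmod_ge0//.
    by apply: ler_pM; rewrite ?exprn_ge0 ?cmod_ge0// lerXn2r// nnegrE ?cmod_ge0.
  apply: le_trans (cmodD _ _) _; rewrite lerD// cmodM.
  have -> : cmod (2 : C) = 2.
    by rewrite -(rmorph_nat (real_complex R) 2) cmod_real ger0_norm.
  by rewrite ler_wpM2l.
Qed.

Lemma ctrans_cdiff n f z : (n == 1) || (n == 2) -> entire f -> inside z ->
  cdiff (ctrans n f) z (n%:R * ctrans n.+1 f z).
Proof.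
move=> n12 ef iz e e0.
have [M M0 HM] := boundary_bounded ef.
have m0 : 0 < margin z by rewrite margin_gt0.
have [K K0 HK] := kernel_expansion n12 m0.
pose c := 4 * (M * K) * (x2 - x1 + (y2 - y1)).
have S0 : 0 <= x2 - x1 + (y2 - y1) by rewrite addr_ge0// subr_ge0 ltW.
have c0 : 0 <= c by rewrite /c; apply: mulr_ge0 => //; apply: mulr_ge0 => //; exact: mulr_ge0.
have c1 : 0 < c + 1 by rewrite ltr_wpDl.
exists (Num.min (margin z / 2) (e / (c + 1))); first by rewrite lt_min !divr_gt0.
move=> h; rewrite lt_min => /andP[hm he].
have izh : inside (z + h) by apply: inside_near => //; lra.
have b0 := ctrans_bcont n ef iz; have b1 := ctrans_bcont n ef izh.
have b2 := ctrans_bcont n.+1 ef iz.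
have bZ (k : C) (g : C -> C) : bcont g x1 x2 y1 y2 -> bcont (fun w => k * g w) x1 x2 y1 y2.
  have cZ (q : R -> C) : ccont q -> ccont (fun t => k * q t).
    move=> [q1 q2]; split=> t.
      rewrite (_ : (fun t => complex.Re _) = fun t => complex.Re k * complex.Re (q t) - complex.Im k * complex.Im (q t)).
        by apply: cvgB; apply: cvgM; [exact: cvg_cst|exact: q1|exact: cvg_cst|exact: q2].
      by apply/funext => s; case: k (q s) => [? ?] [? ?].
    rewrite (_ : (fun t => complex.Im _) = fun t => complex.Re k * complex.Im (q t) + complex.Im k * complex.Re (q t)).
      by apply: cvgD; apply: cvgM; [exact: cvg_cst|exact: q2|exact: cvg_cst|exact: q1].
    by apply/funext => s; case: k (q s) => [? ?] [? ?].
  by move=> [? ? ? ?]; split; exact: (cZ (fun t => g _)).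
have cD (q q' : R -> C) : ccont q -> ccont q' -> ccont (fun t => q t + q' t).
  move=> [q1 q2] [r1 r2]; split=> t.
    rewrite (_ : (fun t => complex.Re _) = fun t => complex.Re (q t) + complex.Re (q' t)).
      by apply: cvgD; [exact: q1|exact: r1].
    by apply/funext => s; case: (q s) (q' s) => [? ?] [? ?].
  rewrite (_ : (fun t => complex.Im _) = fun t => complex.Im (q t) + complex.Im (q' t)).
    by apply: cvgD; [exact: q2|exact: r2].
  by apply/funext => s; case: (q s) (q' s) => [? ?] [? ?].
have bD (g g' : C -> C) : bcont g x1 x2 y1 y2 -> bcont g' x1 x2 y1 y2 ->
    bcont (fun w => g w + g' w) x1 x2 y1 y2.
  by move=> [? ? ? ?] [? ? ? ?]; split; exact: (cD (fun t => g _) (fun t => g' _)).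
pose E w := f w * ((w - (z + h)) ^+ n)^-1 + (-1 * (f w * ((w - z) ^+ n)^-1)
  + - (n%:R * h) * (f w * ((w - z) ^+ n.+1)^-1)).
have EE : ctrans n f (z + h) - ctrans n f z - n%:R * ctrans n.+1 f z * h = rint E x1 x2 y1 y2.
  rewrite /E (rintD b1 (bD _ _ (bZ _ _ b0) (bZ _ _ b2))) (rintD (bZ _ _ b0) (bZ _ _ b2)).
  have abs p q r : p - q - n%:R * r * h = p + (-1 * q + - (n%:R * h) * r) :> C by ring.
  by rewrite (rintZ _ b0) (rintZ _ b2); exact: abs.
rewrite EE.
have bE : bcont E x1 x2 y1 y2 := bD _ _ b1 (bD _ _ (bZ _ _ b0) (bZ _ _ b2)).
have Ele : forall x y, x1 <= x <= x2 -> y1 <= y <= y2 ->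
   (x == x1) || (x == x2) || (y == y1) || (y == y2) ->
   cmod (E (x +i* y)) <= M * (K * cmod h ^+ 2).
  move=> x y hx hy sw.
  have sw' : sides x1 x2 y1 y2 (x +i* y) by move: sw; rewrite /sides /= -!orbA.
  rewrite (_ : E _ = f (x +i* y) * (((x +i* y - z - h) ^+ n)^-1 - ((x +i* y - z) ^+ n)^-1 - n%:R * h * ((x +i* y - z) ^+ n.+1)^-1)).
    rewrite cmodM; apply: ler_pM; rewrite ?cmod_ge0//; first exact: HM.
    by apply: HK; [exact: margin_le|exact: ltW].
  have abs (p q r s : C) : s * p + (-1 * (s * q) + - (n%:R * h) * (s * r)) = s * (p - q - n%:R * h * r).
    by ring.
  by rewrite (_ : x +i* y - z - h = x +i* y - (z + h)); [exact: abs|rewrite opprD addrA].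
apply: le_trans (rint_le (ltW x12) (ltW y12) bE Ele) _.
rewrite (_ : _ * _ * _ = c * cmod h * cmod h); last by rewrite /c expr2; ring.
apply: ler_wpM2r; rewrite ?cmod_ge0//.
move: he; rewrite ltr_pdivlMr// => he; have := cmod_ge0 h; lra.
Qed.

Lemma entire_cderiv_inside f z : entire f -> inside z -> exists l, cdiff (cderiv f) z l.
Proof.
move=> ef iz; have ec : entire (fun=> 1 : C) by exact: entire_cst.
pose c n := ctrans n (fun=> 1).
pose g w := (c 1 w)^-1 * ctrans 1 f w.
have dc n w : (n == 1) || (n == 2) -> inside w -> cdiff (c n) w (n%:R * c n.+1 w).
  by move=> n12 iw; apply: ctrans_cdiff.
have fg w : inside w -> f w = g w.
  move=> iw; rewrite /g -cauchy_formula// mulrC mulfK//.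
  exact: winding_neq0.
pose g' w := (c 1 w)^-1 * (1%:R * ctrans 2 f w) + (- (1%:R * c 2 w) / c 1 w ^+ 2) * ctrans 1 f w.
have dg w : inside w -> cdiff g w (g' w).
  move=> iw; apply: cdiffM; last exact: ctrans_cdiff.
  by apply: cdiffV; [exact: winding_neq0|exact: dc].
have f'g' w : inside w -> cderiv f w = g' w.
  move=> iw; apply: cderiv_cdiff; apply: (cdiff_near (d := margin w)) (dg w iw).
    by rewrite margin_gt0.
  by move=> h hw; apply: fg; exact: inside_near.
have : exists l, cdiff g' z l.
  have c0 : c 1 z != 0 by exact: winding_neq0.
  eexists; apply: cdiffD.
    apply: cdiffM; first by apply: cdiffV => //; exact: dc.
    by apply: cdiffZ; apply: ctrans_cdiff.
  apply: cdiffM; last exact: ctrans_cdiff.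
  apply: cdiffM; first by apply: cdiffN; apply: cdiffZ; exact: dc.
  apply: cdiffV; first by rewrite expf_neq0.
  by apply: cdiffX; exact: dc.
move=> [l Hl]; exists l; apply: (cdiff_near (d := margin z)) Hl; first by rewrite margin_gt0.
by move=> h hz; apply: f'g'; exact: inside_near.
Qed.

End Rectangle.

(** Cauchy's formula writes [f] as a Cauchy transform, up to the nonzero winding
    factor, and Cauchy transforms can be differentiated any number of times. *)
Theorem entire_cderiv f : entire f -> entire (cderiv f).
Proof.
move=> ef; pose B z := (complex.Re z - 1, complex.Re z + 1, complex.Im z - 1, complex.Im z + 1).
have H z : exists l, cdiff (cderiv f) z l.
  apply: (@entire_cderiv_inside (complex.Re z - 1) (complex.Re z + 1) (complex.Im z - 1) (complex.Im z + 1)) => //;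
    rewrite ?/inside; lra.
by have [g Hg] := choice H; exact: cdiff_entire Hg.
Qed.

Lemma complex_mvt f (f' : C -> C) p (h : C) (M : R) :
  (forall w, cdiff f w (f' w)) ->
  (forall t : R, 0 <= t <= 1 -> cmod (f' (p + t%:C * h)) <= M) ->
  cmod (f (p + h) - f p) <= 2 * M * cmod h.
Proof.
move=> df HM.
have HQ t := cdiff_line (df (p + t%:C * h)).
have key (F g : R -> R) : (forall x : R, is_derive x 1 F (g x)) ->
    (forall t, 0 <= t <= 1 -> `|g t| <= M * cmod h) -> `|F 1 - F 0| <= M * cmod h.
  move=> HF HfM; have [|c + ->] := MVT_segment ler01 (fun x _ => HF x).
    exact/continuous_subspaceT/(is_derive_continuous HF).
  by rewrite in_itv /= => /HfM; rewrite subr0 mulr1.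
have HM' t : 0 <= t <= 1 -> cmod (f' (p + t%:C * h) * h) <= M * cmod h.
  by move=> /HM ?; rewrite cmodM ler_wpM2r// cmod_ge0.
have K1 := key _ _ (fun x => (HQ x).1) (fun t ht => le_trans (ge_Re_cmod _) (HM' t ht)).
have K2 := key _ _ (fun x => (HQ x).2) (fun t ht => le_trans (ge_Im_cmod _) (HM' t ht)).
rewrite mul1r mul0r addr0 in K1 K2.
apply: le_trans (le_cmod_ReIm _) _.
by move: K1 K2; case: (f (p + h)) (f p) => [? ?] [? ?] /= K1 K2; lra.
Qed.

(** The difference quotient at [a] extends to an entire function: its
    differentiability at [a] is the second order Taylor expansion of [f]. *)
Lemma entire_factor f a : entire f -> f a = 0 ->
  exists2 u, entire u & forall w, f w = (w - a) * u w.
Proof.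
move=> ef fa0; have /entireP df := ef; have /entireP ddf := entire_cderiv ef.
pose f1 := cderiv f a; pose f2 := cderiv (cderiv f) a.
pose u w := if w == a then f1 else f w / (w - a).
exists u; last first.
  move=> w; rewrite /u; case: eqVneq => [->|wa]; first by rewrite fa0 subrr mul0r.
  by rewrite mulrCA mulfV ?mulr1// subr_eq0.
suff H : forall w, exists l, cdiff u w l by have [u' Hu] := choice H; exact: cdiff_entire Hu.
move=> w.
have [->|wa] := eqVneq w a; last first.
  have wa0 : w - a != 0 by rewrite subr_eq0.
  have : exists l, cdiff (fun w => f w / (w - a)) w l.
    eexists; apply: cdiffM; first exact: df.
    exact: (@cdiffV _ (fun w => w - a) w 1 wa0 (cdiff_subz a w)).
  move=> [l Hl]; exists l; apply: (cdiff_near (d := cmod (w - a))) Hl; first by rewrite cmod_gt0.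
  move=> h hw; rewrite /u ifN//; apply: contraTneq hw => <-.
  by rewrite opprD addNKr cmodN ltxx.
exists (f2 / 2) => e e0.
have [d d0 Hd] := ddf a _ (divr_gt0 e0 (ltr0n _ 2)); exists d => // h hd.
have [->|h0] := eqVneq h 0; first by rewrite addr0 subrr mulr0 subr0 cmod0 mulr0.
rewrite /u eqxx ifN; last by rewrite -subr_eq0 addrC addKr.
rewrite (_ : a + h - a = h); last by rewrite addrC addKr.
pose r w := f w - (f1 * w + f2 / 2 * ((w - a) * (w - a))).
pose r' w := cderiv f w - (f1 * 1 + f2 / 2 * ((w - a) * 1 + 1 * (w - a))).
have dr v : cdiff r v (r' v).
  apply: cdiffB; first exact: df.
  apply: cdiffD; first by apply: cdiffZ; exact: cdiff_id.
  by apply: cdiffZ; apply: cdiffM; exact: cdiff_subz.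
have : cmod (r (a + h) - r a) <= 2 * (e / 2 * cmod h) * cmod h.
  apply: complex_mvt dr _ => t /andP[t0 t1].
  have th : cmod (t%:C * h) <= cmod h.
    by rewrite cmodM cmod_real ger0_norm// ler_piMl ?cmod_ge0.
  have := Hd (t%:C * h) (le_lt_trans th hd).
  rewrite (_ : cderiv f _ - _ - _ = r' (a + t%:C * h)); last first.
    by rewrite /r' -/f1 -/f2; field.
  move=> /le_trans; apply; apply: ler_wpM2l => //; lra.
rewrite (_ : r (a + h) - r a = (f (a + h) / h - f1 - f2 / 2 * h) * h); last first.
  by rewrite /r fa0; field.
rewrite cmodM ler_pM2r ?cmod_gt0// => /le_trans; apply.
by rewrite mulrCA mulrA divfK.
Qed.

(** A function with unboundedly many zeros (with multiplicity) in a bounded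
    set vanishes: comparing the Cauchy formula for the cofactor on a large
    square gains a factor 1/3 per zero. *)
Theorem entire_finite_factor f (r : R) : entire f -> (exists w, f w != 0) ->
  exists (s : seq C) u, [/\ entire u,
    forall w, f w = (\prod_(a <- s) (w - a)) * u w,
    forall a, a \in s -> cmod a <= r & forall w, cmod w <= r -> u w != 0].
Proof.
move=> ef [w0 fw0].
pose r1 := Num.max r 0 + cmod w0 + 1.
have r1r : r <= r1 by rewrite /r1; have := cmod_ge0 w0; have : r <= Num.max r 0 by [rewrite le_max lexx]; lra.
have r1w : cmod w0 < r1 by rewrite /r1; have : 0 <= Num.max r 0 by [rewrite le_max lexx orbT]; lra.
have r10 : 0 < r1 by apply: le_lt_trans r1w; exact: cmod_ge0.
pose fac (s : seq C) u := [/\ entire u,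
    forall w, f w = (\prod_(a <- s) (w - a)) * u w & forall a, a \in s -> cmod a <= r].
have [n Hn] : exists n, forall s u, fac s u -> (size s <= n)%N.
  apply: contrapT => /forallNP H.
  pose b := 8 * r1.
  have bb : - b < b by rewrite /b; lra.
  have [M M0 HM] := boundary_bounded bb bb ef.
  have iw : inside (-b) b (-b) b w0.
    have h1 := ge_Re_cmod w0; have h2 := ge_Im_cmod w0.
    move: h1 h2; rewrite !ler_norml /inside => /andP[? ?] /andP[? ?].
    by rewrite /b; apply/andP; split; apply/andP; split; lra.
  pose m := margin (-b) b (-b) b w0.
  have m0 : 0 < m by rewrite margin_gt0.
  pose c := cmod (ctrans (-b) b (-b) b 1 (fun=> 1) w0).
  have c0 : 0 < c by rewrite cmod_gt0 winding_neq0.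
  pose D := 4 * (M / m) * (b + b + (b + b)) / c.
  have D0 : 0 <= D.
    by rewrite /D divr_ge0 ?(ltW c0)// !mulr_ge0 ?invr_ge0 ?(ltW m0)// /b; lra.
  have small (k : nat) : cmod (f w0) <= D * 3^-1 ^+ k.
    have [s [u [[eu fu sr] ks]]] : exists s u, fac s u /\ (k < size s)%N.
      apply: contrapT => nH; apply: (H k) => s u su; rewrite leqNgt.
      by apply/negP => ks; apply: nH; exists s, u.
    have bnd x y : - b <= x <= b -> - b <= y <= b ->
       (x == - b) || (x == b) || (y == - b) || (y == b) ->
       cmod (u (x +i* y) * ((x +i* y - w0) ^+ 1)^-1) <= M / (6 * r1) ^+ size s / m.
      move=> hx hy sw.
      have sw' : sides (-b) b (-b) b (x +i* y) by move: sw; rewrite /sides /= -!orbA.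
      have big a : a \in s -> 6 * r1 <= cmod (x +i* y - a).
        move=> /sr ar; have : b <= cmod (x +i* y).
          have h1 := ge_Re_cmod (x +i* y); have h2 := ge_Im_cmod (x +i* y).
          rewrite /= in h1 h2; have b0 : 0 <= b by lra.
          by case/orP: sw => [/orP[/orP[]|]|] /eqP e;
            [apply: le_trans h1|apply: le_trans h1|apply: le_trans h2|apply: le_trans h2];
            rewrite e ?normrN ger0_norm.
        by have := ler_cmodB (x +i* y) a; rewrite /b; lra.
      rewrite cmodM expr1 cmodV; apply: ler_pM; rewrite ?invr_ge0 ?cmod_ge0//.
        have rs0 : 0 < (6 * r1) ^+ size s by rewrite exprn_gt0// mulr_gt0.
        rewrite ler_pdivlMr//; apply: le_trans (HM x y hx hy sw).
        rewrite fu cmodM mulrC ler_wpM2r ?cmod_ge0//.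
        elim: (s) big => [|a t IH] big; first by rewrite big_nil expr0 /cmod ComplexField.Normc.normc1.
        rewrite big_cons cmodM exprS; apply: ler_pM; rewrite ?exprn_ge0 ?mulr_ge0 ?(ltW r10)//.
          by apply: big; rewrite mem_head.
        by apply: IH => a' a't; apply: big; rewrite inE a't orbT.
      by rewrite lef_pV2 ?posrE// ?cmod_gt0 ?(sides_neq iw)//; exact: margin_le.
    have := rint_le (ltW bb) (ltW bb) (ctrans_bcont 1 eu iw) bnd.
    rewrite -/(ctrans (-b) b (-b) b 1 u w0) -(cauchy_formula eu iw) cmodM -/c => hu.
    have {}hu : cmod (u w0) <= D / (6 * r1) ^+ size s.
      rewrite -(ler_pM2r c0); apply: le_trans hu _; rewrite le_eqVlt; apply/orP; left; apply/eqP.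
      rewrite /D opprK; have : (6 * r1) ^+ size s != 0 by rewrite expf_neq0// gt_eqF// mulr_gt0.
      move: (_ ^+ _) => q q0; field; rewrite q0 /=.
      by apply/andP; split; rewrite gt_eqF.
    have hp : cmod (\prod_(a <- s) (w0 - a)) <= (2 * r1) ^+ size s.
      elim: (s) sr => [|a t IH] sr; first by rewrite big_nil expr0 /cmod ComplexField.Normc.normc1.
      rewrite big_cons cmodM exprS; apply: ler_pM; rewrite ?cmod_ge0//.
        have := sr a (mem_head _ _); have := cmodD w0 (- a); rewrite cmodN; lra.
      by apply: IH => a' a't; apply: sr; rewrite inE a't orbT.
    rewrite fu cmodM; apply: (@le_trans _ _ ((2 * r1) ^+ size s * (D / (6 * r1) ^+ size s))).
      by apply: ler_pM; rewrite ?cmod_ge0.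
    rewrite mulrCA -exprVn -exprMn (_ : 2 * r1 / (6 * r1) = 3^-1); last first.
      by field; rewrite gt_eqF.
    apply: ler_wpM2l => //.
    by rewrite ler_wiXn2l// ?invr_ge0// ?invf_le1// ?ler1n// ltnW.
  have : cmod (f w0) <= 0.
    have cv : (fun k : nat => D * 3^-1 ^+ k) @ \oo --> (D * 0 : R).
      by apply: cvgMr; apply: cvg_expr; rewrite ger0_norm ?invr_ge0// invf_lt1// ltr1n.
    rewrite mulr0 in cv; rewrite -(cvg_lim (@Rhausdorff R) cv).
    apply: limr_ge; first by apply/cvg_ex; exists 0.
    by apply: nearW => k; exact: small.
  by rewrite leNgt cmod_gt0 fw0.
have f0 : fac [::] f by split=> // w; rewrite big_nil mul1r.
have key (k : nat) : forall s u, fac s u -> (n <= size s + k)%N ->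
    exists s u, fac s u /\ forall w, cmod w <= r -> u w != 0.
  elim: k => [|k IH] s u su nk.
    exists s, u; split=> // w wr; apply/eqP => uw.
    have [eu fu sr] := su.
    have [v ev uv] := entire_factor eu uw.
    have /Hn : fac (w :: s) v.
      split=> // [z|a]; first by rewrite fu uv big_cons; ring.
      by rewrite inE => /orP[/eqP ->|/sr].
    by rewrite /= ltnNge; rewrite addn0 in nk; rewrite nk.
  have [[w wr uw]|nw] := pselect (exists2 w, cmod w <= r & u w = 0); last first.
    by exists s, u; split=> // w wr; apply/eqP => uw; apply: nw; exists w.
  have [eu fu sr] := su.
  have [v ev uv] := entire_factor eu uw.
  apply: (IH (w :: s) v); last by rewrite /= addSnnS.
  split=> // [z|a]; first by rewrite fu uv big_cons; ring.
  by rewrite inE => /orP[/eqP ->|/sr].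
have [s [u [[eu fu sr] ur]]] := key n [::] f f0 (leqnn _).
by exists s, u.
Qed.

End EntireFunctions.

(** * Multiplicities and numbers of solutions *)

Section Multiplicity.
Variable R : realType.
Local Notation C := R[i].
Implicit Types (f g u : C -> C) (z w p v a : C) (s : seq C).

Local Notation der k := (iter k (@cderiv R)).

Lemma entire_iter k u : entire u -> entire (der k u).
Proof.
move=> eu; elim: k => [|k IH]; first exact: eu.
by rewrite iterS; exact: entire_cderiv IH.
Qed.

Lemma iter_cderiv_mulX k u a : entire u ->
  der k (fun w => (w - a) * u w) =
  fun w => (w - a) * der k u w + k%:R * der k.-1 u w.
Proof.
move=> eu; elim: k => [|k IH].
  by apply/funext => w; rewrite /= mul0r addr0.
rewrite iterS IH; apply: cderivE => w.
have /entireP d1 : entire (der k u) by exact: entire_iter.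
have /entireP d2 : entire (der k.-1 u) by exact: entire_iter.
have := cdiffD (cdiffM (cdiff_subz a w) (d1 w)) (cdiffZ k%:R (d2 w)).
have -> : k%:R * cderiv (der k.-1 u) w = k%:R * der k u w.
  by case: (k) => [|n]; rewrite ?mul0r.
have -> : k.+1%:R * der k.+1.-1 u w = 1 * der k u w + k%:R * der k u w.
  by rewrite -natr1 mulrDl addrC.
by rewrite addrA.
Qed.

Definition vanish g z (m : nat) := forall k, (k < m)%N -> der k g z = 0.

(** By Leibniz's rule, a factor [w - a] raises the order of vanishing at [a] by
    exactly one. *)
Lemma vanish_factor u a m : entire u ->
  vanish (fun w => (w - a) * u w) a m.+1 <-> vanish u a m.
Proof.
move=> eu; split=> H k km.
  have := H k.+1 km; rewrite iter_cderiv_mulX// subrr mul0r add0r => /eqP.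
  by rewrite mulf_eq0 pnatr_eq0 /= => /eqP.
rewrite iter_cderiv_mulX// subrr mul0r add0r.
by case: k km => [|k] km; [rewrite mul0r|rewrite H ?mulr0].
Qed.

Lemma vanish_cofactor u a z m : entire u -> z != a ->
  vanish (fun w => (w - a) * u w) z m <-> vanish u z m.
Proof.
move=> eu za; have za0 : z - a != 0 by rewrite subr_eq0.
split=> H k; last first.
  move=> km; rewrite iter_cderiv_mulX// (H k km) mulr0 add0r.
  by case: k km => [|k] km; [rewrite mul0r|rewrite H ?mulr0// ltnW].
elim: k => [|k IH] km; have := H _ km; rewrite iter_cderiv_mulX//.
  by rewrite mul0r addr0 => /eqP; rewrite mulf_eq0 (negPf za0) => /eqP.
rewrite IH ?(ltnW km)// mulr0 addr0 => /eqP.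
by rewrite mulf_eq0 (negPf za0) => /eqP.
Qed.

Lemma entire_prod s u : entire u -> entire (fun w => (\prod_(a <- s) (w - a)) * u w).
Proof.
move=> eu; elim: s => [|a s IH].
  by rewrite (_ : (fun _ => _) = u)//; apply/funext => w; rewrite big_nil mul1r.
rewrite (_ : (fun _ => _) = fun w => (w - a) * ((\prod_(a <- s) (w - a)) * u w)); last first.
  by apply/funext => w; rewrite big_cons mulrA.
apply: cdiff_entire => w; apply: cdiffM; first exact: cdiff_subz.
by move/entireP : IH; apply.
Qed.

Lemma vanish_prod s u z m : entire u -> u z != 0 ->
  vanish (fun w => (\prod_(a <- s) (w - a)) * u w) z m <-> (m <= count_mem z s)%N.
Proof.
move=> eu uz; elim: s m => [|a s IH] m.
  rewrite (_ : (fun _ => _) = u); last by apply/funext => w; rewrite big_nil mul1r.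
  case: m => [|m] /=; first by split.
  by split=> // /(_ 0%N isT) /= /eqP; rewrite (negPf uz).
rewrite (_ : (fun _ => _) = fun w => (w - a) * ((\prod_(a <- s) (w - a)) * u w)); last first.
  by apply/funext => w; rewrite big_cons mulrA.
have es : entire (fun w => (\prod_(a <- s) (w - a)) * u w) by exact: entire_prod.
rewrite /=; case: eqVneq => [az|az]; last first.
  by rewrite add0n -IH; apply: vanish_cofactor => //; rewrite eq_sym.
case: m => [|m]; first by split.
by rewrite az add1n ltnS -IH; exact: vanish_factor.
Qed.

Lemma zero_mult_prod s u z : entire u -> u z != 0 ->
  zero_mult (fun w => (\prod_(a <- s) (w - a)) * u w) z = (count_mem z s)%:R%:E.
Proof.
move=> eu uz; apply/eqP; rewrite eq_le; apply/andP; split.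
  apply: ge_ereal_sup => _ [m /(vanish_prod _ _ eu uz) mc <-].
  by rewrite lee_fin ler_nat.
by apply: ereal_sup_ubound; exists (count_mem z s) => //; apply/(vanish_prod _ _ eu uz).
Qed.

Lemma zero_mult_cst0 z : zero_mult (fun=> 0 : C) z = +oo%E.
Proof.
have d0 k : der k (fun=> 0 : C) = fun=> 0.
  by elim: k => [//|k IH]; rewrite iterS IH; apply: cderivE => w; exact: cdiff_cst.
apply/eqyP => r r0.
apply: (@le_trans _ _ ((Num.truncn r).+1%:R%:E)).
  by rewrite lee_fin ltW// truncnS_gt.
by apply: ereal_sup_ubound; eexists; [|reflexivity] => k _; rewrite d0.
Qed.

Lemma esum_count_mem (T : set C) s :
  (\esum_(z in T) (count_mem z s)%:R%:E = (\sum_(a <- s) \1_T a)%:E :> \bar R)%E.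
Proof.
elim: s => [|a s IH]; first by rewrite big_nil esum1.
transitivity (\esum_(z in T) (((a == z)%:R : R)%:E + (count_mem z s)%:R%:E))%E.
  by apply: eq_esum => z _ /=; rewrite natrD EFinD.
rewrite esumD; [|by move=> *; rewrite lee_fin ler0n..].
rewrite IH big_cons EFinD; congr (_ + _)%E.
have [Ta|nTa] := pselect (T a); last first.
  rewrite indicE memNset// esum1// => z Tz.
  by case: eqVneq => // az; case: nTa; rewrite az.
rewrite indicE mem_set//.
transitivity (\esum_(z in [set a]) ((a == z)%:R : R)%:E)%E; last first.
  by rewrite esum_set1 ?eqxx ?lee_fin.
rewrite esum_mkcond [RHS]esum_mkcond; apply: eq_esum => z _.
have [<-|az] := eqVneq a z; first by rewrite !mem_set.
by do 2 case: ifP.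
Qed.

(** The number of solutions becomes a sum over one finite list in which zeros are
    repeated according to multiplicity, as in the sums over test functions. *)
Lemma num_solutions_prod g K (T : set C) (r : R) s u : entire u ->
  (forall w, g w - K = (\prod_(a <- s) (w - a)) * u w) ->
  (forall w, cmod w <= r -> u w != 0) -> (forall w, T w -> cmod w <= r) ->
  num_solutions g K T = (\sum_(a <- s) \1_T a)%:E.
Proof.
move=> eu gE ur Tr; rewrite /num_solutions -esum_count_mem.
rewrite esum_mkcondr; apply: eq_esum => z Tz.
rewrite (_ : (fun w => g w - K) = fun w => (\prod_(a <- s) (w - a)) * u w); last exact/funext.
rewrite zero_mult_prod//; last exact/ur/Tr.
case: ifPn => //; rewrite notin_setE /= => gz.
suff -> : count_mem z s = 0%N by [].
apply/count_memPn/negP => zs; apply: gz; apply/eqP.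
by rewrite -subr_eq0 gE (big_rem z zs) /= subrr !mul0r.
Qed.

Lemma num_solutions_cst K (T : set C) : T !=set0 ->
  num_solutions (fun=> K) K T = +oo%E.
Proof.
move=> [z Tz]; apply/eqP; rewrite -leye_eq; apply: esum_ge.
exists [set z]; first by split; [exact: finite_set1|move=> _ ->; split].
by rewrite fsbig_set1 (_ : (fun w => _) = fun=> 0) ?zero_mult_cst0//; apply/funext => w; rewrite subrr.
Qed.

End Multiplicity.

(** * Integration over the plane *)

Section PlaneMeasure.
Variable R : realType.
Local Notation mu := (@lebesgue_measure R).
Local Notation l2 := (mu \x mu)%E.
Implicit Types (F G : R * R -> R) (p : R * R).

Lemma near_pairP p (P : R * R -> Prop) :
  (\forall q \near p, P q) <->
  (exists2 d : R, 0 < d &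
    forall q : R * R, `|q.1 - p.1| < d -> `|q.2 - p.2| < d -> P q).
Proof.
split.
- move=> /nbhs_ballP[d /= d0 H]; exists d => // q q1 q2; apply: H.
  by split; rewrite /ball /= distrC.
- move=> [d d0 H]; apply/nbhs_ballP; exists d => //= q [].
  by rewrite /ball /= => q1 q2; apply: H; rewrite distrC.
Qed.

Lemma open_measurable_plane (U : set (R * R)) : open U -> measurable U.
Proof.
move=> oU.
pose B (a b : rat) (n : nat) : set (R * R) :=
  `](ratr a - n.+1%:R^-1), (ratr a + n.+1%:R^-1)[ `*` `](ratr b - n.+1%:R^-1), (ratr b + n.+1%:R^-1)[.
pose V a b n := if pselect (B a b n `<=` U) then B a b n else set0.
have -> : U = \bigcup_a \bigcup_b \bigcup_n V a b n.
  apply/seteqP; split => [p Up|p [a _ [b _ [n _]]]]; last first.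
    by rewrite /V; case: pselect => // VU /VU.
  have /near_pairP[d d0 Hd] := open_nbhs_nbhs (conj oU Up).
  have [n nd] : exists n : nat, n.+1%:R^-1 < d / 2 :> R.
    exists (Num.truncn (d / 2)^-1); rewrite invf_plt ?posrE ?divr_gt0//.
    exact: truncnS_gt.
  have n0 : 0 < n.+1%:R^-1 :> R by rewrite invr_gt0.
  suff [a [b [pab Bab]]] : exists a b, B a b n p /\ B a b n `<=` U.
    by exists a => //; exists b => //; exists n => //; rewrite /V; case: pselect.
  rewrite /B; move: (n.+1%:R^-1) n0 nd => e e0 ed.
  have [a ] := @rat_in_itvoo R (p.1 - e) (p.1 + e) ltac:(lra).
  rewrite in_itv /= => /andP[a1 a2].
  have [b ] := @rat_in_itvoo R (p.2 - e) (p.2 + e) ltac:(lra).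
  rewrite in_itv /= => /andP[b1 b2].
  exists a, b; split.
    by split; rewrite /= in_itv /=; apply/andP; split; lra.
  move=> q [/=]; rewrite !in_itv /= => /andP[? ?] /andP[? ?].
  by apply: Hd; rewrite ltr_norml; apply/andP; split; lra.
apply: (@bigcupT_measurable_rat _ _ (fun a => \bigcup_b \bigcup_n V a b n)) => a.
apply: (@bigcupT_measurable_rat _ _ (fun b => \bigcup_n V a b n)) => b.
apply: bigcupT_measurable => n; rewrite /V; case: (pselect _) => BU; last exact: measurable0.
by apply: measurableX; exact: measurable_itv.
Qed.

Lemma continuous_measurable_plane F : continuous F -> measurable_fun setT F.
Proof.
move=> cF; apply: (measurability _ (RGenOpens.measurableE R)).
move=> _ [_ [x [y ->] <-]]; rewrite setTI; apply: open_measurable_plane.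
by apply: open_comp => [q _|]; [exact: cF|exact: interval_open].
Qed.

Lemma continuous_section1 F y : continuous F -> continuous (fun x => F (x, y)).
Proof.
move=> cF x; apply: (@continuous_comp _ _ _ (fun x => (x, y)) F); last exact: cF.
by apply: (@cvg_pair _ _ _ _ (nbhs x) (nbhs y)); [exact: cvg_id|exact: cvg_cst].
Qed.

Lemma continuous_section2 F x : continuous F -> continuous (fun y => F (x, y)).
Proof.
move=> cF y; apply: (@continuous_comp _ _ _ (fun y => (x, y)) F); last exact: cF.
by apply: (@cvg_pair _ _ _ _ (nbhs x) (nbhs y)); [exact: cvg_cst|exact: cvg_id].
Qed.

Definition box (M : R) : set (R * R) := `[- M, M] `*` `[- M, M].

Lemma box_measurable M : measurable (box M).
Proof. by apply: measurableX; exact: measurable_itv. Qed.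

Lemma box_finite M : (l2 (box M) < +oo)%E.
Proof.
rewrite /box product_measure1E//= !lebesgue_measure_itv/=.
by case: ifP => _; rewrite ?mule0// -EFinB -EFinM ltry.
Qed.

Lemma integrable_box F M C : measurable_fun setT F ->
  (forall p, `|F p| <= C) -> (forall p, ~ box M p -> F p = 0) ->
  l2.-integrable setT (EFin \o F).
Proof.
move=> mF FC F0.
have : l2.-integrable (box M) (EFin \o F).
  apply: measurable_bounded_integrable; [exact: box_measurable|exact: box_finite| |].
    exact: measurable_funTS.
  by exists C; split; [exact: num_real|move=> x Cx p _; apply: le_trans (ltW Cx)].
move=> I; have := proj1 (@integrable_mkcond _ _ _ l2 _ _ (box_measurable M)) I.
apply: eq_integrable => // p _; rewrite /patch; case: ifPn => // /negP pM.
by rewrite /= F0// => pM'; apply: pM; rewrite inE.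
Qed.

Lemma box_compact M : compact (box M).
Proof. by apply: compact_setX; exact: segment_compact. Qed.

Lemma continuous_box_bounded F M : continuous F -> exists2 C, 0 <= C &
  forall p, box M p -> `|F p| <= C.
Proof.
move=> cF; have cI : compact (F @` box M).
  apply: continuous_compact; last exact: box_compact.
  exact: continuous_subspaceT.
have [C [_ HC]] := compact_bounded cI.
exists (`|C| + 1) => [|p pM]; first by rewrite addr_ge0.
by apply: HC; [rewrite ltr_pwDr// ler_norm|exists p].
Qed.

Lemma integrable_continuous_box F M : continuous F ->
  (forall p, ~ box M p -> F p = 0) -> l2.-integrable setT (EFin \o F).
Proof.
move=> cF F0; have [C C0 HC] := continuous_box_bounded M cF.
apply: (integrable_box (M := M) (C := C)) => //; first exact: continuous_measurable_plane.
move=> p; have [/HC//|pM] := pselect (box M p).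
by rewrite F0// normr0.
Qed.

Lemma integral_derivative_eq0 (F f : R -> R) :
  (forall x : R, is_derive x 1 F (f x)) -> continuous f ->
  (fun n => F n%:R) @ \oo --> (0 : R) -> (fun n => F (- n%:R)) @ \oo --> (0 : R) ->
  mu.-integrable setT (EFin \o f) -> (\int[mu]_x (f x)%:E = 0)%E.
Proof.
move=> dF cf cp cn fi.
have cF := is_derive_continuous dF.
pose D n : set R := `[- n.+1%:R, n.+1%:R].
have I n : (\int[mu]_(x in D n) (f x)%:E = (F n.+1%:R - F (- n.+1%:R))%:E)%E.
  rewrite (@continuous_FTC2 _ f F) ?EFinB//.
  - by rewrite -subr_gt0 opprK addr_gt0.
  - exact: continuous_subspaceT.
  - split => [x _||]; first by have [] := dF x.
    + exact: cvg_at_right_filter (cF _).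
    + exact: cvg_at_left_filter (cF _).
  - by move=> x _; rewrite derive1E; have [_ ->] := dF x.
have c0 : (fun n => \int[mu]_x ((EFin \o f) \_ (D n)) x)%E @ \oo --> 0%E.
  under eq_fun do rewrite -integral_mkcond I.
  apply: cvg_EFin; first exact: nearW.
  rewrite -[0]subr0 /comp /=; apply: cvgB.
    by have := cp; rewrite -(cvg_shiftS (fun n => F n%:R)).
  by have := cn; rewrite -(cvg_shiftS (fun n => F (- n%:R))).
have mf : measurable_fun setT f by exact: continuous_measurable_fun.
have [_ _ c1] : [/\ mu.-integrable setT (EFin \o f),
    [sequence \int[mu]_x (`|((EFin \o f) \_ (D n)) x - (EFin \o f) x|)]_n%E @ \oo --> 0%E
    & [sequence \int[mu]_x (((EFin \o f) \_ (D n)) x)]_n%E @ \oo --> (\int[mu]_x (EFin \o f) x)%E].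
  apply: (@dominated_convergence _ _ _ mu setT measurableT _ _ (abse \o (EFin \o f))).
  - move=> n; apply: (measurable_restrictT _ _).1; first exact: measurable_itv.
    by apply: measurable_funTS; exact/measurable_EFinP.
  - exact/measurable_EFinP.
  - apply: aeW => x _; apply: cvg_near_cst; exists (Num.truncn `|x|) => // n /= nx.
    rewrite /patch ifT// inE /D /= in_itv /= -ler_norml.
    apply: le_trans (ltW (truncnS_gt _)) _; first by rewrite ler_nat ltnS.
  - exact: integrable_abse.
  - apply: aeW => x n _; rewrite /patch; case: ifP => _ //=.
    by rewrite normr0 lee_fin.
exact: (cvg_unique (@ereal_hausdorff R) c1 c0).
Qed.

(** Fubini in each direction for the derivative of a function that vanishes at
    infinity along every line. *)
Lemma integral2_derivative1_eq0 G (Gx : R * R -> R) :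
  (forall x y : R, is_derive x 1 (fun t => G (t, y)) (Gx (x, y))) -> continuous Gx ->
  (forall y, (fun n => G (n%:R, y)) @ \oo --> (0 : R)) ->
  (forall y, (fun n => G (- n%:R, y)) @ \oo --> (0 : R)) ->
  l2.-integrable setT (EFin \o Gx) -> (\int[l2]_p (Gx p)%:E = 0)%E.
Proof.
move=> dG cGx cp cn iG; rewrite -(integral21_prod_meas1 iG) /fubini_G.
have [N [mN N0 NP]] := ae_integrable2 iG.
rewrite (@ae_eq_integral _ _ _ mu setT (cst 0%E)) ?integral_cst ?mul0e//.
  exact: (measurable_fubini_G iG).
exists N; split=> // y /= yN; apply: NP => /= iGy; apply: yN => _.
apply: (@integral_derivative_eq0 (fun x => G (x, y)) (fun x => Gx (x, y))) => //.
exact: continuous_section1.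
Qed.

Lemma integral2_derivative2_eq0 G (Gy : R * R -> R) :
  (forall x y : R, is_derive y 1 (fun t => G (x, t)) (Gy (x, y))) -> continuous Gy ->
  (forall x, (fun n => G (x, n%:R)) @ \oo --> (0 : R)) ->
  (forall x, (fun n => G (x, - n%:R)) @ \oo --> (0 : R)) ->
  l2.-integrable setT (EFin \o Gy) -> (\int[l2]_p (Gy p)%:E = 0)%E.
Proof.
move=> dG cGx cp cn iG; rewrite -(integral12_prod_meas1 iG) /fubini_F.
have [N [mN N0 NP]] := ae_integrable1 iG.
rewrite (@ae_eq_integral _ _ _ mu setT (cst 0%E)) ?integral_cst ?mul0e//.
  exact: (measurable_fubini_F iG).
exists N; split=> // y /= yN; apply: NP => /= iGy; apply: yN => _.
apply: (@integral_derivative_eq0 (fun x => G (y, x)) (fun x => Gy (y, x))) => //.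
exact: continuous_section2.
Qed.

End PlaneMeasure.

(** * Affine substitutions and Gaussian densities *)

Section AffineSubstitution.
Variable R : realType.
Local Notation mu := (@lebesgue_measure R).
Local Notation l2 := (mu \x mu)%E.

Lemma lebesgue_affine (a b : R) (A : set R) : a != 0 -> measurable A ->
  mu A = (`|a|%:E * mu ((fun x => (a * x + b)%R) @^-1` A))%E.
Proof.
move=> a0 mA.
have mf : measurable_fun setT (fun x : R => a * x + b).
  by apply: measurable_funD => //; exact: measurable_funM.
pose phi : measurableTypeR R -> measurableTypeR R := fun x => a * x + b.
have mphi : measurable_fun setT phi by exact: mf.
pose nu := mscale (NngNum (normr_ge0 a)) (pushforward mu phi).
suff H : forall X, ocitv X -> mu X = nu mphi X.
  exact: (@lebesgue_measure_unique R (nu mphi) H A mA).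
move=> _ [[x y] _ <-].
change (mu `]x, y]%classic = `|a|%:E * mu (phi @^-1` `]x, y]%classic))%E.
have [xy|yx] := ltP x y; last first.
  by rewrite set_itv_ge ?bnd_simp -?leNgt// preimage_set0 !measure0 mule0.
have [a1|a1] := ltP 0 a.
  rewrite (_ : _ @^-1` _ = `](x - b) / a, (y - b) / a]%classic); last first.
    apply/seteqP; split=> t /=; rewrite !in_itv /=.
      by rewrite ltr_pdivrMr// ler_pdivlMr// ltrBlDr lerBrDr mulrC.
    by rewrite ltr_pdivrMr// ler_pdivlMr// ltrBlDr lerBrDr mulrC.
  rewrite !lebesgue_measure_itv /= !lte_fin xy ltr_pM2r ?invr_gt0// ltrD2r xy.
  rewrite ger0_norm ?(ltW a1)// -!EFinB -EFinM; congr EFin.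
  by rewrite -mulrBl opprD addrACA opprK addNr addr0; field.
have {a1}a0 : a < 0 by rewrite lt_neqAle a0.
rewrite (_ : _ @^-1` _ = `[(y - b) / a, (x - b) / a[%classic); last first.
  apply/seteqP; split=> t /=; rewrite !in_itv /=.
    by rewrite ltr_ndivlMr// ler_ndivrMr// ltrBlDr lerBrDr mulrC andbC.
  by rewrite ltr_ndivlMr// ler_ndivrMr// ltrBlDr lerBrDr mulrC andbC.
rewrite !lebesgue_measure_itv /= !lte_fin xy ltr_nM2r ?invr_lt0// ltrD2r xy.
rewrite ltr0_norm// -!EFinB -EFinM; congr EFin.
by rewrite -mulrBl opprD addrACA opprK addNr addr0; field; rewrite lt_eqF.
Qed.

Lemma integral_affine (a b : R) (f : R -> \bar R) : a != 0 ->
  measurable_fun setT f -> (forall x, 0 <= f x)%E ->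
  (\int[mu]_x f (a * x + b)%R = `|a|^-1%:E * \int[mu]_x f x)%E.
Proof.
move=> a0 mf f0.
have mphi : measurable_fun setT (fun x : R => a * x + b).
  by apply: measurable_funD => //; exact: measurable_funM.
pose phi : measurableTypeR R -> measurableTypeR R := fun x => a * x + b.
have mphi' : measurable_fun setT phi by exact: mphi.
pose nu := mscale (NngNum (normr_ge0 a)) (pushforward mu phi).
rewrite [X in (_ = _ * X)%E](@eq_measure_integral _ _ _ setT (nu mphi') mu); last first.
  by move=> A mA _; exact: lebesgue_affine.
rewrite ge0_integral_mscale// ge0_integral_pushforward// preimage_setT /=.
rewrite muleA -EFinM mulVf ?mul1e//; first by rewrite normr_eq0.
Qed.

Lemma integral2_affine (s k1 k2 : R) (f : R * R -> \bar R) : s != 0 ->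
  measurable_fun setT f -> (forall p, 0 <= f p)%E ->
  (\int[l2]_p f ((s * p.1 + k1)%R, (s * p.2 + k2)%R)
   = (s ^+ 2)^-1%:E * \int[l2]_p f p)%E.
Proof.
move=> s0 mf f0.
have m1 (k : R) : measurable_fun setT (fun x : R => s * x + k).
  by apply: measurable_funD => //; exact: measurable_funM.
rewrite fubini_tonelli1//; last first.
  apply: measurableT_comp => //; apply: measurable_fun_pair.
    exact: measurableT_comp (m1 _) _.
  exact: measurableT_comp (m1 _) _.
rewrite [X in (_ * X)%E]fubini_tonelli1// /fubini_F /=.
have mF : measurable_fun setT (fubini_F mu f).
  exact: measurable_fun_fubini_tonelli_F.
have F0 x : (0 <= fubini_F mu f x)%E by exact: integral_ge0.
pose G x := fubini_F mu f (s * x + k1)%R.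
have mG : measurable_fun setT G by exact: measurableT_comp mF (m1 k1).
have G0 x : (0 <= G x)%E by exact: F0.
transitivity (\int[mu]_x (`|s|^-1%:E * G x))%E.
  apply: eq_integral => x _.
  rewrite (@integral_affine s k2 (fun y => f ((s * x + k1)%R, y)))//.
  exact: measurableT_comp.
have i0 : (0 <= `|s|^-1%:E)%E by rewrite lee_fin invr_ge0.
rewrite (ge0_integralZl mu measurableT mG (fun x _ => G0 x) i0).
rewrite (integral_affine k1 s0 mF F0).
by rewrite muleA -EFinM -expr2 exprVn real_normK ?num_real.
Qed.

(** Multiplication by the complex number [a + ib] scales area by its squared
    modulus; it is undone one coordinate at a time. *)
Lemma integral2_cmul (a b : R) (f : R * R -> \bar R) : (a != 0) || (b != 0) ->
  measurable_fun setT f -> (forall p, 0 <= f p)%E ->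
  (\int[l2]_p f ((a * p.1 - b * p.2)%R, (b * p.1 + a * p.2)%R)
   = (a ^+ 2 + b ^+ 2)^-1%:E * \int[l2]_p f p)%E.
Proof.
move=> ab mf f0.
have msec x : measurable_fun setT (fun y => f (x, y)) by exact: measurableT_comp.
have ml (u v : R) : measurable_fun setT (fun y : R => u * y + v).
  by apply: measurable_funD => //; exact: measurable_funM.
have mll (u v : R) : measurable_fun setT (fun p : R * R => u * p.1 + v * p.2).
  by apply: measurable_funD; apply: measurable_funM.
have m1 : measurable_fun setT (fun p : R * R => f ((a * p.1 - b * p.2)%R, (b * p.1 + a * p.2)%R)).
  apply: measurableT_comp => //; apply: measurable_fun_pair => //.
  by have := mll a (- b); congr measurable_fun; apply/funext => p; rewrite mulNr.
rewrite fubini_tonelli1//.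
pose h (p : R * R) := f ((a * p.1 - b * p.2)%R, (b * p.1 + a * p.2)%R).
transitivity (\int[mu]_y \int[mu]_x h (x, y))%E.
  exact: (@fubini_tonelli _ _ _ _ R mu mu h m1 (fun p => f0 _)).
have [a0|a0] := eqVneq a 0.
  have b0 : b != 0 by move: ab; rewrite a0 eqxx.
  rewrite (@fubini_tonelli1 _ _ _ _ R mu mu f mf f0).
  have mF : measurable_fun setT (fubini_F mu f) by exact: measurable_fun_fubini_tonelli_F.
  have F0 x : (0 <= fubini_F mu f x)%E by exact: integral_ge0.
  pose G y := fubini_F mu f (- b * y + 0)%R.
  have mG : measurable_fun setT G by exact: measurableT_comp mF (ml _ _).
  have G0 x : (0 <= G x)%E by exact: F0.
  transitivity (\int[mu]_y (`|b|^-1%:E * G y))%E.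
    apply: eq_integral => y _; rewrite -(@integral_affine b 0 (fun x => f ((- b * y + 0)%R, x)))//.
    by apply: eq_integral => x _; rewrite /h /= a0 !mul0r sub0r !addr0 mulNr.
  have i0 : (0 <= `|b|^-1%:E)%E by rewrite lee_fin invr_ge0.
  have nb : - b != 0 by rewrite oppr_eq0.
  rewrite (ge0_integralZl mu measurableT mG (fun x _ => G0 x) i0).
  rewrite (integral_affine 0 nb mF F0) muleA -EFinM normrN -expr2 exprVn.
  by rewrite real_normK ?num_real// a0 expr0n /= add0r.
pose D := (a ^+ 2 + b ^+ 2) / a.
have D2 : 0 < a ^+ 2 + b ^+ 2.
  by apply: ltr_pwDl; [rewrite exprn_even_gt0|exact: sqr_ge0].
have D0 : D != 0 by rewrite mulf_neq0 ?invr_eq0 ?(gt_eqF D2).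
pose g (p : R * R) := f (p.1, b / a * p.1 + D * p.2).
have mg : measurable_fun setT g.
  have mp : measurable_fun setT (fun p : R * R => (p.1, b / a * p.1 + D * p.2)).
    by apply: measurable_fun_pair; [exact: measurable_fst|exact: mll].
  exact: measurableT_comp mf mp.
have g0 p : (0 <= g p)%E by exact: f0.
have mG : measurable_fun setT (fubini_G mu g) by exact: measurable_fun_fubini_tonelli_G.
have mF : measurable_fun setT (fubini_F mu f) by exact: measurable_fun_fubini_tonelli_F.
transitivity (\int[mu]_y (`|a|^-1%:E * fubini_G mu g y))%E.
  apply: eq_integral => y _; rewrite -(@integral_affine a (- b * y) (fun x => g (x, y)))//.
    apply: eq_integral => x _; rewrite /g /h /=; congr (f (_, _)); first by rewrite mulNr.
    by rewrite /D; field.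
  exact: measurableT_comp.
have G0 y : (0 <= fubini_G mu g y)%E by exact: integral_ge0.
have i0 : (0 <= `|a|^-1%:E)%E by rewrite lee_fin invr_ge0.
rewrite (ge0_integralZl mu measurableT mG (fun x _ => G0 x) i0).
rewrite (@fubini_tonelli1 _ _ _ _ R mu mu f mf f0).
transitivity (`|a|^-1%:E * \int[mu]_x fubini_F mu g x)%E.
  by congr (_ * _)%E; exact/esym/(@fubini_tonelli _ _ _ _ R mu mu g mg (fun p => f0 _)).
transitivity (`|a|^-1%:E * \int[mu]_x (`|D|^-1%:E * fubini_F mu f x))%E.
  congr (_ * _)%E; apply: eq_integral => x _.
  rewrite -(@integral_affine D (b / a * x) (fun y => f (x, y)))//.
  by apply: eq_integral => y _; rewrite /g /= addrC.
have F0 x : (0 <= fubini_F mu f x)%E by exact: integral_ge0.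
have d0 : (0 <= `|D|^-1%:E)%E by rewrite lee_fin invr_ge0.
rewrite (ge0_integralZl mu measurableT mF (fun x _ => F0 x) d0).
rewrite muleA -EFinM; congr ((_ : R)%:E * _)%E.
by rewrite /D normf_div (gtr0_norm D2) invf_div mulrA mulVf ?mul1r// normr_eq0.
Qed.

End AffineSubstitution.

Section GaussianDensity.
Variable R : realType.
Local Notation mu := (@lebesgue_measure R).
Local Notation l2 := (mu \x mu)%E.

Definition gdens (V : R) (p : R * R) : R :=
  (pi * V)^-1 * expR (- (p.1 ^+ 2 + p.2 ^+ 2) / V).

Lemma gdens_ge0 V p : 0 <= V -> 0 <= gdens V p.
Proof. by move=> V0; rewrite mulr_ge0 ?expR_ge0// invr_ge0 mulr_ge0// pi_ge0. Qed.

Lemma gdens_normal V p : 0 < V ->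
  gdens V p = normal_pdf 0 (Num.sqrt (V / 2)) p.1 * normal_pdf 0 (Num.sqrt (V / 2)) p.2.
Proof.
move=> V0; have s0 : Num.sqrt (V / 2) != 0 by rewrite sqrtr_eq0 -ltNge divr_gt0.
have s2 : Num.sqrt (V / 2) ^+ 2 *+ 2 = V.
  by rewrite sqr_sqrtr ?divr_ge0 ?ltW// mulr2n; field.
rewrite !normal_pdfE// /normal_fun /normal_peak -mulrnAl s2 !subr0.
rewrite mulrACA -expRD /gdens.
have -> : (Num.sqrt (V * pi))^-1 * (Num.sqrt (V * pi))^-1 = (pi * V)^-1.
  by rewrite -invfM -expr2 sqr_sqrtr ?(mulrC V)// mulr_ge0 ?pi_ge0// ltW.
by rewrite -mulrDl opprD.
Qed.

Lemma measurable_gdens V : measurable_fun setT (gdens V).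
Proof.
apply: measurable_funM => //; apply: measurableT_comp => //.
apply: measurable_funM => //; apply: measurable_funN.
by apply: measurable_funD; apply: measurable_funX.
Qed.

Lemma integral_gdens V : 0 < V -> (\int[l2]_p (gdens V p)%:E = 1)%E.
Proof.
move=> V0; have s0 : Num.sqrt (V / 2) != 0 by rewrite sqrtr_eq0 -ltNge divr_gt0.
have mg : measurable_fun setT (EFin \o gdens V).
  by apply/measurable_EFinP; exact: (@measurable_gdens V).
have g0 p : (0 <= (EFin \o gdens V) p)%E by rewrite lee_fin gdens_ge0// ltW.
rewrite (@fubini_tonelli1 _ _ _ _ R mu mu _ mg g0).
rewrite -[RHS](@integral_normal_pdf R 0 (Num.sqrt (V / 2))).
pose n := normal_pdf 0 (Num.sqrt (V / 2)) : R -> R.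
have mn : measurable_fun setT (EFin \o n).
  by apply/measurable_EFinP; exact: measurable_normal_pdf.
have n0 y : (0 <= (EFin \o n) y)%E by rewrite lee_fin normal_pdf_ge0.
apply: eq_integral => x _.
transitivity (\int[mu]_y ((n x)%:E * (EFin \o n) y))%E.
  by apply: eq_integral => y _; rewrite /= gdens_normal// EFinM.
rewrite (ge0_integralZl mu measurableT mn (fun y _ => n0 y) (n0 x)).
by rewrite integral_normal_pdf mule1.
Qed.

Lemma integrable_gdens V : 0 < V -> l2.-integrable setT (EFin \o gdens V).
Proof.
move=> V0; apply/integrableP; split; first by apply/measurable_EFinP; exact: (@measurable_gdens V).
rewrite (_ : (\int[_]_(x in _) _ = 1)%E) ?ltry// -(integral_gdens V0).
by apply: eq_integral => p _; rewrite /= ger0_norm// gdens_ge0// ltW.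
Qed.

End GaussianDensity.

(** * Integrability of the logarithmic kernel *)

Section LogIntegrability.
Variable R : realType.
Local Notation mu := (@lebesgue_measure R).
Local Notation l2 := (mu \x mu)%E.
Implicit Types (F G W : R * R -> R) (p k : R * R).

Lemma FTC2_closed (F f : R -> R) (a b : R) : a < b ->
  (forall x, a <= x <= b -> is_derive x 1 F (f x)) ->
  (forall x, a <= x <= b -> {for x, continuous f}) ->
  (\int[mu]_(x in `[a, b]) (f x)%:E = (F b - F a)%:E)%E.
Proof.
move=> ab dF cf.
have cF x : a <= x <= b -> {for x, continuous F}.
  move=> xab; apply: differentiable_continuous; apply/derivable1_diffP.
  by have [] := dF x xab.
have oo x : x \in `]a, b[%R -> a <= x <= b.
  by rewrite in_itv /= => /andP[ax xb]; rewrite !ltW.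
rewrite (@continuous_FTC2 _ f F)//.
- apply: continuous_in_subspaceT => x; rewrite inE /= ?in_itv /=; exact: cf.
- split => [x /oo /dF [] //||].
  + by apply: cvg_at_right_filter; apply: cF; rewrite lexx ltW.
  + by apply: cvg_at_left_filter; apply: cF; rewrite lexx ltW.
- by move=> x /oo /dF [dFx Fx]; rewrite derive1E.
Qed.

(** The singular part of the logarithm on one side of its pole *)
Definition lnpole (t : R) : R := if (0 < t) && (t <= 1) then - ln t else 0.

Lemma lnpole_ge0 t : 0 <= lnpole t.
Proof. by rewrite /lnpole; case: ifP => // /andP[t0 t1]; rewrite oppr_ge0 ln_le0. Qed.

Lemma measurable_lnpole : measurable_fun setT lnpole.
Proof.
apply: measurable_fun_ifT => //.
  by apply: measurable_and; [exact: measurable_fun_ltr|exact: measurable_fun_ler].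
by apply: measurable_funN; exact: measurable_ln.
Qed.

Lemma integral_lnpole : (\int[mu]_x (lnpole x)%:E <= 1)%E.
Proof.
pose D n : set R := `[n.+1%:R^-1, 1].
have D01 : \bigcup_n D n = `]0, 1].
  apply/seteqP; split => [x [n _]|x]; rewrite /D /= ?in_itv /= ?bnd_simp.
    move=> /andP[nx x1]; apply/andP; split => //.
    by apply: lt_le_trans nx; rewrite invr_gt0.
  move=> /andP[x0 x1]; exists (Num.truncn x^-1) => //; rewrite /D /= ?in_itv /= ?bnd_simp.
  apply/andP; split => //.
  by rewrite invf_ple ?posrE// ltW// truncnS_gt.
have E : (\int[mu]_x (lnpole x)%:E = \int[mu]_(x in `]0%R, 1%R]) (- ln x)%:E)%E.
  rewrite [RHS]integral_mkcond; apply: eq_integral => t _.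
  rewrite /patch mem_setE in_itv /lnpole /=; by case: ifP.
have dF (x : R) : 0 < x -> is_derive x 1 (fun x => x - x * ln x) (- ln x).
  move=> x0; have dl := is_derive1_ln x0.
  have -> : - ln x = 1 - (x *: x^-1 + ln x *: 1).
    by rewrite [x *: _]mulfV ?gt_eqF// [_ *: 1]mulr1; ring.
  by apply: is_deriveB; exact: is_deriveM.
have In n : (\int[mu]_(x in D n) (- ln x)%:E <= 1)%E.
  have n0 : 0 < n.+1%:R^-1 :> R by rewrite invr_gt0.
  have : n.+1%:R^-1 <= 1 :> R by rewrite invf_le1// ler1n.
  rewrite le_eqVlt => /predU1P[n1|n1].
    by rewrite /D n1 set_itv1 integral_set1 lee01.
  have dn (x : R) : n.+1%:R^-1 <= x <= 1 -> is_derive x 1 (fun x => x - x * ln x) (- ln x).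
    by move=> /andP[nx _]; apply: dF; exact: lt_le_trans nx.
  have cn (x : R) : n.+1%:R^-1 <= x <= 1 -> {for x, continuous (fun x => - ln x)}.
    by move=> /andP[nx _]; apply: continuousN; apply: continuous_ln; exact: lt_le_trans nx.
  rewrite (FTC2_closed n1 dn cn) lee_fin ln1 mulr0 subr0 lerBlDr lerDl subr_ge0 -[leRHS]mulr1.
  by rewrite ler_pM2l// (le_trans (ln_le0 _))// ltW.
rewrite E -D01.
have ndD : nondecreasing_seq D.
  move=> m n mn; apply/subsetPset => x; rewrite /D /= !in_itv /= => /andP[mx ->].
  rewrite andbT; apply: le_trans mx.
  by rewrite lef_pV2 ?posrE// ler_nat ltnS.
have mD n : measurable (D n) by exact: measurable_itv.
have mf n : measurable_fun (D n) (fun x => (- ln x)%:E).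
  by apply: measurable_funTS; apply/measurable_EFinP; apply: measurable_funN; exact: measurable_ln.
have f0 n x : D n x -> (0 <= (- ln x)%:E)%E.
  by rewrite /D /= in_itv /= => /andP[_ x1]; rewrite lee_fin oppr_ge0 ln_le0.
have cv : (\int[mu]_(x in D n) (- ln x)%:E @[n --> \oo] -->
    \int[mu]_(x in \bigcup_n D n) (- ln x)%:E)%E.
  exact: ge0_nondecreasing_set_cvg_integral.
rewrite -(cvg_lim (@ereal_hausdorff R) cv); apply: lime_le.
  by apply/cvg_ex; eexists; exact: cv.
by apply: nearW => n; exact: In.
Qed.

Definition r2 k p : R := (p.1 - k.1) ^+ 2 + (p.2 - k.2) ^+ 2.

(** The logarithm of the distance to [k] *)
Definition lndist k p : R := ln (r2 k p) / 2.

Lemma r2_ge0 k p : 0 <= r2 k p.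
Proof. by rewrite addr_ge0// sqr_ge0. Qed.

Lemma lndist_le k p : `|lndist k p| <=
  (lnpole (p.1 - k.1) + lnpole (- (p.1 - k.1))) +
  (lnpole (p.2 - k.2) + lnpole (- (p.2 - k.2))) + r2 k p.
Proof.
pose P (t : R) : R := lnpole t + lnpole (- t).
rewrite -/(P _) -/(P _) /lndist /r2; move: (p.1 - k.1) (p.2 - k.2) => a b.
have P0 t : 0 <= P t by rewrite addr_ge0// lnpole_ge0.
have a2 := sqr_ge0 a; have b2 := sqr_ge0 b; have Pa := P0 a; have Pb := P0 b.
have Q (t s : R) : t != 0 -> 0 <= s -> t ^+ 2 + s < 1 -> - (ln (t ^+ 2 + s) / 2) <= P t.
  move=> t0 s0 ts1.
  have n0 : 0 < `|t| by rewrite normr_gt0.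
  have t2 : t ^+ 2 = `|t| ^+ 2 by rewrite real_normK// num_real.
  have t20 : 0 < t ^+ 2 by rewrite t2 exprn_gt0.
  have nt1 : `|t| <= 1.
    rewrite -(@ler_pXn2r _ 2) ?nnegrE// expr1n -t2.
    by apply: le_trans (ltW ts1); rewrite lerDl.
  have -> : P t = - ln `|t|.
    rewrite /P /lnpole oppr_gt0; have [tp|tn] := ltP 0 t.
      by move: nt1; rewrite gtr0_norm// => ->; rewrite ltNge (ltW tp) /= addr0.
    have tn' : t < 0 by rewrite lt_neqAle t0.
    by move: nt1; rewrite ltr0_norm// => ->; rewrite tn' /= add0r.
  have : ln (t ^+ 2) <= ln (t ^+ 2 + s).
    by rewrite ler_ln ?posrE ?lerDl//; apply: lt_le_trans t20 _; rewrite lerDl.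
  rewrite t2 lnXn// mulr2n; move: (ln `|t|) (ln (`|t| ^+ 2 + s)) => u v; lra.
have gen (u v w r : R) : 0 <= u -> 0 <= v -> 0 <= r -> w <= u \/ w <= v \/ w <= r -> w <= u + v + r.
  by move=> u0 v0 r0 [|[]] h; lra.
have [r1|r1] := leP 1 (a ^+ 2 + b ^+ 2).
  have l0 := ln_ge0 r1.
  rewrite ger0_norm ?divr_ge0//; apply: gen => //; first exact: addr_ge0.
  right; right; have := @ln_sublinear _ (a ^+ 2 + b ^+ 2) (lt_le_trans ltr01 r1).
  by move: l0; move: (ln (a ^+ 2 + b ^+ 2)) => u; lra.
have L0 : ln (a ^+ 2 + b ^+ 2) <= 0 by rewrite ln_le0// ltW.
rewrite ler0_norm; last by rewrite pmulr_lle0 ?invr_gt0.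
apply: gen => //; first exact: addr_ge0.
have [a0|a0] := eqVneq a 0; last by left; exact: Q.
have [b0|b0] := eqVneq b 0; last by right; left; rewrite addrC; apply: Q => //; rewrite addrC.
by right; right; rewrite a0 b0 expr0n /= addr0 ln0// mul0r oppr0.
Qed.

Lemma measurable_r2 k : measurable_fun setT (r2 k).
Proof.
by apply: measurable_funD; apply: measurable_funX; apply: measurable_funB.
Qed.

Lemma measurable_lndist k : measurable_fun setT (lndist k).
Proof.
apply: measurable_funM => //; apply: measurableT_comp; last exact: measurable_r2.
exact: measurable_ln.
Qed.

(** Domination by a multiple of a Gaussian density: the class of weights for
    which polynomial and logarithmic factors stay integrable. *)
Definition gdom F := exists C V : R,
  [/\ 0 <= C, 0 < V & forall p, `|F p| <= C * gdens V p].

Lemma gdom_integrable F : measurable_fun setT F -> gdom F ->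
  l2.-integrable setT (EFin \o F).
Proof.
move=> mF [C [V [C0 V0 H]]].
apply: (@le_integrable _ _ _ l2 setT measurableT (EFin \o F)
  (fun p : R * R => C%:E * (EFin \o gdens V) p)%E).
- exact/measurable_EFinP.
- move=> p _; rewrite /= lee_fin.
  by rewrite [leRHS]ger0_norm// mulr_ge0// gdens_ge0// ltW.
- by apply: integrableZl => //; exact: integrable_gdens.
Qed.

Lemma gdens_poly V p (A B : R) : 0 < V -> 0 <= A -> 0 <= B ->
  gdens V p * (A + B * (p.1 ^+ 2 + p.2 ^+ 2)) <=
  (2 * (A + 2 * V * B)) * gdens (2 * V) p.
Proof.
move=> V0 A0 B0; have r0 : 0 <= p.1 ^+ 2 + p.2 ^+ 2 by rewrite addr_ge0// sqr_ge0.
rewrite /gdens; move: (p.1 ^+ 2 + p.2 ^+ 2) r0 => r r0.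
pose t := r / (2 * V).
have t0 : 0 <= t by rewrite divr_ge0// mulr_ge0// ltW.
have rE : r = 2 * V * t by rewrite /t mulrC divfK// gt_eqF// mulr_gt0.
have -> : - r / V = - t + - t by rewrite rE; field; rewrite gt_eqF.
have -> : - r / (2 * V) = - t by rewrite /t mulNr.
rewrite expRD.
have e1 : expR (- t) * (1 + t) <= 1.
  by rewrite expRN mulrC ler_pdivrMr ?expR_gt0// mul1r expR_ge1Dx.
have piV : 0 < (pi * V)^-1 by rewrite invr_gt0 mulr_gt0// pi_gt0.
have -> : (pi * (2 * V))^-1 = (pi * V)^-1 / 2 by rewrite mulrCA invfM mulrC.
have E0 := expR_gt0 (- t).
rewrite [leLHS](_ : _ = ((pi * V)^-1 * expR (- t)) * (expR (- t) * (A + B * r))); last by ring.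
rewrite [leRHS](_ : _ = ((pi * V)^-1 * expR (- t)) * (A + 2 * V * B)); last first.
  by move: ((pi * V)^-1) => u; field.
apply: ler_wpM2l; first by rewrite mulr_ge0 ?ltW.
apply: (@le_trans _ _ (expR (- t) * (1 + t) * (A + 2 * V * B))); last first.
  by rewrite ler_piMl// addr_ge0// !mulr_ge0// ltW.
rewrite -mulrA ler_wpM2l ?(ltW E0)// rE.
have : 0 <= t * A by rewrite mulr_ge0.
have : 0 <= 2 * V * B by rewrite !mulr_ge0// ltW.
have -> : (1 + t) * (A + 2 * V * B) = A + t * A + 2 * V * B + B * (2 * V * t) by ring.
lra.
Qed.

Lemma gdom_poly F W (A B : R) : gdom F -> 0 <= A -> 0 <= B ->
  (forall p, `|W p| <= A + B * (p.1 ^+ 2 + p.2 ^+ 2)) -> gdom (fun p => F p * W p).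
Proof.
move=> [C [V [C0 V0 H]]] A0 B0 HW.
exists (C * (2 * (A + 2 * V * B))), (2 * V); split.
- by rewrite !mulr_ge0// addr_ge0// !mulr_ge0// ltW.
- by rewrite mulr_gt0.
- move=> p; rewrite normrM -mulrA; apply: le_trans (ler_wpM2l C0 (gdens_poly p V0 A0 B0)).
  by rewrite mulrA; apply: ler_pM.
Qed.

Lemma r2_le k p : r2 k p <= 2 * (k.1 ^+ 2 + k.2 ^+ 2) + 2 * (p.1 ^+ 2 + p.2 ^+ 2).
Proof.
have E (a b : R) : (a - b) ^+ 2 <= 2 * b ^+ 2 + 2 * a ^+ 2.
  by rewrite -subr_ge0 (_ : _ - _ = (a + b) ^+ 2) ?sqr_ge0//; ring.
apply: le_trans (lerD (E p.1 k.1) (E p.2 k.2)) _.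
by rewrite !mulrDr addrACA.
Qed.

Lemma integral_gdens_pole1 V (h : R -> R) (c : R) : 0 < V -> measurable_fun setT h ->
  (forall x, 0 <= h x) -> (\int[mu]_x (h x)%:E <= c%:E)%E ->
  (\int[l2]_p (gdens V p * h p.1)%:E < +oo)%E.
Proof.
move=> V0 mh h0 hc.
pose s := Num.sqrt (V / 2); pose n := normal_pdf 0 s : R -> R.
have s0 : s != 0 by rewrite sqrtr_eq0 -ltNge divr_gt0.
have mn : measurable_fun setT (EFin \o n).
  by apply/measurable_EFinP; exact: measurable_normal_pdf.
have n0 y : (0 <= (EFin \o n) y)%E by rewrite lee_fin normal_pdf_ge0.
pose H (p : R * R) := (gdens V p * h p.1)%:E.
have mH : measurable_fun setT H.
  by apply/measurable_EFinP; apply: measurable_funM; [exact: (@measurable_gdens R V)|exact: measurableT_comp].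
have H0 p : (0 <= H p)%E by rewrite lee_fin mulr_ge0// gdens_ge0// ltW.
rewrite (@fubini_tonelli1 _ _ _ _ R mu mu H mH H0).
apply: (@le_lt_trans _ _ ((normal_peak s)%:E * c%:E)%E); last by rewrite -EFinM ltry.
apply: (@le_trans _ _ ((normal_peak s)%:E * \int[mu]_x (h x)%:E)%E); last first.
  by apply: lee_wpmul2l => //; rewrite lee_fin normal_peak_ge0.
rewrite -ge0_integralZl//; last 3 first.
- exact/measurable_EFinP.
- by move=> x _; rewrite lee_fin.
- by rewrite lee_fin normal_peak_ge0.
have F0 x : (0 <= fubini_F mu H x)%E by apply: integral_ge0 => y _; exact: H0.
have mF : measurable_fun setT (fubini_F mu H) by exact: measurable_fun_fubini_tonelli_F.
apply: ge0_le_integral => //.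
- by move=> x _; exact: F0.
- by apply: emeasurable_funM => //; exact/measurable_EFinP.
- move=> x _.
  have i0 : (0 <= (n x * h x)%:E)%E by rewrite lee_fin mulr_ge0 ?normal_pdf_ge0.
  rewrite /fubini_F (_ : (\int[_]_y _)%E = (\int[mu]_y ((n x * h x)%:E * (EFin \o n) y))%E); last first.
    by apply: eq_integral => y _; rewrite /H gdens_normal// -/s -EFinM /=; congr EFin; rewrite mulrAC.
  rewrite (ge0_integralZl mu measurableT mn (fun y _ => n0 y) i0).
  rewrite integral_normal_pdf mule1 -EFinM lee_fin ler_wpM2r//.
  exact: normal_pdf_ub.
Qed.

End LogIntegrability.

(** * Twice differentiable functions with Gaussian decay *)

Section RealDerivatives.
Variable R : realType.
Implicit Types (F G : R -> R) (x a b : R).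

Lemma rdD F G x a b : is_derive x 1 F a -> is_derive x 1 G b ->
  is_derive x 1 (fun t => F t + G t) (a + b).
Proof. by move=> dF dG; exact: is_deriveD dF dG. Qed.

Lemma rdN F x a : is_derive x 1 F a -> is_derive x 1 (fun t => - F t) (- a).
Proof. by move=> dF; exact: is_deriveN dF. Qed.

Lemma rdB F G x a b : is_derive x 1 F a -> is_derive x 1 G b ->
  is_derive x 1 (fun t => F t - G t) (a - b).
Proof. by move=> dF dG; exact: is_deriveB dF dG. Qed.

Lemma rdM F G x a b : is_derive x 1 F a -> is_derive x 1 G b ->
  is_derive x 1 (fun t => F t * G t) (a * G x + F x * b).
Proof.
move=> dF dG; have := is_deriveM dF dG.
by rewrite addrC [_ *: a]mulrC.
Qed.

Lemma rd_cst c x : is_derive x 1 (fun=> c : R) 0.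
Proof. exact: is_derive_cst. Qed.

Lemma rd_id x : is_derive x 1 (fun t => t) 1.
Proof. exact: is_derive_id. Qed.

Lemma rdZ c F x a : is_derive x 1 F a -> is_derive x 1 (fun t => c * F t) (c * a).
Proof. by move=> dF; have := rdM (rd_cst c x) dF; rewrite mul0r add0r. Qed.

Lemma rdX2 F x a : is_derive x 1 F a -> is_derive x 1 (fun t => F t ^+ 2) (2 * F x * a).
Proof.
move=> dF; have := rdM dF dF; rewrite (_ : (fun t => F t * F t) = fun t => F t ^+ 2)//.
by rewrite (_ : 2 * F x * a = a * F x + F x * a)//; ring.
Qed.

Lemma rdV F x a : F x != 0 -> is_derive x 1 F a ->
  is_derive x 1 (fun t => (F t)^-1) (- a / F x ^+ 2).
Proof.
move=> F0 dF; have := is_deriveV F0 dF.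
by rewrite (_ : - a / F x ^+ 2 = - (F x) ^- 2 *: a)// [RHS]mulrC mulrN mulNr.
Qed.

Lemma rd_comp F G x a b : is_derive (G x) 1 F a -> is_derive x 1 G b ->
  is_derive x 1 (fun t => F (G t)) (a * b).
Proof.
move=> dF dG; have := is_derive1_comp dF dG.
by rewrite /comp.
Qed.

Lemma rd_ln F x a : 0 < F x -> is_derive x 1 F a ->
  is_derive x 1 (fun t => ln (F t)) (a / F x).
Proof. by move=> F0 dF; have := rd_comp (is_derive1_ln F0) dF; rewrite mulrC. Qed.

Lemma rd_exp F x a : is_derive x 1 F a ->
  is_derive x 1 (fun t => expR (F t)) (expR (F x) * a).
Proof. by move=> dF; exact: rd_comp (is_derive_expR (F x)) dF. Qed.

End RealDerivatives.

Section TestFunctions.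
Variable R : realType.
Local Notation mu := (@lebesgue_measure R).
Local Notation l2 := (mu \x mu)%E.
Implicit Types (F G W : R * R -> R) (p k : R * R).

(** Twice continuously differentiable functions of two real variables, with
    the derivatives that enter the Laplacian. *)
Record c2fun := C2Fun {
  c2 : R * R -> R; c2_1 : R * R -> R; c2_11 : R * R -> R;
  c2_2 : R * R -> R; c2_22 : R * R -> R;
  c2_d1 : forall x y : R, is_derive x 1 (fun t => c2 (t, y)) (c2_1 (x, y));
  c2_d11 : forall x y : R, is_derive x 1 (fun t => c2_1 (t, y)) (c2_11 (x, y));
  c2_d2 : forall x y : R, is_derive y 1 (fun t => c2 (x, t)) (c2_2 (x, y));
  c2_d22 : forall x y : R, is_derive y 1 (fun t => c2_2 (x, t)) (c2_22 (x, y));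
  c2_c : continuous c2; c2_c1 : continuous c2_1; c2_c11 : continuous c2_11;
  c2_c2 : continuous c2_2; c2_c22 : continuous c2_22 }.

Definition lap (f : c2fun) p : R := c2_11 f p + c2_22 f p.

Definition c2_gdom (f : c2fun) :=
  [/\ gdom (c2 f), gdom (c2_1 f), gdom (c2_11 f), gdom (c2_2 f) & gdom (c2_22 f)].

Definition c2_supp (f : c2fun) (A : set (R * R)) :=
  forall p, ~ A p -> [/\ c2 f p = 0, c2_1 f p = 0, c2_11 f p = 0, c2_2 f p = 0 & c2_22 f p = 0].

Lemma continuous_lap f : continuous (lap f).
Proof. by move=> p; apply: cvgD; [exact: c2_c11|exact: c2_c22]. Qed.

Lemma gdens_le (V U : R) p : 0 < V -> V <= U -> gdens V p <= U / V * gdens U p.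
Proof.
move=> V0 VU; have U0 : 0 < U by exact: lt_le_trans VU.
rewrite /gdens (_ : (pi * V)^-1 = U * (V^-1 * (pi * U)^-1)); last first.
  by rewrite !invfM mulrCA (mulrCA U) mulfV ?gt_eqF// mulr1 mulrC.
rewrite -!mulrA; do 2 (apply: ler_wpM2l; first by rewrite ?invr_ge0 ltW).
apply: ler_wpM2l; first by rewrite invr_ge0 mulr_ge0 ?pi_ge0// ltW.
rewrite ler_expR !mulNr lerN2; apply: ler_wpM2l; first by rewrite addr_ge0// sqr_ge0.
by rewrite lef_pV2.
Qed.

Lemma gdomD F G : gdom F -> gdom G -> gdom (fun p => F p + G p).
Proof.
have mono (C V U : R) p : 0 <= C -> 0 < V -> V <= U -> C * gdens V p <= (C * U / V) * gdens U p.
  by move=> C0 V0 VU; rewrite -!mulrA; apply: ler_wpM2l => //; rewrite mulrA; exact: gdens_le.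
move=> [C [V [C0 V0 HF]]] [D [U [D0 U0 HG]]].
pose X := Num.max V U.
have X0 : 0 < X by rewrite lt_max V0.
exists (C * X / V + D * X / U), X; split => //.
  by rewrite addr_ge0// divr_ge0 ?mulr_ge0// ltW.
move=> p; apply: le_trans (ler_normD _ _) _; rewrite mulrDl; apply: lerD.
  by apply: le_trans (HF p) (mono _ _ _ _ C0 V0 _); rewrite le_max lexx.
by apply: le_trans (HG p) (mono _ _ _ _ D0 U0 _); rewrite le_max lexx orbT.
Qed.

Lemma gdom_poly1 F W : gdom F -> (exists2 A, 0 <= A & forall p, `|W p| <= A * (1 + (p.1 ^+ 2 + p.2 ^+ 2))) ->
  gdom (fun p => F p * W p).
Proof.
move=> gF [A A0 HW]; apply: (gdom_poly gF A0 A0) => p.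
by apply: le_trans (HW p) _; rewrite mulrDr mulr1.
Qed.

Lemma continuous_box0_gdom F M : continuous F -> (forall p, ~ box M p -> F p = 0) -> gdom F.
Proof.
move=> cF F0; have [C C0 HC] := continuous_box_bounded M cF.
pose a := (pi * 1)^-1 * expR (- (M ^+ 2 + M ^+ 2) / 1) : R.
have a0 : 0 < a by rewrite mulr_gt0 ?expR_gt0// invr_gt0 mulr_gt0 ?pi_gt0.
exists (C / a), 1; split => //; first by rewrite divr_ge0// ltW.
move=> p; have [pM|pM] := pselect (box M p); last first.
  by rewrite F0// normr0 mulr_ge0 ?gdens_ge0// divr_ge0// ltW.
rewrite mulrAC ler_pdivlMr//; apply: ler_pM => //; rewrite ?(ltW a0)//; first exact: HC.
rewrite /a /gdens ler_wpM2l ?invr_ge0 ?mulr_ge0 ?pi_ge0// ler_expR !divr1 lerN2.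
have sq (t : R) : - M <= t <= M -> t ^+ 2 <= M ^+ 2.
  move=> /andP[t1 t2]; rewrite -subr_ge0 (_ : M ^+ 2 - t ^+ 2 = (M - t) * (M + t)); last by ring.
  by rewrite mulr_ge0//; lra.
case: pM; rewrite /= !in_itv /= => h1 h2.
by apply: lerD; exact: sq.
Qed.

Lemma c2_supp_gdom f M : c2_supp f (box M) -> c2_gdom f.
Proof.
move=> Hs; split; apply: (@continuous_box0_gdom _ M);
 [exact: c2_c|by move=> p /Hs[]|exact: c2_c1|by move=> p /Hs[]|exact: c2_c11|by move=> p /Hs[]
 |exact: c2_c2|by move=> p /Hs[]|exact: c2_c22|by move=> p /Hs[]].
Qed.

Lemma gdom_cvg0 F : gdom F -> [/\
  forall y, (fun n => F (n%:R, y)) @ \oo --> (0 : R),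
  forall y, (fun n => F (- n%:R, y)) @ \oo --> (0 : R),
  forall x, (fun n => F (x, n%:R)) @ \oo --> (0 : R) &
  forall x, (fun n => F (x, - n%:R)) @ \oo --> (0 : R)].
Proof.
move=> [C [V [C0 V0 HF]]].
pose B n : R := C * (pi * V)^-1 * (V * n.+1%:R^-1).
have B0 : B @ \oo --> (0 : R).
  rewrite -[0](mulr0 (C * (pi * V)^-1)) /B; apply: cvgMr.
  by rewrite -[0](mulr0 V); apply: cvgMr; exact: cvg_harmonic.
have H n p : (n.+1%:R ^+ 2 <= p.1 ^+ 2 + p.2 ^+ 2 :> R) -> `|F p| <= B n.
  move=> np; apply: le_trans (HF p) _; rewrite /gdens mulrA; apply: ler_wpM2l.
    by rewrite mulr_ge0// invr_ge0 mulr_ge0 ?pi_ge0// ltW.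
  rewrite mulNr expRN -[X in _ <= X]invrK lef_pV2 ?posrE ?expR_gt0//; last first.
    by rewrite invr_gt0 mulr_gt0 ?invr_gt0.
  rewrite invfM invrK.
  apply: le_trans (expR_ge1Dx _); apply: (@le_trans _ _ (n.+1%:R ^+ 2 / V)).
    rewrite mulrC ler_wpM2r ?invr_ge0 ?(ltW V0)//.
    by rewrite expr2 ler_peMr// ler1n.
  by apply: ler_wpDl => //; rewrite ler_wpM2r ?invr_ge0 ?(ltW V0).
have K (u : nat -> R * R) : (forall n, n%:R ^+ 2 <= (u n).1 ^+ 2 + (u n).2 ^+ 2 :> R) ->
    (fun n => F (u n)) @ \oo --> (0 : R).
  move=> Hu; rewrite -cvg_shiftS; apply/norm_cvg0P.
  apply: (@squeeze_cvgr _ _ _ _ (fun=> 0) B); [|exact: cvg_cst|exact: B0].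
  by apply: nearW => n; rewrite normr_ge0 /=; exact: H.
split=> t; apply: K => n /=; rewrite ?sqrrN ?lerDl ?lerDr sqr_ge0//.
Qed.

Lemma integral_gdens_pole2 V (h : R -> R) (c : R) : 0 < V -> measurable_fun setT h ->
  (forall x, 0 <= h x) -> (\int[mu]_x (h x)%:E <= c%:E)%E ->
  (\int[l2]_p (gdens V p * h p.2)%:E < +oo)%E.
Proof.
move=> V0 mh h0 hc.
pose f (p : R * R) := (gdens V p * h p.2)%:E.
have mf : measurable_fun setT f.
  by apply/measurable_EFinP; apply: measurable_funM; [exact: (@measurable_gdens R V)|exact: measurableT_comp].
have f0 p : (0 <= f p)%E by rewrite lee_fin mulr_ge0// gdens_ge0// ltW.
have := @integral2_cmul R 0 1 f; rewrite oner_neq0 orbT => /(_ isT mf f0).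
rewrite expr0n expr1n /= add0r invr1 mul1e => <-.
apply: le_lt_trans (integral_gdens_pole1 V0 mh h0 hc); rewrite le_eqVlt; apply/orP; left; apply/eqP.
apply: eq_integral => p _; rewrite /f /= /gdens /=; congr EFin.
by rewrite !mul0r !mul1r sub0r addr0 sqrrN (addrC (p.2 ^+ 2)).
Qed.

(** The logarithm is integrable against every Gaussian weight. *)
Lemma integrable_gdom_lndist F k : measurable_fun setT F -> gdom F ->
  l2.-integrable setT (EFin \o (fun p => F p * lndist k p)).
Proof.
move=> mF gF; have [C [V [C0 V0 HF]]] := gF.
pose h (c x : R) : R := lnpole (x - c) + lnpole (- (x - c)).
have h0 c x : 0 <= h c x by rewrite addr_ge0// lnpole_ge0.
have ms c : measurable_fun setT (fun x : R => x - c) by exact: measurable_funB.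
have mh c : measurable_fun setT (h c).
  apply: measurable_funD; apply: measurableT_comp; try exact: measurable_lnpole.
  - exact: ms.
  - by apply: measurable_funN; exact: ms.
have mlp : measurable_fun setT (EFin \o @lnpole R) by apply/measurable_EFinP; exact: measurable_lnpole.
have lp0 (x : R) : (0 <= (EFin \o @lnpole R) x)%E by rewrite lee_fin lnpole_ge0.
have hc c : (\int[mu]_x (h c x)%:E <= 2%:E)%E.
  under eq_integral do rewrite EFinD.
  rewrite ge0_integralD//=; last 4 first.
  - by move=> x _; exact: lp0.
  - by apply: (measurableT_comp mlp); exact: ms.
  - by move=> x _; exact: lp0.
  - by apply: (measurableT_comp mlp); apply: measurable_funN; exact: ms.
  have n1 : 1 != 0 :> R by rewrite oner_neq0.
  have n2 : -1 != 0 :> R by rewrite oppr_eq0 oner_neq0.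
  have := integral_affine (- c) n1 mlp lp0; have := integral_affine c n2 mlp lp0.
  rewrite normrN normr1 invr1 !mul1e => e2 e1.
  rewrite (_ : 2%:E = 1 + 1)%E; last by rewrite -EFinD.
  apply: leeD.
    apply: le_trans (@integral_lnpole R); rewrite -e1 le_eqVlt; apply/orP; left; apply/eqP.
    by apply: eq_integral => x _ /=; rewrite mul1r.
  apply: le_trans (@integral_lnpole R); rewrite -e2 le_eqVlt; apply/orP; left; apply/eqP.
  by apply: eq_integral => x _ /=; rewrite mulN1r opprB addrC.
have i1 : l2.-integrable setT (EFin \o (fun p => gdens V p * h k.1 p.1)).
  apply/integrableP; split.
    by apply/measurable_EFinP; apply: measurable_funM; [exact: (@measurable_gdens R V)|exact: measurableT_comp].
  apply: le_lt_trans (integral_gdens_pole1 V0 (mh k.1) (h0 k.1) (hc k.1)).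
  rewrite le_eqVlt; apply/orP; left; apply/eqP; apply: eq_integral => p _ /=.
  by rewrite ger0_norm// mulr_ge0// gdens_ge0// ltW.
have i2 : l2.-integrable setT (EFin \o (fun p => gdens V p * h k.2 p.2)).
  apply/integrableP; split.
    by apply/measurable_EFinP; apply: measurable_funM; [exact: (@measurable_gdens R V)|exact: measurableT_comp].
  apply: le_lt_trans (integral_gdens_pole2 V0 (mh k.2) (h0 k.2) (hc k.2)).
  rewrite le_eqVlt; apply/orP; left; apply/eqP; apply: eq_integral => p _ /=.
  by rewrite ger0_norm// mulr_ge0// gdens_ge0// ltW.
have i3 : l2.-integrable setT (EFin \o (fun p => gdens V p * r2 k p)).
  apply: gdom_integrable.
    by apply: measurable_funM; [exact: (@measurable_gdens R V)|exact: measurable_r2].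
  apply: (@gdom_poly _ _ _ (2 * (k.1 ^+ 2 + k.2 ^+ 2)) 2) => //.
  - by exists 1, V; split => // p; rewrite mul1r ger0_norm// gdens_ge0// ltW.
  - by rewrite mulr_ge0// addr_ge0// sqr_ge0.
  - by move=> p; rewrite ger0_norm ?r2_ge0// r2_le.
pose g1 p : R := gdens V p * h k.1 p.1.
pose g2 p : R := gdens V p * h k.2 p.2.
pose g3 p : R := gdens V p * r2 k p.
have i : l2.-integrable setT (fun p => C%:E * (((EFin \o g1) \+ (EFin \o g2)) \+ (EFin \o g3)) p)%E.
  by apply: integrableZl => //; apply: integrableD => //; exact: integrableD.
apply: le_integrable i => //.
  by apply/measurable_EFinP; apply: measurable_funM => //; exact: measurable_lndist.
move=> p _ /=; rewrite lee_fin -!mulrDr [leRHS]ger0_norm; last first.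
  apply: mulr_ge0 => //; apply: mulr_ge0; first by rewrite gdens_ge0// ltW.
  by apply: addr_ge0; [exact: addr_ge0|exact: r2_ge0].
rewrite normrM mulrA; apply: ler_pM => //.
exact: lndist_le.
Qed.

End TestFunctions.

(** * Green's identity and the regularized logarithm *)

Section LogKernel.
Variable R : realType.
Local Notation mu := (@lebesgue_measure R).
Local Notation l2 := (mu \x mu)%E.
Implicit Types (F G W : R * R -> R) (p k : R * R) (f u : c2fun R).

Definition polyb W := exists2 A : R, 0 <= A &
  forall p, `|W p| <= A * (1 + (p.1 ^+ 2 + p.2 ^+ 2)).

Definition c2_poly u :=
  [/\ polyb (c2 u), polyb (c2_1 u), polyb (c2_11 u), polyb (c2_2 u) & polyb (c2_22 u)].

Lemma integrable_gdom_poly F W : continuous F -> continuous W -> gdom F -> polyb W ->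
  l2.-integrable setT (EFin \o (fun p => F p * W p)).
Proof.
move=> cF cW gF pW; apply: gdom_integrable; last exact: gdom_poly1.
by apply: measurable_funM; exact: continuous_measurable_plane.
Qed.

Lemma gdomN F : gdom F -> gdom (fun p => - F p).
Proof. by move=> [C [V [? ? H]]]; exists C, V; split => // p; rewrite normrN. Qed.

Lemma gdomB F G : gdom F -> gdom G -> gdom (fun p => F p - G p).
Proof. by move=> gF gG; apply: gdomD => //; exact: gdomN. Qed.

(** Green's identity; no boundary term survives the Gaussian decay. *)
Lemma green_gdom f u : c2_gdom f -> c2_poly u ->
  (\int[l2]_p (lap f p * c2 u p)%:E = \int[l2]_p (c2 f p * lap u p)%:E)%E.
Proof.
move=> [g0 g1 g11 g2 g22] [p0 p1 p11 p2 p22].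
have cM F G : continuous F -> continuous G -> continuous (fun p => F p * G p).
  by move=> cF cG p; apply: cvgM; [exact: cF|exact: cG].
pose X p := c2_11 f p * c2 u p - c2 f p * c2_11 u p.
pose Y p := c2_22 f p * c2 u p - c2 f p * c2_22 u p.
have cX : continuous X.
  by move=> p; apply: cvgB; apply: cM; [exact: c2_c11|exact: c2_c|exact: c2_c|exact: c2_c11].
have cY : continuous Y.
  by move=> p; apply: cvgB; apply: cM; [exact: c2_c22|exact: c2_c|exact: c2_c|exact: c2_c22].
have iX : l2.-integrable setT (EFin \o X).
  apply: gdom_integrable; first exact: continuous_measurable_plane.
  by apply: gdomB; exact: gdom_poly1.
have iY : l2.-integrable setT (EFin \o Y).
  apply: gdom_integrable; first exact: continuous_measurable_plane.
  by apply: gdomB; exact: gdom_poly1.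
have EX : (\int[l2]_p (X p)%:E = 0)%E.
  have [l1 l2' _ _] := gdom_cvg0 (gdomB (gdom_poly1 g1 p0) (gdom_poly1 g0 p1)).
  apply: (integral2_derivative1_eq0 (G := fun p => c2_1 f p * c2 u p - c2 f p * c2_1 u p)) => //.
  move=> x y; have := rdB (rdM (c2_d11 f x y) (c2_d1 u x y)) (rdM (c2_d1 f x y) (c2_d11 u x y)).
  by rewrite opprD addrA addrK.
have EY : (\int[l2]_p (Y p)%:E = 0)%E.
  have [_ _ l1 l2'] := gdom_cvg0 (gdomB (gdom_poly1 g2 p0) (gdom_poly1 g0 p2)).
  apply: (integral2_derivative2_eq0 (G := fun p => c2_2 f p * c2 u p - c2 f p * c2_2 u p)) => //.
  move=> x y; have := rdB (rdM (c2_d22 f x y) (c2_d2 u x y)) (rdM (c2_d2 f x y) (c2_d22 u x y)).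
  by rewrite opprD addrA addrK.
have iL : l2.-integrable setT (EFin \o (fun p => c2 f p * lap u p)).
  rewrite (_ : _ \o _ = (EFin \o (fun p => c2 f p * c2_11 u p)) \+ (EFin \o (fun p => c2 f p * c2_22 u p))).
    by apply: integrableD => //; apply: integrable_gdom_poly => //; [exact: c2_c|exact: c2_c11|exact: c2_c|exact: c2_c22].
  by apply/funext => p /=; rewrite /lap mulrDr EFinD.
rewrite (_ : (fun p => (lap f p * c2 u p)%:E) =
   ((EFin \o X) \+ (EFin \o Y)) \+ (EFin \o (fun p => c2 f p * lap u p))); last first.
  by apply/funext => p; rewrite /= -!EFinD; congr EFin; rewrite /X /Y /lap; ring.
rewrite integralD //=; last exact: integrableD.
by rewrite integralD //= EX EY !add0e.
Qed.

Section Regularization.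
Variables (e : R) (k : R * R).
Hypothesis e0 : 0 < e.

Let t p : R := r2 k p + e.
Let t0 p : 0 < t p. Proof. by rewrite ltr_wpDl// r2_ge0. Qed.

Let dt1 (x y : R) : is_derive x 1 (fun s => t (s, y)) (2 * (x - k.1)).
Proof.
have := rdD (rdD (rdX2 (rdB (rd_id x) (rd_cst k.1 x))) (rd_cst ((y - k.2) ^+ 2) x)) (rd_cst e x).
by rewrite !addr0 subr0 mulr1.
Qed.

Let dt2 (x y : R) : is_derive y 1 (fun s => t (x, s)) (2 * (y - k.2)).
Proof.
have := rdD (rdD (rd_cst ((x - k.1) ^+ 2) y) (rdX2 (rdB (rd_id y) (rd_cst k.2 y)))) (rd_cst e y).
by rewrite addr0 add0r subr0 mulr1.
Qed.

Let u p : R := ln (t p) / 2.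
Let u1 p : R := (p.1 - k.1) * (t p)^-1.
Let u2 p : R := (p.2 - k.2) * (t p)^-1.
Let u11 p : R := (t p)^-1 - (p.1 - k.1) * (2 * (p.1 - k.1) / t p ^+ 2).
Let u22 p : R := (t p)^-1 - (p.2 - k.2) * (2 * (p.2 - k.2) / t p ^+ 2).

Let c1 : continuous (fun p : R * R => p.1 - k.1).
Proof. by move=> p; apply: cvgB; [exact: cvg_fst|exact: cvg_cst]. Qed.

Let c2' : continuous (fun p : R * R => p.2 - k.2).
Proof. by move=> p; apply: cvgB; [exact: cvg_snd|exact: cvg_cst]. Qed.

Let ct : continuous t.
Proof.
move=> p; apply: cvgD; last exact: cvg_cst.
by apply: cvgD; rewrite /GRing.exp /=; apply: cvgM; by [exact: c1|exact: c2'].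
Qed.

Let ctV : continuous (fun p => (t p)^-1).
Proof. by move=> p; apply: cvgV; [rewrite gt_eqF|exact: ct]. Qed.

Let ct2V : continuous (fun p => (t p ^+ 2)^-1).
Proof.
move=> p; apply: cvgV; first by rewrite expf_neq0// gt_eqF.
by rewrite /GRing.exp /=; apply: cvgM; exact: ct.
Qed.

Let cu : continuous u.
Proof.
move=> p; apply: cvgM; last exact: cvg_cst.
by apply: (@continuous_comp _ _ _ t (@ln R)); [exact: ct|exact: continuous_ln].
Qed.

Let cu1 : continuous u1.
Proof. by move=> p; apply: cvgM; [exact: c1|exact: ctV]. Qed.

Let cu2 : continuous u2.
Proof. by move=> p; apply: cvgM; [exact: c2'|exact: ctV]. Qed.

Let cu11 : continuous u11.
Proof.
move=> p; apply: cvgB; first exact: ctV.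
apply: cvgM; first exact: c1.
by apply: cvgM; [apply: cvgM; [exact: cvg_cst|exact: c1]|exact: ct2V].
Qed.

Let cu22 : continuous u22.
Proof.
move=> p; apply: cvgB; first exact: ctV.
apply: cvgM; first exact: c2'.
by apply: cvgM; [apply: cvgM; [exact: cvg_cst|exact: c2']|exact: ct2V].
Qed.

Let du1 (x y : R) : is_derive x 1 (fun s => u (s, y)) (u1 (x, y)).
Proof.
have := rdM (rd_ln (F := fun s => t (s, y)) (t0 (x, y)) (dt1 x y)) (rd_cst (2^-1) x).
by rewrite mulr0 addr0 (_ : _ / 2 = u1 (x, y))// /u1 /=; field; rewrite gt_eqF.
Qed.

Let du2 (x y : R) : is_derive y 1 (fun s => u (x, s)) (u2 (x, y)).
Proof.
have := rdM (rd_ln (F := fun s => t (x, s)) (t0 (x, y)) (dt2 x y)) (rd_cst (2^-1) y).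
by rewrite mulr0 addr0 (_ : _ / 2 = u2 (x, y))// /u2 /=; field; rewrite gt_eqF.
Qed.

Let du11 (x y : R) : is_derive x 1 (fun s => u1 (s, y)) (u11 (x, y)).
Proof.
have := rdM (rdB (rd_id x) (rd_cst k.1 x)) (rdV (F := fun s => t (s, y)) (lt0r_neq0 (t0 (x, y))) (dt1 x y)).
by rewrite subr0 mul1r mulNr mulrN.
Qed.

Let du22 (x y : R) : is_derive y 1 (fun s => u2 (x, s)) (u22 (x, y)).
Proof.
have := rdM (rdB (rd_id y) (rd_cst k.2 y)) (rdV (F := fun s => t (x, s)) (lt0r_neq0 (t0 (x, y))) (dt2 x y)).
by rewrite subr0 mul1r mulNr mulrN.
Qed.

(** The logarithm of the distance to [k], smoothed at scale the square root of [e]: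
    its Laplacian is an approximate identity as [e] tends to 0. *)
Definition lnreg : c2fun R := C2Fun du1 du11 du2 du22 cu cu1 cu11 cu2 cu22.

Lemma polyb_r2 W (A : R) : 0 <= A -> (forall p, `|W p| <= A * (1 + r2 k p)) -> polyb W.
Proof.
move=> A0 HW; exists (A * (2 * (1 + (k.1 ^+ 2 + k.2 ^+ 2)))).
  by rewrite !mulr_ge0// !addr_ge0// sqr_ge0.
move=> p; apply: le_trans (HW p) _; rewrite -mulrA ler_wpM2l//.
have := r2_le k p; have : 0 <= p.1 ^+ 2 + p.2 ^+ 2 by rewrite addr_ge0// sqr_ge0.
have : 0 <= k.1 ^+ 2 + k.2 ^+ 2 by rewrite addr_ge0// sqr_ge0.
move: (k.1 ^+ 2 + k.2 ^+ 2) (p.1 ^+ 2 + p.2 ^+ 2) (r2 k p) => a b r a0 b0 rab.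
have : 0 <= a * b by rewrite mulr_ge0.
have -> : 2 * (1 + a) * (1 + b) = 2 + 2 * a + 2 * b + 2 * (a * b) by ring.
lra.
Qed.

Let tV p : (t p)^-1 <= e^-1.
Proof. by rewrite lef_pV2 ?posrE// /t lerDr r2_ge0. Qed.

Lemma ln_abs_le (x : R) : 0 < x -> `|ln x| <= x + x^-1.
Proof.
move=> x0; have xV0 : 0 < x^-1 by rewrite invr_gt0.
have l1 := ln_sublinear x0; have := ln_sublinear xV0; rewrite lnV ?posrE// => l2.
rewrite ler_norml; apply/andP; split; lra.
Qed.

Lemma c2_poly_lnreg : c2_poly lnreg.
Proof.
have eV0 : 0 < e^-1 by rewrite invr_gt0.
have b1 (q a : R) : a ^+ 2 <= q -> `|a * (q + e)^-1| <= e^-1 * (1 + q).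
  move=> aq; have q0 : 0 <= q by apply: le_trans aq; exact: sqr_ge0.
  have qe0 : 0 < q + e by rewrite ltr_wpDl.
  rewrite normrM mulrC; apply: ler_pM => //.
    by rewrite gtr0_norm ?invr_gt0// lef_pV2 ?posrE// lerDr.
  apply: (@le_trans _ _ (1 + a ^+ 2)); last by rewrite lerD2l.
  have := sqr_ge0 (`|a| - 1); rewrite -(real_normK (num_real a)) sqrrB.
  by have := normr_ge0 a; rewrite expr1n mulr1 mulr2n; move: (`|a|) => c; lra.
have b2 (q a : R) : a ^+ 2 <= q ->
    `|(q + e)^-1 - a * (2 * a / (q + e) ^+ 2)| <= (3 * e^-1) * (1 + q).
  move=> aq; have q0 : 0 <= q by apply: le_trans aq; exact: sqr_ge0.
  have qe0 : 0 < q + e by rewrite ltr_wpDl.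
  have VV : (q + e)^-1 <= e^-1 by rewrite lef_pV2 ?posrE// lerDr.
  have V0 : 0 < (q + e)^-1 by rewrite invr_gt0.
  have -> : a * (2 * a / (q + e) ^+ 2) = 2 * (a ^+ 2 / (q + e)) * (q + e)^-1.
    by field; rewrite gt_eqF.
  have h0 : 0 <= a ^+ 2 / (q + e) by rewrite divr_ge0 ?sqr_ge0// ltW.
  have h1 : a ^+ 2 / (q + e) <= 1.
    by rewrite ler_pdivrMr// mul1r; apply: le_trans aq _; rewrite lerDl ltW.
  have gen (c v : R) : 0 <= c -> c <= 1 -> v <= e^-1 -> 0 < v ->
      `|v - 2 * c * v| <= (3 * e^-1) * (1 + q).
    move=> c0 cle1 ve v0; apply: (@le_trans _ _ (3 * e^-1)).
      apply: (@le_trans _ _ (3 * v)); last by rewrite ler_wpM2l.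
      have cv0 : 0 <= c * v by rewrite mulr_ge0 ?(ltW v0).
      have cv1 : c * v <= v by rewrite ler_piMl ?(ltW v0).
      by rewrite -mulrA ler_norml; apply/andP; split; lra.
    by rewrite ler_peMr ?mulr_ge0 ?(ltW eV0)// lerDl.
  exact: gen.
have a1 p : (p.1 - k.1) ^+ 2 <= r2 k p by rewrite /r2 lerDl sqr_ge0.
have a2 p : (p.2 - k.2) ^+ 2 <= r2 k p by rewrite /r2 lerDr sqr_ge0.
split.
- apply: (@polyb_r2 _ (1 + e + e^-1)); first by rewrite !addr_ge0 ?ltW.
  move=> p; rewrite /= /u normrM.
  apply: (@le_trans _ _ `|ln (t p)|).
    by rewrite ler_piMr// ger0_norm ?invr_ge0// invf_le1// ler1n.
  apply: le_trans (ln_abs_le (t0 p)) _.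
  have := tV p; have := r2_ge0 k p; rewrite /t; move: (r2 k p) => r r0 ve.
  have -> : (1 + e + e^-1) * (1 + r) = 1 + e + e^-1 + r + r * e + r * e^-1 by ring.
  have : 0 <= r * e by rewrite mulr_ge0// ltW.
  have : 0 <= r * e^-1 by rewrite mulr_ge0// ltW.
  by move: (r * e^-1) (r * e) (e^-1) ((r + e)^-1) ve => ? ? ? ? ? ? ?; lra.
- by apply: (@polyb_r2 _ e^-1); [exact: ltW|move=> p; exact: b1].
- by apply: (@polyb_r2 _ (3 * e^-1)); [rewrite mulr_ge0// ltW|move=> p; exact: b2].
- by apply: (@polyb_r2 _ e^-1); [exact: ltW|move=> p; exact: b1].
- by apply: (@polyb_r2 _ (3 * e^-1)); [rewrite mulr_ge0// ltW|move=> p; exact: b2].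
Qed.

Lemma lap_lnreg p : lap lnreg p = 2 * e / (r2 k p + e) ^+ 2.
Proof.
rewrite /lap /= /u11 /u22 -/(t p).
have -> : 2 * e = 2 * t p - 2 * ((p.1 - k.1) ^+ 2 + (p.2 - k.2) ^+ 2) by rewrite /t /r2; ring.
by field; rewrite gt_eqF.
Qed.

End Regularization.

End LogKernel.

(** * The fundamental solution of the Laplace equation *)

Section LogPotential.
Variable R : realType.
Local Notation mu := (@lebesgue_measure R).
Local Notation l2 := (mu \x mu)%E.
Implicit Types (F G W : R * R -> R) (p k : R * R) (f u : c2fun R).

Lemma integral_line_kernel (c : R) : 0 < c ->
  (\int[mu]_x (2 * `|x| / (1 + c * x ^+ 2) ^+ 2)%:E = (2 / c)%:E)%E.
Proof.
move=> c0; pose t (x : R) : R := 1 + c * x ^+ 2.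
have t0 x : 0 < t x by rewrite ltr_wpDr// mulr_ge0 ?sqr_ge0// ltW.
have ct : continuous t.
  by move=> x; apply: cvgD; [exact: cvg_cst|apply: cvgMr; apply: exprn_continuous].
have ct2V : continuous (fun x => (t x ^+ 2)^-1).
  move=> x; apply: cvgV; first by rewrite expf_neq0// gt_eqF.
  by rewrite /GRing.exp /=; apply: cvgM; exact: ct.
pose g (x : R) : R := 2 * `|x| / t x ^+ 2.
rewrite (@ge0_symfun_integralT R g); last 3 first.
- by move=> x; rewrite /g !mulr_ge0// invr_ge0 exprn_ge0// ltW.
- move=> x; apply: cvgM; last exact: ct2V.
  by apply: cvgMr; exact: norm_continuous.
- by move=> x; rewrite /g /= normrN /t sqrrN.
rewrite -set_itvcy.
pose F (x : R) : R := - (c^-1 * (t x)^-1).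
have dF (x : R) : is_derive x 1 F (2 * x / t x ^+ 2).
  have dt : is_derive x 1 t (0 + c * (2 * x * 1)).
    exact: (rdD (rd_cst 1 x) (rdZ c (rdX2 (rd_id x)))).
  have := rdN (rdZ c^-1 (rdV (F := t) (lt0r_neq0 (t0 x)) dt)).
  rewrite (_ : - (c^-1 * _) = 2 * x / t x ^+ 2)//.
  by rewrite add0r mulr1; field; rewrite !gt_eqF.
have E : (\int[mu]_(x in `[0%R, +oo[) (2 * x / t x ^+ 2)%:E = (0 : R)%:E - (F 0)%:E)%E.
  apply: ge0_continuous_FTC2y.
  - by move=> x x0; rewrite !mulr_ge0// invr_ge0 exprn_ge0// ltW.
  - apply: continuous_subspaceT => x; apply: cvgM; last exact: ct2V.
    by apply: cvgMr; exact: cvg_id.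
  - apply/cvgrPdist_lt => e e0; exists (Num.max 1 (c ^+ 2 * e)^-1); split; first exact: num_real.
    move=> x; rewrite gt_max => /andP[x1 xe].
    have x0 : 0 < x by exact: lt_trans x1.
    rewrite sub0r /F opprK ger0_norm ?mulr_ge0 ?invr_ge0 ?(ltW c0) ?(ltW (t0 x))//.
    rewrite -invfM invf_plt ?posrE ?mulr_gt0//.
    apply: (@lt_le_trans _ _ (c * (c * x))).
      rewrite mulrA -expr2 -(ltr_pM2l (_ : 0 < (c ^+ 2)^-1)) ?invr_gt0 ?exprn_gt0//.
      by rewrite mulKf ?expf_neq0 ?gt_eqF// -invfM.
    rewrite ler_wpM2l ?(ltW c0)// /t; apply: ler_wpDl => //.
    by rewrite ler_wpM2l ?(ltW c0)// expr2 ler_peMr// ltW.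
  - by move=> x _; have [] := dF x.
  - by apply: cvg_at_right_filter; exact: (is_derive_continuous dF).
  - by move=> x _; rewrite derive1E; have [_ ->] := dF x.
rewrite (_ : (\int[_]_(x in _) _)%E = (\int[mu]_(x in `[0%R, +oo[) (2 * x / t x ^+ 2)%:E)%E).
  rewrite E -EFinB -EFinM /F /t expr0n /= mulr0 addr0 invr1 mulr1 sub0r opprK.
  by congr EFin.
by apply: eq_integral => x; rewrite inE /= in_itv /= andbT => x0; rewrite /g ger0_norm.
Qed.

Lemma integral_cauchy_kernel : (\int[mu]_x (2 / (1 + x ^+ 2))%:E = (2 * pi)%:E :> \bar R)%E.
Proof.
have t0 (x : R) : 0 < 1 + x ^+ 2 by rewrite ltr_wpDr// sqr_ge0.
rewrite (@ge0_symfun_integralT R (fun x => 2 / (1 + x ^+ 2))); last 3 first.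
- by move=> x; rewrite divr_ge0// ltW.
- move=> x; apply: cvgMr; apply: cvgV; first by rewrite gt_eqF.
  by apply: cvgD; [exact: cvg_cst|exact: exprn_continuous].
- by move=> x; rewrite /= sqrrN.
rewrite -set_itvcy.
transitivity (2%:E * \int[mu]_(x in `[0%R, +oo[) (2%:E * ((oneDsqr x)^-1)%:E))%E.
  by [].
have mO : measurable_fun (`[0%R, +oo[%classic : set R) (fun x : R => ((oneDsqr x)^-1)%:E).
  apply/measurable_EFinP/measurable_funTS; apply: continuous_measurable_fun.
  exact: continuous_oneDsqrV.
rewrite (ge0_integralZl mu _ mO)//.
rewrite integral0y_oneDsqr -!EFinM; congr EFin; lra.
Qed.

Definition kern p : R := 2 / (1 + (p.1 ^+ 2 + p.2 ^+ 2)) ^+ 2.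

Let kt0 p : 0 < 1 + (p.1 ^+ 2 + p.2 ^+ 2).
Proof. by rewrite ltr_wpDr// addr_ge0// sqr_ge0. Qed.

Lemma kern_ge0 p : 0 <= kern p.
Proof. by rewrite divr_ge0// exprn_ge0// ltW. Qed.

Lemma measurable_kern : measurable_fun setT kern.
Proof.
apply: continuous_measurable_plane => p; apply: cvgMr; apply: cvgV.
  by rewrite expf_neq0// gt_eqF.
rewrite /GRing.exp /=; apply: cvgM; (apply: cvgD; first exact: cvg_cst);
 by apply: cvgD; apply: cvgM; by [exact: cvg_fst|exact: cvg_snd].
Qed.

(** In the coordinates (x, y/x) the integral becomes a product of elementary
    ones; this replaces polar coordinates. *)
Lemma integral_kern : (\int[l2]_p (kern p)%:E = (2 * pi)%:E)%E.
Proof.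
have mk : measurable_fun setT (EFin \o kern) by apply/measurable_EFinP; exact: measurable_kern.
have k0 p : (0 <= (EFin \o kern) p)%E by rewrite lee_fin kern_ge0.
rewrite (@fubini_tonelli1 _ _ _ _ R mu mu _ mk k0).
pose g (p : R * R) : \bar R := (`|p.1| * kern (p.1, p.1 * p.2))%:E.
have mg : measurable_fun setT g.
  apply/measurable_EFinP; apply: measurable_funM; first exact: measurableT_comp.
  apply: (measurableT_comp measurable_kern); apply: measurable_fun_pair => //.
  exact: measurable_funM.
have g0 p : (0 <= g p)%E by rewrite lee_fin mulr_ge0// kern_ge0.
have mF : measurable_fun setT (fubini_F mu (EFin \o kern)).
  exact: measurable_fun_fubini_tonelli_F.
have mG : measurable_fun setT (fubini_F mu g) by exact: measurable_fun_fubini_tonelli_F.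
transitivity (\int[mu]_x fubini_F mu g x)%E.
  apply: ae_eq_integral => //; exists [set 0]; split=> //; first exact: lebesgue_measure_set1.
  move=> x /= xne; apply: contrapT => x0; apply: xne => _.
  have {}x0 : x != 0 by apply/eqP.
  have mkx : measurable_fun setT (fun y => (kern (x, y))%:E) by exact: measurableT_comp mk _.
  have i0 : (0 <= `|x|%:E)%E by rewrite lee_fin.
  have kx0 y : (0 <= (kern (x, y))%:E)%E by rewrite lee_fin kern_ge0.
  have mkxt : measurable_fun setT (fun t => (kern (x, x * t + 0))%:E).
    apply: (measurableT_comp mkx); apply: measurable_funD => //; exact: measurable_funM.
  have := integral_affine 0 x0 mkx kx0.
  rewrite /fubini_F /g /= => E.
  transitivity (`|x|%:E * \int[mu]_t (kern (x, x * t + 0)%R)%:E)%E.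
    by rewrite E muleA -EFinM mulfV ?mul1e// normr_eq0.
  have kxt0 t : (0 <= (kern (x, x * t + 0))%:E)%E by rewrite lee_fin kern_ge0.
  rewrite -(ge0_integralZl mu measurableT mkxt (fun t _ => kxt0 t) i0).
  by apply: eq_integral => t _; rewrite addr0 EFinM.
transitivity (\int[mu]_t (2 / (1 + t ^+ 2))%:E)%E; last exact: integral_cauchy_kernel.
rewrite (@fubini_tonelli _ _ _ _ R mu mu g mg g0).
apply: eq_integral => t _; rewrite -integral_line_kernel; last by rewrite ltr_wpDr// sqr_ge0.
apply: eq_integral => x _; rewrite /g /kern /=; congr EFin.
by rewrite mulrCA mulrA; congr (_ / _ ^+ 2); ring.
Qed.

Let s (n : nat) : R := n.+1%:R^-1.

(** Rescaling by [s n] around [k] turns the Laplacians of the regularized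
    logarithms into the fixed kernel [kern], and [G] is then evaluated closer and
    closer to [k]. *)
Lemma kernel_cvg G k (M : R) : continuous G -> (forall p, 0 <= G p <= M) ->
  (fun n => \int[l2]_p (G p * (2 * s n ^+ 2 / (r2 k p + s n ^+ 2) ^+ 2))%:E)%E @ \oo
    --> (2 * pi * G k)%:E.
Proof.
move=> cG GM.
have s0 n : 0 < s n by rewrite invr_gt0.
have mG : measurable_fun setT G by exact: continuous_measurable_plane.
pose D n p : R * R := (s n * p.1 + k.1, s n * p.2 + k.2).
have mD n : measurable_fun setT (D n).
  by apply: measurable_fun_pair; apply: measurable_funD => //; exact: measurable_funM.
pose h n p : \bar R := (G (D n p) * kern p)%:E.
have E n : (\int[l2]_p (G p * (2 * s n ^+ 2 / (r2 k p + s n ^+ 2) ^+ 2))%:E = \int[l2]_p h n p)%E.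
  pose f p : \bar R := (G p * (2 * s n ^+ 2 / (r2 k p + s n ^+ 2) ^+ 2))%:E.
  have f0 p : (0 <= f p)%E.
    have /andP[Gp _] := GM p.
    rewrite lee_fin; apply: mulr_ge0 => //; apply: divr_ge0; last exact: sqr_ge0.
    by rewrite pmulr_rge0// sqr_ge0.
  have s20 : 0 < s n ^+ 2 by rewrite exprn_gt0.
  have mf : measurable_fun setT f.
    apply/measurable_EFinP; apply: measurable_funM => //.
    have := @continuous_measurable_plane R _ (@continuous_lap R (lnreg k s20)).
    by congr measurable_fun; apply/funext => p; rewrite lap_lnreg.
  have E := integral2_affine k.1 k.2 (lt0r_neq0 (s0 n)) mf f0.
  have mfD : measurable_fun setT (f \o D n) by exact: measurableT_comp.
  have i0 : (0 <= (s n ^+ 2)%:E)%E by rewrite lee_fin ltW.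
  transitivity ((s n ^+ 2)%:E * \int[l2]_p (f \o D n) p)%E.
    by rewrite E muleA -EFinM mulfV ?mul1e// gt_eqF.
  rewrite -(ge0_integralZl l2 measurableT mfD (fun p _ => f0 _) i0).
  apply: eq_integral => p _; rewrite /f /h /= -EFinM; congr EFin.
  rewrite mulrCA; congr (_ * _).
  have -> : r2 k (D n p) = s n ^+ 2 * (p.1 ^+ 2 + p.2 ^+ 2) by rewrite /r2 /= !addrK !exprMn mulrDr.
  rewrite /kern; have := kt0 p; move: (p.1 ^+ 2 + p.2 ^+ 2) => q q0.
  have := s0 n; move: (s n) => t t0.
  by field; rewrite !gt_eqF//= -{2}[t ^+ 2]mulr1 -mulrDr mulr_gt0 ?exprn_gt0// addrC.
under eq_cvg do rewrite E.
have ik : l2.-integrable setT (EFin \o kern).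
  apply/integrableP; split; first by apply/measurable_EFinP; exact: measurable_kern.
  rewrite (_ : (\int[_]_(x in _) _)%E = (2 * pi)%:E) ?ltry// -integral_kern.
  by apply: eq_integral => p _ /=; rewrite ger0_norm// kern_ge0.
have M0 : 0 <= M by have /andP[] := GM k; exact: le_trans.
have [_ _] : [/\ l2.-integrable setT (fun p => (G k * kern p)%:E),
    [sequence \int[l2]_p (`|h n p - (G k * kern p)%:E|)]_n%E @ \oo --> 0%E
    & [sequence \int[l2]_p (h n p)]_n%E @ \oo --> (\int[l2]_p (G k * kern p)%:E)%E].
  apply: (@dominated_convergence _ _ _ l2 setT measurableT _ _ (fun p => M%:E * (EFin \o kern) p)%E).
  - move=> n; apply/measurable_EFinP; apply: measurable_funM; last exact: measurable_kern.
    exact: (measurableT_comp mG (mD n)).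
  - by apply/measurable_EFinP; apply: measurable_funM => //; exact: measurable_kern.
  - apply: aeW => p _; apply: cvg_EFin; first exact: nearW.
    rewrite /comp /=; apply: cvgMl; apply: (@cvg_comp _ _ _ (fun n => D n p) G); last exact: cG.
    have cs (x y : R) : (fun n => s n * x + y) @ \oo --> y.
      have : (fun n => s n * x + y) @ \oo --> 0 * x + y.
        by apply: cvgD; [apply: cvgMl; exact: cvg_harmonic|exact: cvg_cst].
      by rewrite mul0r add0r.
    have := cvg_pair (cs p.1 k.1) (cs p.2 k.2).
    rewrite /D; case: (k) => k1 k2 /= cp; exact: cp.
  - exact: integrableZl.
  - apply: aeW => p n _; rewrite /h -EFinM /= lee_fin normrM.
    rewrite (ger0_norm (kern_ge0 p)); apply: ler_wpM2r; first exact: kern_ge0.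
    by have /andP[Gp GpM] := GM (D n p); rewrite ger0_norm.
rewrite (_ : (\int[l2]_p (G k * kern p)%:E)%E = (2 * pi * G k)%:E)//.
rewrite (_ : (fun p => (G k * kern p)%:E) = (fun p => (G k)%:E * (EFin \o kern) p)%E)//.
by rewrite integralZl// integral_kern -EFinM mulrC.
Qed.

Lemma r2_gt0 k p : p <> k -> 0 < r2 k p.
Proof.
move=> pk; rewrite lt0r r2_ge0 andbT; apply/eqP => /eqP.
rewrite paddr_eq0 ?sqr_ge0// !sqrf_eq0 !subr_eq0 => /andP[/eqP p1 /eqP p2].
by apply: pk; rewrite [p]surjective_pairing p1 p2 -surjective_pairing.
Qed.

Lemma ae_neq k (Q : R * R -> Prop) : (forall p, p <> k -> Q p) -> {ae l2, forall p, Q p}.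
Proof.
move=> kQ; exists ([set k.1] `*` [set k.2]); split.
- by apply: measurableX; exact: measurable_set1.
- rewrite product_measure1E//=; try exact: measurable_set1.
  by rewrite lebesgue_measure_set1 mul0e.
- move=> p /= nQ; have -> : p = k by apply: contrapT => /kQ.
  by [].
Qed.

(** The logarithm is, up to the factor 2 pi, a fundamental solution of the
    Laplace equation: Green's identity for its regularizations, in the limit. *)
Lemma lap_lndist f k : c2_gdom f ->
  (\int[l2]_p (lap f p * lndist k p)%:E = (2 * pi * c2 f k)%:E)%E.
Proof.
move=> gf; have [g0 _ g11 _ g22] := gf.
have s0 n : 0 < s n by rewrite invr_gt0.
have s20 n : 0 < s n ^+ 2 by rewrite exprn_gt0.
have glap : gdom (lap f) by exact: gdomD.
have mlap : measurable_fun setT (lap f) by apply: continuous_measurable_plane; exact: continuous_lap.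
have [C [V [C0 V0 HC]]] := g0.
pose M := C * (pi * V)^-1.
have piV : 0 <= (pi * V)^-1 by rewrite invr_ge0 mulr_ge0 ?pi_ge0// ltW.
have M0 : 0 <= M by rewrite mulr_ge0.
have fM p : `|c2 f p| <= M.
  apply: le_trans (HC p) _; rewrite ler_wpM2l// /gdens ler_piMr//.
  by rewrite -expR0 ler_expR mulNr oppr_le0 divr_ge0 ?(ltW V0)// addr_ge0// sqr_ge0.
clearbody M.
pose Kn n p : R := 2 * s n ^+ 2 / (r2 k p + s n ^+ 2) ^+ 2.
have KnE n p : Kn n p = lap (lnreg k (s20 n)) p by rewrite lap_lnreg.
have KnE' n : Kn n = lap (lnreg k (s20 n)) by apply/funext => p; exact: KnE.
have Kn0 n p : 0 <= Kn n p.
  by apply: divr_ge0; rewrite ?sqr_ge0// pmulr_rge0// ltW.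
have ifK n : l2.-integrable setT (EFin \o (fun p => c2 f p * Kn n p)).
  have [_ _ p11 _ p22] := c2_poly_lnreg k (s20 n).
  rewrite KnE'; apply: integrable_gdom_poly => //; first exact: c2_c.
    exact: continuous_lap.
  have [A A0 HA] := p11; have [B B0 HB] := p22; exists (A + B); first exact: addr_ge0.
  by move=> p; apply: le_trans (ler_normD _ _) _; rewrite mulrDl lerD.
pose G p := c2 f p + M.
have cG : continuous G by move=> p; apply: cvgD; [exact: c2_c|exact: cvg_cst].
have GM p : 0 <= G p <= M + M.
  by have := fM p; rewrite ler_norml /G => /andP[? ?]; apply/andP; split; lra.
have cvG := @kernel_cvg G k (M + M) cG GM.
have cM : continuous (fun _ : R * R => M) by move=> p; exact: cvg_cst.
have cvM := @kernel_cvg (fun=> M) k M cM (fun p => introT andP (conj M0 (lexx M))).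
have mK n : measurable_fun setT (Kn n).
  by rewrite KnE'; apply: continuous_measurable_plane; exact: continuous_lap.
have iMK n : l2.-integrable setT (EFin \o (fun p => M * Kn n p)).
  apply/integrableP; split; first by apply/measurable_EFinP; apply: measurable_funM; [exact: measurable_cst|exact: mK].
  pose f' p : \bar R := (M * Kn n p)%:E.
  have f0 p : (0 <= f' p)%E by rewrite lee_fin mulr_ge0.
  have mf : measurable_fun setT f'.
    by apply/measurable_EFinP; apply: measurable_funM; [exact: measurable_cst|exact: mK].
  rewrite (_ : (\int[_]_(x in _) _)%E = (\int[l2]_p f' p)%E); last first.
    by apply: eq_integral => p _; rewrite gee0_abs//; exact: f0.
  have := integral2_affine k.1 k.2 (lt0r_neq0 (s0 n)) mf f0.
  rewrite (_ : (\int[l2]_p f' (_, _))%E = ((M * (s n ^+ 2)^-1)%:E * (2 * pi)%:E)%E).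
    case: (\int[l2]_p f' p)%E => [r| |] //; rewrite ?ltry//.
    by rewrite gt0_muley ?lte_fin ?invr_gt0// -EFinM.
  rewrite -integral_kern -ge0_integralZl//.
  - apply: eq_integral => p _; rewrite /f' -EFinM; congr EFin; rewrite -(mulrA M) ; congr (_ * _).
    rewrite /Kn; have -> : r2 k (s n * p.1 + k.1, s n * p.2 + k.2) = s n ^+ 2 * (p.1 ^+ 2 + p.2 ^+ 2).
      by rewrite /r2 /= !addrK !exprMn mulrDr.
    rewrite /kern; have := kt0 p; move: (p.1 ^+ 2 + p.2 ^+ 2) => q q0.
    have := s0 n; move: (s n) => t t0.
    by field; rewrite !gt_eqF//= -{2}[t ^+ 2]mulr1 -mulrDr mulr_gt0 ?exprn_gt0// addrC.
  - by apply/measurable_EFinP; exact: measurable_kern.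
  - by move=> p _; rewrite lee_fin kern_ge0.
  - by rewrite lee_fin divr_ge0// ltW.
have cvR : (fun n => \int[l2]_p (c2 f p * Kn n p)%:E)%E @ \oo --> (2 * pi * c2 f k)%:E.
  rewrite (_ : 2 * pi * c2 f k = 2 * pi * G k - 2 * pi * M); last by rewrite /G; ring.
  have cGM : (fun n => (\int[l2]_p (G p * Kn n p)%:E - \int[l2]_p (M * Kn n p)%:E)%E) @ \oo
      --> ((2 * pi * G k)%:E - (2 * pi * M)%:E)%E.
    by apply: cvgeB cvG cvM; exact: fin_num_adde_defl.
  rewrite EFinB; apply: cvg_trans cGM; apply: near_eq_cvg; apply: nearW => n.
  rewrite -integralB//=; last 2 first.
  - rewrite (_ : (fun p => _) = (EFin \o (fun p => c2 f p * Kn n p)) \+ (EFin \o (fun p => M * Kn n p))).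
      exact: integrableD.
    by apply/funext => p /=; rewrite -EFinD /G mulrDl.
  - exact: iMK.
  by apply: eq_integral => p _ /=; rewrite -EFinB /G mulrDl addrK.
pose u n := lnreg k (s20 n).
have [_ _] : [/\ l2.-integrable setT (fun p => (lap f p * lndist k p)%:E),
    [sequence \int[l2]_p (`|(lap f p * c2 (u n) p)%:E - (lap f p * lndist k p)%:E|)]_n%E @ \oo --> 0%E
    & [sequence \int[l2]_p (lap f p * c2 (u n) p)%:E]_n%E @ \oo --> (\int[l2]_p (lap f p * lndist k p)%:E)%E].
  apply: (@dominated_convergence _ _ _ l2 setT measurableT _ _
    (fun p => `|(lap f p * lndist k p)%:E| + `|(lap f p * (r2 k p + 1))%:E|)%E).
  - move=> n; apply/measurable_EFinP; apply: measurable_funM => //.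
    by apply: continuous_measurable_plane; exact: c2_c.
  - by apply/measurable_EFinP; apply: measurable_funM => //; exact: measurable_lndist.
  - apply: (ae_neq (k := k)) => p pk _; have r0 := r2_gt0 pk.
    apply: cvg_EFin; first exact: nearW.
    rewrite /comp /=; apply: cvgMr; rewrite /u /lndist; apply: cvgMl.
    apply: (@cvg_comp _ _ _ (fun n => r2 k p + s n ^+ 2) (@ln R)); last exact: continuous_ln.
    have : (fun n => r2 k p + s n ^+ 2) @ \oo --> r2 k p + 0 * 0.
      by apply: cvgD; [exact: cvg_cst|apply: cvgM; exact: cvg_harmonic].
    by rewrite mulr0 addr0.
  - apply: integrableD => //; apply: integrable_abse; first exact: integrable_gdom_lndist.
    apply: gdom_integrable; first by apply: measurable_funM => //; apply: measurable_funD => //; exact: measurable_r2.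
    apply: (@gdom_poly _ _ _ (2 * (k.1 ^+ 2 + k.2 ^+ 2) + 1) 2) => //.
      by rewrite addr_ge0// mulr_ge0// addr_ge0// sqr_ge0.
    move=> p /=; rewrite ger0_norm; last by rewrite ler_wpDr// r2_ge0.
    by have := r2_le k p; lra.
  - apply: (ae_neq (k := k)) => p pk n _; have r0 := r2_gt0 pk.
    rewrite /= -EFinD lee_fin !normrM -mulrDr; apply: ler_wpM2l => //.
    rewrite (ger0_norm (_ : 0 <= 2^-1 :> R)) ?invr_ge0//.
    have s1 : s n ^+ 2 <= 1.
      by rewrite exprn_ile1 ?(ltW (s0 n))// invf_le1// ler1n.
    rewrite (ger0_norm (_ : 0 <= r2 k p + 1)); last by rewrite ler_wpDr// r2_ge0.
    have rs : 0 < r2 k p + s n ^+ 2 by rewrite addr_gt0.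
    have l1 : ln (r2 k p) <= ln (r2 k p + s n ^+ 2) by rewrite ler_ln ?posrE// lerDl ltW.
    have l2'' := ln_sublinear rs.
    have : `|ln (r2 k p + s n ^+ 2)| <= `|ln (r2 k p)| + (r2 k p + 1).
      rewrite ler_norml; have n1 := ler_norm (- ln (r2 k p)); rewrite normrN in n1.
      have n2 := normr_ge0 (ln (r2 k p)).
      move: (ln (r2 k p)) (ln (r2 k p + s n ^+ 2)) l1 l2'' n1 n2 => a b l1 l2'' n1 n2.
      by apply/andP; split; lra.
    have := r2_ge0 k p.
    move: (`|ln (r2 k p + s n ^+ 2)|) (`|ln (r2 k p)|) (r2 k p) => a b r; lra.
move=> cvL; apply: (cvg_unique (@ereal_hausdorff R) cvL).
apply: cvg_trans cvR; apply: near_eq_cvg; apply: nearW => n.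
by have E := green_gdom gf (c2_poly_lnreg k (s20 n)); rewrite -KnE' in E; first [exact: E|exact: esym E].
Qed.

End LogPotential.

(** * Zeros of an entire function as a Laplacian *)

Section LocalGreen.
Variable R : realType.
Local Notation C := R[i].
Local Notation mu := (@lebesgue_measure R).
Local Notation l2 := (mu \x mu)%E.
Implicit Types (F G W : R * R -> R) (p k : R * R) (f u : c2fun R) (A : set (R * R)).

Lemma rd_near0 (F : R -> R) (x : R) : (\forall t \near x, F t = 0) -> is_derive x 1 F 0.
Proof.
move=> F0; apply: near_eq_is_derive (rd_cst 0 x).
by apply: filterS F0 => t ->.
Qed.

Lemma near_supp A F p : closed A -> (forall q, ~ A q -> F q = 0) -> ~ A p ->
  \forall q \near p, F q = 0.
Proof.
move=> cA F0 nAp; have oA : open (~` A) by exact: closed_openC.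
have := open_nbhs_nbhs (conj oA nAp); exact: filterS.
Qed.

(** A continuous function supported in [A] times a function continuous at the
    points of [A] is continuous everywhere: this is what makes functions such
    as the logarithm, regular near the support only, usable below. *)
Lemma continuous_suppM A F W : closed A -> continuous F -> (forall q, ~ A q -> F q = 0) ->
  (forall p, A p -> {for p, continuous W}) -> continuous (fun p => F p * W p).
Proof.
move=> cA cF F0 cW p; have [Ap|nAp] := pselect (A p).
  by apply: cvgM; [exact: cF|exact: cW].
apply: cvg_near_cst; have := near_supp cA F0 nAp.
by apply: filterS => q ->; rewrite F0// !mul0r.
Qed.

Lemma near_section1 (x y : R) (Q : R * R -> Prop) : (\forall q \near (x, y), Q q) ->
  \forall t \near x, Q (t, y).
Proof.
move=> /near_pairP[d d0 H]; apply/nbhs_ballP; exists d => //= t.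
by rewrite /ball /= distrC => td; apply: H => //=; rewrite subrr normr0.
Qed.

Lemma near_section2 (x y : R) (Q : R * R -> Prop) : (\forall q \near (x, y), Q q) ->
  \forall t \near y, Q (x, t).
Proof.
move=> /near_pairP[d d0 H]; apply/nbhs_ballP; exists d => //= t.
by rewrite /ball /= distrC => td; apply: H => //=; rewrite subrr normr0.
Qed.

Section Green.
Variables (A : set (R * R)) (M : R) (f : c2fun R) (w w1 w11 w2 w22 : R * R -> R).
Hypotheses (cA : closed A) (AM : A `<=` box M) (fA : c2_supp f A).
Hypotheses (dw1 : forall x y : R, A (x, y) -> is_derive x 1 (fun t => w (t, y)) (w1 (x, y)))
  (dw11 : forall x y : R, A (x, y) -> is_derive x 1 (fun t => w1 (t, y)) (w11 (x, y)))
  (dw2 : forall x y : R, A (x, y) -> is_derive y 1 (fun t => w (x, t)) (w2 (x, y)))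
  (dw22 : forall x y : R, A (x, y) -> is_derive y 1 (fun t => w2 (x, t)) (w22 (x, y))).
Hypotheses (cw : forall p, A p -> {for p, continuous w})
  (cw1 : forall p, A p -> {for p, continuous w1})
  (cw11 : forall p, A p -> {for p, continuous w11})
  (cw2 : forall p, A p -> {for p, continuous w2})
  (cw22 : forall p, A p -> {for p, continuous w22}).

Let f0 q : ~ A q -> c2 f q = 0. Proof. by case/fA. Qed.
Let f10 q : ~ A q -> c2_1 f q = 0. Proof. by case/fA. Qed.
Let f110 q : ~ A q -> c2_11 f q = 0. Proof. by case/fA. Qed.
Let f20 q : ~ A q -> c2_2 f q = 0. Proof. by case/fA. Qed.
Let f220 q : ~ A q -> c2_22 f q = 0. Proof. by case/fA. Qed.
Let notA q : ~ box M q -> ~ A q. Proof. by move=> nb /AM. Qed.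

Let sub_int (F G : R * R -> R) : continuous F -> continuous G ->
  (forall q, ~ A q -> F q = 0) -> (forall q, ~ A q -> G q = 0) ->
  continuous (fun p => F p - G p) /\ l2.-integrable setT (EFin \o (fun p => F p - G p)).
Proof.
move=> cF cG F0 G0; have c : continuous (fun p => F p - G p).
  by move=> p; apply: cvgB; [exact: cF|exact: cG].
split=> //; apply: (@integrable_continuous_box R _ M c) => p /notA nA.
by rewrite F0// G0// subrr.
Qed.

Let parts1 : (\int[l2]_p (c2_11 f p * w p - c2 f p * w11 p)%:E = 0)%E.
Proof.
have c11w := continuous_suppM cA (@c2_c11 R f) f110 cw.
have cw11' := continuous_suppM cA (@c2_c R f) f0 cw11.
have [] := sub_int c11w cw11'.
- by move=> q /f110 ->; rewrite mul0r.
- by move=> q /f0 ->; rewrite mul0r.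
move=> cX iX.
pose G p := c2_1 f p * w p - c2 f p * w1 p.
have [] := sub_int (continuous_suppM cA (@c2_c1 R f) f10 cw) (continuous_suppM cA (@c2_c R f) f0 cw1).
- by move=> q /f10 ->; rewrite mul0r.
- by move=> q /f0 ->; rewrite mul0r.
move=> cG iG.
have G0 q : ~ A q -> G q = 0 by move=> nA; rewrite /G f10// f0// !mul0r subrr.
have [g1 g2 _ _] : [/\ forall y, (fun n => G (n%:R, y)) @ \oo --> (0 : R),
    forall y, (fun n => G (- n%:R, y)) @ \oo --> (0 : R),
    forall x, (fun n => G (x, n%:R)) @ \oo --> (0 : R) &
    forall x, (fun n => G (x, - n%:R)) @ \oo --> (0 : R)].
  by apply: gdom_cvg0; apply: (@continuous_box0_gdom R G M cG) => q /notA /G0.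
apply: (integral2_derivative1_eq0 (G := G)) => //.
move=> x y; have [Axy|nA] := pselect (A (x, y)); last first.
  rewrite f110// f0// !mul0r subrr; apply: rd_near0.
  exact: near_section1 (near_supp cA G0 nA).
have := rdB (rdM (c2_d11 f x y) (dw1 Axy)) (rdM (c2_d1 f x y) (dw11 Axy)).
rewrite (_ : _ - _ = c2_11 f (x, y) * w (x, y) - c2 f (x, y) * w11 (x, y))//; ring.
Qed.

Let parts2 : (\int[l2]_p (c2_22 f p * w p - c2 f p * w22 p)%:E = 0)%E.
Proof.
have c22w := continuous_suppM cA (@c2_c22 R f) f220 cw.
have cw22' := continuous_suppM cA (@c2_c R f) f0 cw22.
have [] := sub_int c22w cw22'.
- by move=> q /f220 ->; rewrite mul0r.
- by move=> q /f0 ->; rewrite mul0r.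
move=> cX iX.
pose G p := c2_2 f p * w p - c2 f p * w2 p.
have [] := sub_int (continuous_suppM cA (@c2_c2 R f) f20 cw) (continuous_suppM cA (@c2_c R f) f0 cw2).
- by move=> q /f20 ->; rewrite mul0r.
- by move=> q /f0 ->; rewrite mul0r.
move=> cG iG.
have G0 q : ~ A q -> G q = 0 by move=> nA; rewrite /G f20// f0// !mul0r subrr.
have [_ _ g1 g2] : [/\ forall y, (fun n => G (n%:R, y)) @ \oo --> (0 : R),
    forall y, (fun n => G (- n%:R, y)) @ \oo --> (0 : R),
    forall x, (fun n => G (x, n%:R)) @ \oo --> (0 : R) &
    forall x, (fun n => G (x, - n%:R)) @ \oo --> (0 : R)].
  by apply: gdom_cvg0; apply: (@continuous_box0_gdom R G M cG) => q /notA /G0.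
apply: (integral2_derivative2_eq0 (G := G)) => //.
move=> x y; have [Axy|nA] := pselect (A (x, y)); last first.
  rewrite f220// f0// !mul0r subrr; apply: rd_near0.
  exact: near_section2 (near_supp cA G0 nA).
have := rdB (rdM (c2_d22 f x y) (dw2 Axy)) (rdM (c2_d2 f x y) (dw22 Axy)).
rewrite (_ : _ - _ = c2_22 f (x, y) * w (x, y) - c2 f (x, y) * w22 (x, y))//; ring.
Qed.

(** Green's second identity for a test function: no boundary term, and the
    second function need only be regular on the support of the first. *)
Lemma green_supp :
  (\int[l2]_p (lap f p * w p)%:E = \int[l2]_p (c2 f p * (w11 p + w22 p))%:E)%E.
Proof.
have z q : ~ A q -> c2_11 f q * w q = 0 by move=> /f110 ->; rewrite mul0r.
have z' q : ~ A q -> c2_22 f q * w q = 0 by move=> /f220 ->; rewrite mul0r.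
have z1 q : ~ A q -> c2 f q * w11 q = 0 by move=> /f0 ->; rewrite mul0r.
have z2 q : ~ A q -> c2 f q * w22 q = 0 by move=> /f0 ->; rewrite mul0r.
have [_ iX] := sub_int (continuous_suppM cA (@c2_c11 R f) f110 cw) (continuous_suppM cA (@c2_c R f) f0 cw11) z z1.
have [_ iY] := sub_int (continuous_suppM cA (@c2_c22 R f) f220 cw) (continuous_suppM cA (@c2_c R f) f0 cw22) z' z2.
have cw12 p : A p -> {for p, continuous (fun p => w11 p + w22 p)}.
  by move=> Ap; apply: cvgD; [exact: cw11|exact: cw22].
have iZ : l2.-integrable setT (EFin \o (fun p => c2 f p * (w11 p + w22 p))).
  apply: (@integrable_continuous_box R _ M); first exact: (continuous_suppM cA (@c2_c R f) f0 cw12).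
  by move=> p /notA /f0 ->; rewrite mul0r.
have E : (\int[l2]_p (lap f p * w p)%:E = \int[l2]_p
   (((c2_11 f p * w p - c2 f p * w11 p)%:E + (c2_22 f p * w p - c2 f p * w22 p)%:E) +
   (c2 f p * (w11 p + w22 p))%:E))%E.
  by apply: eq_integral => p _; rewrite -!EFinD /lap; congr EFin; ring.
rewrite E integralD//=; last exact: integrableD.
by rewrite integralD//= parts1 parts2 !add0e.
Qed.

End Green.

Lemma cdiff_plane (h : C -> C) p l : cdiff h (plane p) l ->
  {for p, continuous (fun q => complex.Re (h (plane q)))} /\
  {for p, continuous (fun q => complex.Im (h (plane q)))}.
Proof.
move=> /cdiff_continuous hc.
have H (e : R) : 0 < e -> \forall q \near p, cmod (h (plane q) - h (plane p)) < e.
  move=> /hc[d d0 Hd]; apply/near_pairP; exists (d / 2); first by rewrite divr_gt0.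
  move=> q q1 q2; rewrite (_ : plane q = plane p + ((q.1 - p.1) +i* (q.2 - p.2))); last first.
    by rewrite /plane; simpc; congr (_ +i* _); rewrite addrC subrK.
  by apply: Hd; apply: le_lt_trans (le_cmod_ReIm _) _ => /=; move: q1 q2; lra.
split; apply/cvgrPdist_lt => e /H; apply: filterS => q; apply: le_lt_trans.
- by rewrite -cmodN opprB -raddfB ge_Re_cmod.
- by rewrite -cmodN opprB -raddfB ge_Im_cmod.
Qed.

Lemma lndist_cmod (a : C) p : lndist (complex.Re a, complex.Im a) p = ln (cmod (plane p - a)).
Proof.
have -> : lndist (complex.Re a, complex.Im a) p = ln (cmod (plane p - a) ^+ 2) / 2.
  by rewrite sqr_cmod /lndist /r2; case: a => a b; rewrite /plane; simpc.
have := cmod_ge0 (plane p - a); rewrite le_eqVlt => /orP[/eqP <-|h0].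
  by rewrite expr0n /= ln0// mul0r.
by rewrite lnXn// -[ln _ *+ 2]mulr_natr mulfK// pnatr_eq0.
Qed.

Lemma ln_cmodE (z : C) :
  ln (cmod z) = 2^-1 * ln (complex.Re z ^+ 2 + complex.Im z ^+ 2).
Proof.
rewrite -sqr_cmod; have := cmod_ge0 z; rewrite le_eqVlt => /orP[/eqP <-|c0].
  by rewrite expr0n /= ln0// mulr0.
by rewrite lnXn// -[ln _ *+ 2]mulr_natr mulrCA mulVf ?mulr1// pnatr_eq0.
Qed.

Lemma measurable_ln_cmod d (X : measurableType d) (g : X -> C) :
  measurable_fun setT (fun t => complex.Re (g t)) ->
  measurable_fun setT (fun t => complex.Im (g t)) ->
  measurable_fun setT (fun t => ln (cmod (g t))).
Proof.
move=> mr mi; rewrite (_ : (fun t => _) =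
    fun t => 2^-1 * ln (complex.Re (g t) ^+ 2 + complex.Im (g t) ^+ 2)); last first.
  by apply/funext => t; exact: ln_cmodE.
apply: measurable_funM => //; apply: measurableT_comp => //.
by apply: measurable_funD; apply: measurable_funX.
Qed.

(** The logarithm of the modulus of a zero-free holomorphic function is
    harmonic: it is the real part of a local primitive of h' / h. *)
Lemma harmonic_ln_cmod (h : C -> C) A M f : entire h -> closed A -> A `<=` box M ->
  c2_supp f A -> (forall p, A p -> h (plane p) != 0) ->
  (\int[l2]_p (lap f p * ln (cmod (h (plane p))))%:E = 0)%E /\
  l2.-integrable setT (EFin \o (fun p => lap f p * ln (cmod (h (plane p))))).
Proof.
move=> eh cA AM fA h0.
have dh z : cdiff h z (cderiv h z) by exact: (proj1 (entireP _) eh z).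
have dh' z : cdiff (cderiv h) z (cderiv (cderiv h) z) by exact: (proj1 (entireP _) (entire_cderiv eh) z).
have dh'' z : cdiff (cderiv (cderiv h)) z (cderiv (cderiv (cderiv h)) z).
  exact: (proj1 (entireP _) (entire_cderiv (entire_cderiv eh)) z).
pose D z := cderiv h z * (h z)^-1.
pose E z := cderiv h z * (- cderiv h z / h z ^+ 2) + cderiv (cderiv h) z * (h z)^-1.
have dD z : h z != 0 -> cdiff D z (E z) by move=> hz; exact: cdiffM (dh' z) (cdiffV hz (dh z)).
have dE z : h z != 0 -> exists l, cdiff E z l.
  move=> hz; eexists; apply: cdiffD; last exact: cdiffM (dh'' z) (cdiffV hz (dh z)).
  apply: cdiffM; first exact: dh'.
  apply: cdiffM; first exact: cdiffN.
  apply: (cdiffV (f := fun z => h z ^+ 2)); first by rewrite expf_neq0.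
  exact: (cdiffM (dh z) (dh z)).
pose n p := complex.Re (h (plane p)) ^+ 2 + complex.Im (h (plane p)) ^+ 2.
have nE p : n p = cmod (h (plane p)) ^+ 2 by rewrite sqr_cmod.
have n0 p : A p -> 0 < n p by move=> Ap; rewrite nE exprn_gt0// cmod_gt0 h0.
pose w p := 2^-1 * ln (n p).
have wE p : ln (cmod (h (plane p))) = w p.
  by rewrite ln_cmodE.
have ReD z : complex.Re (D z) =
    (complex.Re (cderiv h z) * complex.Re (h z) + complex.Im (cderiv h z) * complex.Im (h z)) /
    (complex.Re (h z) ^+ 2 + complex.Im (h z) ^+ 2).
  rewrite /D; case: (cderiv h z) => a b; case: (h z) => c d /=.
  by rewrite mulrN opprK mulrDl !mulrA.
have ImD z : complex.Im (D z) =
    (complex.Im (cderiv h z) * complex.Re (h z) - complex.Re (cderiv h z) * complex.Im (h z)) /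
    (complex.Re (h z) ^+ 2 + complex.Im (h z) ^+ 2).
  rewrite /D; case: (cderiv h z) => a b; case: (h z) => c d /=.
  by rewrite mulrN addrC mulrBl !mulrA.
have cRe z : A z -> {for z, continuous n}.
  move=> Az; have [c1 c2'] := cdiff_plane (dh (plane z)).
  by apply: cvgD; (apply: cvgM; [|]); assumption.
have cw p : A p -> {for p, continuous w}.
  move=> Ap; apply: cvgM; first exact: cvg_cst.
  apply: (@cvg_comp _ _ _ n (@ln R)); first exact: cRe.
  exact: continuous_ln (n0 _ Ap).
pose w1 p := complex.Re (D (plane p)); pose w2 p := - complex.Im (D (plane p)).
pose w11 p := complex.Re (E (plane p)); pose w22 p := - complex.Re (E (plane p)).
have cD p : A p -> _ := fun Ap => cdiff_plane (dD _ (h0 p Ap)).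
have cE p : A p -> {for p, continuous w11}.
  by move=> /h0 /dE[l] /cdiff_plane[].
have G : (\int[l2]_p (lap f p * w p)%:E = \int[l2]_p (c2 f p * (w11 p + w22 p))%:E)%E.
  apply: (@green_supp A M f w w1 w11 w2 w22 cA AM fA).
  - move=> x y Axy; have [d1 d2] := cdiff_hline (dh (x +i* y)).
    have := rdZ 2^-1 (rd_ln (F := fun t => n (t, y)) (n0 _ Axy) (rdD (rdX2 d1) (rdX2 d2))).
    rewrite (_ : 2^-1 * _ = w1 (x, y)) // /w1 ReD /n /plane /=.
    by rewrite mulrA; congr (_ / _); field.
  - by move=> x y Axy; have [] := cdiff_hline (dD _ (h0 _ Axy)).
  - move=> x y Axy; have [d1 d2] := cdiff_vline (dh (x +i* y)).
    have := rdZ 2^-1 (rd_ln (F := fun t => n (x, t)) (n0 _ Axy) (rdD (rdX2 d1) (rdX2 d2))).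
    rewrite (_ : 2^-1 * _ = w2 (x, y)) // /w2 ImD /n /plane /=.
    rewrite mulrA -mulNr; congr (_ / _).
    by case: (cderiv h (x +i* y)) => a b /=; field.
  - move=> x y Axy; have [_ d] := cdiff_vline (dD _ (h0 _ Axy)).
    have := rdN d; rewrite (_ : complex.Im ('i * E (x +i* y)) = complex.Re (E (x +i* y)))//.
    by case: (E _) => a b /=; rewrite mul0r add0r mul1r.
  - exact: cw.
  - by move=> p Ap; have [] := cD p Ap.
  - exact: cE.
  - by move=> p Ap; have [_ c] := cD p Ap; exact: cvgN.
  - by move=> p Ap; apply: cvgN; exact: cE.
under eq_integral do rewrite wE.
rewrite (_ : (fun p => lap f p * ln _) = (fun p => lap f p * w p)); last by apply/funext => p; rewrite wE.
have l0 q : ~ A q -> lap f q = 0 by case/fA => _ _ e1 _ e2; rewrite /lap e1 e2 addr0.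
split.
  rewrite G integral0_eq// => p _; by rewrite /w22 subrr mulr0.
apply: (@integrable_continuous_box R _ M); first exact: (continuous_suppM cA (@continuous_lap R f) l0 cw).
by move=> p nb; rewrite l0 ?mul0r// => /AM.
Qed.

(** At the zeros themselves the logarithm takes the junk value [ln 0], and the
    identities below only hold almost everywhere. *)
Lemma negligible_plane_mem (s : seq C) : l2.-negligible [set p | plane p \in s].
Proof.
elim: s => [|a s IH].
  by rewrite (_ : [set _ | _] = set0); [exact: negligible_set0|rewrite -subset0].
have na : l2.-negligible [set p | p = (complex.Re a, complex.Im a)].
  have [N [mN N0 NS]] := @ae_neq R (complex.Re a, complex.Im a) _ (fun p H => H).
  by exists N; split=> // p /= pa; apply: NS => /= /(_ pa).
apply: negligibleS (negligibleU na IH) => p /=; rewrite inE => /orP[/eqP <-|ps]; last by right.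
by left; rewrite /= -surjective_pairing.
Qed.

(** The potential-theoretic counting formula: the Laplacian of the logarithm
    of the modulus of an entire function is 2 pi times its zero set. *)
Lemma integral_lap_ln_cmod (s : seq C) (h : C -> C) A M f : entire h -> closed A -> A `<=` box M ->
  c2_supp f A -> (forall p, A p -> h (plane p) != 0) ->
  (\int[l2]_p (lap f p * ln (cmod ((\prod_(a <- s) (plane p - a)) * h (plane p))))%:E
   = (2 * pi * \sum_(a <- s) c2 f (complex.Re a, complex.Im a))%:E)%E.
Proof.
move=> eh cA AM fA h0.
have l0 q : ~ A q -> lap f q = 0 by case/fA => _ _ e1 _ e2; rewrite /lap e1 e2 addr0.
have fM : c2_supp f (box M) by move=> p nb; apply: fA => /AM.
have gf : c2_gdom f := c2_supp_gdom fM.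
have glap : gdom (lap f) by case: gf => *; exact: gdomD.
have mlap : measurable_fun setT (lap f) by apply: continuous_measurable_plane; exact: continuous_lap.
pose v s p := \sum_(a <- s) lndist (complex.Re a, complex.Im a) p + ln (cmod (h (plane p))).
have [i0 ih] := harmonic_ln_cmod eh cA AM fA h0.
have H : (\int[l2]_p (lap f p * v s p)%:E
    = (2 * pi * \sum_(a <- s) c2 f (complex.Re a, complex.Im a))%:E)%E /\
    l2.-integrable setT (EFin \o (fun p => lap f p * v s p)).
  elim: s => [|a s [IH1 IH2]].
    have vE : (fun p => lap f p * v [::] p) = fun p => lap f p * ln (cmod (h (plane p))).
      by apply/funext => p; rewrite /v big_nil add0r.
    by rewrite vE big_nil mulr0; split => //; rewrite -[RHS]i0; apply: eq_integral => p _; rewrite /v big_nil add0r.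
  have vE p : lap f p * v (a :: s) p = lap f p * lndist (complex.Re a, complex.Im a) p + lap f p * v s p.
    by rewrite /v big_cons -addrA mulrDr.
  have ia := integrable_gdom_lndist (complex.Re a, complex.Im a) mlap glap.
  split; last first.
    rewrite (_ : EFin \o _ = (EFin \o (fun p => lap f p * lndist (complex.Re a, complex.Im a) p)) \+
      (EFin \o (fun p => lap f p * v s p))); first exact: integrableD.
    by apply/funext => p /=; rewrite vE EFinD.
  under eq_integral do rewrite vE EFinD.
  by rewrite (integralD measurableT ia IH2) IH1 (lap_lndist _ gf) -EFinD big_cons; congr EFin; rewrite [RHS]mulrDr.
rewrite -H.1; apply: ae_eq_integral => //.
- apply/measurable_EFinP.
  apply: measurable_funM; first exact: mlap.
  have eg : entire (fun z => (\prod_(a <- s) (z - a)) * h z) by exact: entire_prod.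
  have dg p := cdiff_plane (proj1 (entireP _) eg (plane p)).
  apply: measurable_ln_cmod; apply: continuous_measurable_plane => p; by have [] := dg p.
- by have [_ /integrableP[]] := H.
- apply: negligibleS (negligible_plane_mem s) => p /= np; apply: contrapT => ps; apply: np => _.
  have [Ap|nAp] := pselect (A p); last by rewrite l0// !mul0r.
  congr (_ * _)%:E; rewrite /v cmodM lnM ?posrE ?cmod_gt0 ?h0//; last first.
    by rewrite prodf_seq_neq0; apply/allP => a as_ /=; rewrite subr_eq0; apply: contra_notN ps => /eqP ->.
  congr (_ + _); elim: s ps {H} => [|a s IH] ps.
    by have c1 : cmod (1 : C) = 1 := ComplexField.Normc.normc1 R; rewrite !big_nil c1 ln1.
  move/negP: ps; rewrite inE negb_or => /andP[pa /negP ps].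
  rewrite !big_cons cmodM lnM ?posrE ?cmod_gt0 ?subr_eq0//.
    by rewrite IH// lndist_cmod.
  by rewrite prodf_seq_neq0; apply/allP => b bs /=; rewrite subr_eq0; apply: contra_notN ps => /eqP ->.
Qed.

End LocalGreen.

(** * The mean logarithmic potential of a Gaussian variable *)

Section GaussianPotential.
Variable R : realType.
Local Notation mu := (@lebesgue_measure R).
Local Notation l2 := (mu \x mu)%E.
Implicit Types (p k : R * R).

Lemma continuous_coord1 : continuous (fun p : R * R => p.1).
Proof. by move=> p; exact: cvg_fst. Qed.

Lemma continuous_coord2 : continuous (fun p : R * R => p.2).
Proof. by move=> p; exact: cvg_snd. Qed.

Lemma continuous_mul2 (F G : R * R -> R) :
  continuous F -> continuous G -> continuous (fun p => F p * G p).
Proof. by move=> cF cG p; apply: cvgM; [exact: cF|exact: cG]. Qed.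

Lemma continuous_add2 (F G : R * R -> R) :
  continuous F -> continuous G -> continuous (fun p => F p + G p).
Proof. by move=> cF cG p; apply: cvgD; [exact: cF|exact: cG]. Qed.

Lemma continuous_sub2 (F G : R * R -> R) :
  continuous F -> continuous G -> continuous (fun p => F p - G p).
Proof. by move=> cF cG p; apply: cvgB; [exact: cF|exact: cG]. Qed.

Lemma continuous_cst2 (c : R) : continuous (fun _ : R * R => c).
Proof. by move=> p; exact: cvg_cst. Qed.

Lemma continuous_gdens V : continuous (gdens V : R * R -> R).
Proof.
move=> p; apply: cvgM; first exact: cvg_cst.
apply: (@cvg_comp _ _ _ (fun p : R * R => - (p.1 ^+ 2 + p.2 ^+ 2) / V) (@expR R)).
  apply: cvgM; last exact: cvg_cst.
  apply: cvgN; apply: cvgD; apply: cvgM; solve [exact: continuous_coord1|exact: continuous_coord2].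
exact: continuous_expR.
Qed.

Section Fixed.
Variables (V : R) (V0 : 0 < V).

Let g1 p := gdens V p * (- (2 / V) * p.1).
Let g2 p := gdens V p * (- (2 / V) * p.2).
Let g11 p := gdens V p * ((4 / V ^+ 2) * (p.1 * p.1) - 2 / V).
Let g22 p := gdens V p * ((4 / V ^+ 2) * (p.2 * p.2) - 2 / V).

Let Vn0 : V != 0. Proof. by rewrite gt_eqF. Qed.

Let d1 (x y : R) : is_derive x 1 (fun t => gdens V (t, y)) (g1 (x, y)).
Proof.
have := rdZ (pi * V)^-1 (rd_exp (rdM (rdN (rdD (rdX2 (rd_id x)) (rd_cst (y ^+ 2) x))) (rd_cst V^-1 x))).
rewrite (_ : (pi * V)^-1 * _ = g1 (x, y))// /g1 /gdens /= -[RHS]mulrA; congr (_ * (_ * _)).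
by field.
Qed.

Let d2 (x y : R) : is_derive y 1 (fun t => gdens V (x, t)) (g2 (x, y)).
Proof.
have := rdZ (pi * V)^-1 (rd_exp (rdM (rdN (rdD (rd_cst (x ^+ 2) y) (rdX2 (rd_id y)))) (rd_cst V^-1 y))).
rewrite (_ : (pi * V)^-1 * _ = g2 (x, y))// /g2 /gdens /= -[RHS]mulrA; congr (_ * (_ * _)).
by field.
Qed.

Let d11 (x y : R) : is_derive x 1 (fun t => g1 (t, y)) (g11 (x, y)).
Proof.
have := rdM (d1 x y) (rdZ (- (2 / V)) (rd_id x)).
rewrite (_ : _ + _ = g11 (x, y))// /g11 /g1 /=; move: (gdens V (x, y)) => g.
by field.
Qed.

Let d22 (x y : R) : is_derive y 1 (fun t => g2 (x, t)) (g22 (x, y)).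
Proof.
have := rdM (d2 x y) (rdZ (- (2 / V)) (rd_id y)).
rewrite (_ : _ + _ = g22 (x, y))// /g22 /g2 /=; move: (gdens V (x, y)) => g.
by field.
Qed.

Let cg1 : continuous g1.
Proof.
move=> p; apply: cvgM; first exact: continuous_gdens.
by apply: cvgM; [exact: cvg_cst|exact: continuous_coord1].
Qed.

Let cg2 : continuous g2.
Proof.
move=> p; apply: cvgM; first exact: continuous_gdens.
by apply: cvgM; [exact: cvg_cst|exact: continuous_coord2].
Qed.

Let cg11 : continuous g11.
Proof.
move=> p; apply: cvgM; first exact: continuous_gdens.
apply: cvgB; last exact: cvg_cst.
by apply: cvgM; [exact: cvg_cst|apply: cvgM; exact: continuous_coord1].
Qed.

Let cg22 : continuous g22.
Proof.
move=> p; apply: cvgM; first exact: continuous_gdens.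
apply: cvgB; last exact: cvg_cst.
by apply: cvgM; [exact: cvg_cst|apply: cvgM; exact: continuous_coord2].
Qed.

Definition gauss : c2fun R :=
  C2Fun d1 d11 d2 d22 (@continuous_gdens V) cg1 cg11 cg2 cg22.

Lemma lap_gauss p : lap gauss p = gdens V p * (4 / V ^+ 2 * (p.1 ^+ 2 + p.2 ^+ 2) - 4 / V).
Proof. by rewrite /lap /= /g11 /g22; move: (gdens V p) => g; field. Qed.

Let gdom0 : gdom (gdens V).
Proof.
by exists 1, V; split=> // p; rewrite mul1r ger0_norm// gdens_ge0// ltW.
Qed.

Let abs_le (x : R) : `|x| <= 1 + x ^+ 2.
Proof.
by rewrite ler_norml; apply/andP; split; rewrite -subr_ge0;
  [have := sqr_ge0 (x + 2^-1)|have := sqr_ge0 (x - 2^-1)]; rewrite !expr2; nra.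
Qed.

Lemma c2_gdom_gauss : c2_gdom gauss.
Proof.
have a0 : 0 <= 2 / V by rewrite divr_ge0// ltW.
have b0 : 0 <= 4 / V ^+ 2 by rewrite divr_ge0// sqr_ge0.
have lin (x y : R) : `|- (2 / V) * x| <= 2 / V + 2 / V * (x ^+ 2 + y ^+ 2).
  rewrite normrM normrN (ger0_norm a0) -{2}[2 / V]mulr1 -mulrDr ler_wpM2l//.
  by apply: le_trans (abs_le x) _; rewrite lerD2l lerDl sqr_ge0.
have quad (x y : R) : `|4 / V ^+ 2 * (x * x) - 2 / V| <= 2 / V + 4 / V ^+ 2 * (x ^+ 2 + y ^+ 2).
  apply: le_trans (ler_normB _ _) _; rewrite (ger0_norm a0) addrC lerD2l.
  by rewrite normrM (ger0_norm b0) ler_wpM2l// -expr2 ger0_norm ?sqr_ge0// lerDl sqr_ge0.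
split => //; first by apply: (@gdom_poly _ _ _ (2 / V) (2 / V)) => // p; exact: lin.
- by apply: (@gdom_poly _ _ _ (2 / V) (4 / V ^+ 2)) => // p; exact: quad.
- by apply: (@gdom_poly _ _ _ (2 / V) (2 / V)) => // p; rewrite [p.1 ^+ 2 + _]addrC; exact: lin.
- by apply: (@gdom_poly _ _ _ (2 / V) (4 / V ^+ 2)) => // p; rewrite [p.1 ^+ 2 + _]addrC; exact: quad.
Qed.

(** The Gaussian densities solve the heat equation. *)
Lemma heat p : is_derive V 1 (fun v => gdens v p) (lap gauss p / 4).
Proof.
have Vv := rdV (F := fun v => v) Vn0 (rd_id V).
have piV : pi * V != 0 by rewrite mulf_neq0// gt_eqF// pi_gt0.
have pVv := rdV (F := fun v => pi * v) piV (rdZ pi (rd_id V)).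
apply: is_derive_eq (rdM pVv (rd_exp (rdZ (- (p.1 ^+ 2 + p.2 ^+ 2)) Vv))) _.
rewrite lap_gauss /gdens /=; move: (expR _) => E; move: (p.1 ^+ 2 + p.2 ^+ 2) => q.
have : pi != 0 :> R by rewrite gt_eqF// pi_gt0.
move: (pi : R) => c c0.
by field; rewrite ?Vn0 ?c0.
Qed.

End Fixed.

(** Mean of the logarithm of the distance to [k] of a centred complex
    Gaussian variable of density [gdens V]. *)
Definition gpot k (V : R) : R := Rintegral l2 setT (fun p => gdens V p * lndist k p).

Lemma gdom_gdens (V : R) : 0 < V -> gdom (gdens V).
Proof. by move=> V0; have [] := c2_gdom_gauss V0. Qed.

Lemma integrable_gdens_lndist k (V : R) : 0 < V ->
  l2.-integrable setT (EFin \o (fun p => gdens V p * lndist k p)).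
Proof.
move=> V0; apply: integrable_gdom_lndist; last exact: gdom_gdens.
exact: measurable_gdens.
Qed.

(** Differentiating under the integral, the heat equation turns the derivative
    into the integral of a Laplacian against the logarithmic kernel. *)
Lemma gpot_is_derive k (V : R) : 0 < V ->
  is_derive V 1 (gpot k) (expR (- (k.1 ^+ 2 + k.2 ^+ 2) / V) / (2 * V)).
Proof.
move=> V0; pose f v p := gdens v p * lndist k p.
have I (v : R) : [set` `]V / 2, 2 * V[%R] v -> V / 2 < v /\ v < 2 * V.
  by rewrite /= in_itv /= => /andP[].
have Ip (v : R) : V / 2 < v -> 0 < v by move=> h; apply: lt_trans h; rewrite divr_gt0.
have df (v : R) p (v0 : 0 < v) : is_derive v 1 (fun v => f v p) (lap (gauss v0) p / 4 * lndist k p).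
  have := rdM (heat v0 p) (rd_cst (lndist k p) v).
  by rewrite mulr0 addr0.
pose H p := 4 * gdens (2 * V) p * (2 / V + 4 / V ^+ 2 * (p.1 ^+ 2 + p.2 ^+ 2)).
have V20 : 0 < 2 * V by rewrite mulr_gt0.
have a0 : 0 <= 2 / V by rewrite divr_ge0// ltW.
have b0 : 0 <= 4 / V ^+ 2 by rewrite divr_ge0// sqr_ge0.
have n0 p : 0 <= p.1 ^+ 2 + p.2 ^+ 2 by rewrite addr_ge0// sqr_ge0.
have H0 p : 0 <= H p.
  apply: mulr_ge0; first by apply: mulr_ge0 => //; apply: gdens_ge0; exact: ltW.
  by apply: addr_ge0 => //; exact: mulr_ge0.
have gH : gdom H.
  apply: (@gdom_poly _ _ _ (2 / V) (4 / V ^+ 2)) => //.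
    exists 4, (2 * V); split => // p; rewrite ger0_norm//.
    by apply: mulr_ge0 => //; apply: gdens_ge0; exact: ltW.
  by move=> p; rewrite ger0_norm// addr_ge0// mulr_ge0.
have mH : measurable_fun setT H.
  apply: measurable_funM; first by apply: measurable_funM => //; exact: measurable_gdens.
  apply: measurable_funD => //; apply: measurable_funM => //.
  by apply: measurable_funD; apply: measurable_funX.
pose G p := H p * `|lndist k p|.
have iG : l2.-integrable setT (EFin \o G).
  have := integrable_abse (integrable_gdom_lndist k mH gH).
  by congr integrable; apply/funext => p /=; rewrite normrM (ger0_norm (H0 p)).
have G0 p : 0 <= G p by rewrite mulr_ge0.
have IV : [set` `]V / 2, 2 * V[%R] V by rewrite /= in_itv /=; apply/andP; split; lra.
have int (v : R) : [set` `]V / 2, 2 * V[%R] v -> l2.-integrable setT (EFin \o f v).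
  by move=> /I[/Ip v0 _]; exact: integrable_gdens_lndist.
have der (v : R) p : [set` `]V / 2, 2 * V[%R] v -> setT p -> derivable (fun v => f v p) v 1.
  by move=> /I[/Ip v0 _] _; have [] := df v p v0.
have bd (v : R) p : [set` `]V / 2, 2 * V[%R] v -> setT p -> `|partial1of2 f v p| <= G p.
  move=> /I[vl vu] _; have v0 := Ip _ vl; rewrite partial1of2E.
  have [_ ->] := df v p v0; rewrite normrM /G ler_wpM2r// lap_gauss.
  have gv0 : 0 <= gdens v p by rewrite gdens_ge0// ltW.
  rewrite -mulrA normrM (ger0_norm gv0) /H.
  have g4 : gdens v p <= 4 * gdens (2 * V) p.
    apply: le_trans (gdens_le p v0 (ltW vu)) _; rewrite ler_wpM2r// ?gdens_ge0 ?(ltW V20)//.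
    by rewrite ler_pdivrMr//; move: vl; lra.
  apply: ler_pM => //.
  have iv : v^-1 <= 2 / V by rewrite -[2 / V]invrK lef_pV2 ?posrE ?invr_gt0 ?divr_gt0// invf_div ltW.
  have iv0 : 0 <= v^-1 by rewrite invr_ge0 ltW.
  have -> : (4 / v ^+ 2 * (p.1 ^+ 2 + p.2 ^+ 2) - 4 / v) / 4 = v^-1 ^+ 2 * (p.1 ^+ 2 + p.2 ^+ 2) - v^-1.
    by field; rewrite gt_eqF.
  apply: le_trans (ler_normB _ _) _; rewrite addrC (ger0_norm iv0); apply: lerD => //.
  rewrite ger0_norm; last by rewrite mulr_ge0// exprn_ge0.
  apply: ler_wpM2r => //; have -> : 4 / V ^+ 2 = (2 / V) ^+ 2 by field; rewrite gt_eqF.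
  by rewrite lerXn2r// nnegrE.
have D := @derivable_under_integral R _ _ l2 f setT measurableT V (V / 2) (2 * V) IV int der G G0 iG bd.
have E := @differentiation_under_integral R _ _ l2 f setT measurableT V (V / 2) (2 * V) IV int der G G0 iG bd.
apply: DeriveDef; first exact: D.
rewrite -derive1E E.
have K := lap_lndist k (c2_gdom_gauss V0).
rewrite /Rintegral (_ : (\int[l2]_p _)%E = (4^-1 * (2 * pi * gdens V k))%:E) /=.
  rewrite /gdens; have : pi != 0 :> R by rewrite gt_eqF// pi_gt0.
  have Vn0 : V != 0 by rewrite gt_eqF.
  by move: (pi : R) (expR _) => c e c0; field; rewrite Vn0 c0.
rewrite EFinM -K -integralZl//=; last first.
  have [_ _ g11 _ g22] := c2_gdom_gauss V0.
  apply: integrable_gdom_lndist; last exact: gdomD.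
  by apply: continuous_measurable_plane; exact: continuous_lap.
apply: eq_integral => p _; rewrite -EFinM; congr EFin; rewrite partial1of2E.
by have [_ ->] := df V p V0; move: (lap _ _) (lndist _ _) => a b; rewrite mulrA [4^-1 * _]mulrC.
Qed.

End GaussianPotential.

(** * Test functions approximating a compact set *)

Section BumpFunctions.
Variable R : realType.
Local Notation mu := (@lebesgue_measure R).
Implicit Types (f g : c2fun R) (p k : R * R) (A T O : set (R * R)).

Let m (t : R) : R := Num.max t 0.

Let mE t : m t = if t <= 0 then 0 else t.
Proof. by rewrite /m maxEle. Qed.

Let m_ge0 t : 0 <= m t. Proof. by rewrite /m le_max lexx orbT. Qed.

Let mM t : t * m t = m t ^+ 2.
Proof. by rewrite mE; case: ifP => _; rewrite ?mulr0 ?expr0n//= expr2. Qed.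

Let continuous_m : continuous m.
Proof. by move=> t; apply: continuous_max; [exact: cvg_id|exact: cvg_cst]. Qed.

Let d_m2 (t : R) : is_derive t 1 (fun s => m s ^+ 2) (2 * m t).
Proof.
apply: rdiff_is_derive => e e0; exists e => // h he.
apply: (@le_trans _ _ (h ^+ 2)); last first.
  by rewrite -(real_normK (num_real h)) expr2 ler_wpM2r// ltW.
rewrite ler_norml !mE; case: (leP t 0) => t0; case: (leP (t + h) 0) => th0; apply/andP; split; nra.
Qed.

Definition cube (t : R) : R := t * m t ^+ 2.
Definition cube1 (t : R) : R := 3 * m t ^+ 2.
Definition cube2 (t : R) : R := 6 * m t.

Lemma d_cube (t : R) : is_derive t 1 cube (cube1 t).
Proof.
apply: is_derive_eq (rdM (rd_id t) (d_m2 t)) _.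
by rewrite /cube1 mul1r (mulrCA t 2) mM; ring.
Qed.

Lemma d_cube1 (t : R) : is_derive t 1 cube1 (cube2 t).
Proof. by apply: is_derive_eq (rdZ 3 (d_m2 t)) _; rewrite /cube2; ring. Qed.

Let third (j : R -> R) (t : R) : R :=
  6^-1 * (j t - 3 * j (t - 1) + 3 * j (t - 2) - j (t - 3)).

Let d_third (j j1 : R -> R) (t : R) : (forall s : R, is_derive s 1 j (j1 s)) ->
  is_derive t 1 (third j) (third j1 t).
Proof.
move=> dj; have sh (c : R) : is_derive t 1 (fun s => j (s - c)) (j1 (t - c)).
  have := rd_comp (F := j) (G := fun s => s - c) (dj (t - c)) (rdB (rd_id t) (rd_cst c t)).
  by rewrite subr0 mulr1.
exact: (rdZ 6^-1 (rdB (rdD (rdB (dj t) (rdZ 3 (sh 1))) (rdZ 3 (sh 2))) (sh 3))).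
Qed.

Let continuous_third (j : R -> R) : continuous j -> continuous (third j).
Proof.
move=> cj t; have sh (c : R) : {for t, continuous (fun s => j (s - c))}.
  apply: (@cvg_comp _ _ _ (fun s => s - c) j); last exact: cj.
  by apply: cvgB; [exact: cvg_id|exact: cvg_cst].
apply: cvgM; first exact: cvg_cst.
apply: cvgB; last exact: sh.
apply: cvgD; last by apply: cvgM; [exact: cvg_cst|exact: sh].
by apply: cvgB; [exact: cj|apply: cvgM; [exact: cvg_cst|exact: sh]].
Qed.

(** A twice differentiable increasing step from 0 to 1: the third difference
    of the truncated cube, that is, the integral of a quadratic spline. *)
Definition step : R -> R := third cube.

Lemma step_le0 t : t <= 0 -> step t = 0.
Proof.
move=> t0; rewrite /step /third /cube !mE.
rewrite !ifT; first ring.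
all: lra.
Qed.

Lemma step_ge3 t : 3 <= t -> step t = 1.
Proof.
move=> t3; have mp (c : R) : 0 <= c -> m c = c by move=> c0; rewrite /m max_l.
rewrite /step /third /cube !mp; first (by field); lra.
Qed.

Lemma step_bound t : 0 <= step t <= 1.
Proof.
have [t0|t0] := leP t 0; first by rewrite step_le0// lexx ler01.
have [t3|t3] := leP 3 t; first by rewrite step_ge3// ler01 lexx.
have cb (x : R) : 0 <= x -> x <= 1 -> 0 <= x ^+ 3 <= 1.
  by move=> x0 x1; rewrite exprn_ge0//= exprn_ile1.
rewrite /step /third /cube !mE (ifF _ _ (lt_geF t0)).
have -> : t - 3 <= 0 by lra.
rewrite expr0n /= mulr0 subr0.
have [t1|t1] := leP (t - 1) 0.
  have -> : t - 2 <= 0 by lra.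
  have := cb t (ltW t0) _; rewrite -subr_le0 => /(_ t1) /andP[c0 c1].
  rewrite expr0n /= !mulr0 subr0 addr0 -exprS; apply/andP; split; first by rewrite mulr_ge0// invr_ge0.
  by move: c1; lra.
have [t2|t2] := leP (t - 2) 0.
  have w0 : 0 <= t - 1 by exact: ltW.
  have w1 : t - 1 <= 1 by lra.
  rewrite expr0n /= !mulr0 addr0 -!exprS.
  have -> : t ^+ 3 - 3 * (t - 1) ^+ 3 = 1 + 3 * (t - 1) + 3 * (t - 1) ^+ 2 * (1 - (t - 1)) + (t - 1) ^+ 3 by ring.
  move: (t - 1) w0 w1 => w w0 w1.
  have /andP[c0 c1] := cb w w0 w1; have q0 : 0 <= w ^+ 2 * (1 - w) by rewrite mulr_ge0 ?sqr_ge0// subr_ge0.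
  have q1 : 0 <= (w * (1 - w)) * (1 - w) by rewrite !mulr_ge0// subr_ge0.
  have q2 : w ^+ 3 = w * w ^+ 2 by rewrite exprS.
  by rewrite expr2 in q0 q2 *; apply/andP; split; nra.
have w0 : 0 <= 3 - t by lra.
have w1 : 3 - t <= 1 by lra.
have -> : 6^-1 * (t * t ^+ 2 - 3 * ((t - 1) * (t - 1) ^+ 2) + 3 * ((t - 2) * (t - 2) ^+ 2)) = 1 - 6^-1 * (3 - t) ^+ 3 by field.
by have /andP[] := cb _ w0 w1; move: ((3 - t) ^+ 3) => x; lra.
Qed.

Section Radial.
Variables (k : R * R) (a : R).

Let q p : R := 4 - a * r2 k p.
Let s1 := third cube1.
Let s2 := third cube2.
Let b p := step (q p).
Let b1 p := s1 (q p) * (- (2 * a) * (p.1 - k.1)).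
Let b2 p := s1 (q p) * (- (2 * a) * (p.2 - k.2)).
Let b11 p := s2 (q p) * (- (2 * a) * (p.1 - k.1)) ^+ 2 - (2 * a) * s1 (q p).
Let b22 p := s2 (q p) * (- (2 * a) * (p.2 - k.2)) ^+ 2 - (2 * a) * s1 (q p).

Let dq1 (x y : R) : is_derive x 1 (fun t => q (t, y)) (- (2 * a) * (x - k.1)).
Proof.
apply: is_derive_eq (rdB (rd_cst 4 x) (rdZ a (rdD (rdX2 (rdB (rd_id x) (rd_cst k.1 x))) (rd_cst ((y - k.2) ^+ 2) x)))) _.
ring.
Qed.

Let dq2 (x y : R) : is_derive y 1 (fun t => q (x, t)) (- (2 * a) * (y - k.2)).
Proof.
apply: is_derive_eq (rdB (rd_cst 4 y) (rdZ a (rdD (rd_cst ((x - k.1) ^+ 2) y) (rdX2 (rdB (rd_id y) (rd_cst k.2 y)))))) _.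
ring.
Qed.

Let d_step (t : R) : is_derive t 1 step (s1 t).
Proof. exact: d_third d_cube. Qed.

Let d_s1 (t : R) : is_derive t 1 s1 (s2 t).
Proof. exact: d_third d_cube1. Qed.

Let db1 (x y : R) : is_derive x 1 (fun t => b (t, y)) (b1 (x, y)).
Proof. exact: rd_comp (d_step _) (dq1 x y). Qed.

Let db2 (x y : R) : is_derive y 1 (fun t => b (x, t)) (b2 (x, y)).
Proof. exact: rd_comp (d_step _) (dq2 x y). Qed.

Let db11 (x y : R) : is_derive x 1 (fun t => b1 (t, y)) (b11 (x, y)).
Proof.
apply: is_derive_eq (rdM (rd_comp (d_s1 _) (dq1 x y)) (rdZ (- (2 * a)) (rdB (rd_id x) (rd_cst k.1 x)))) _.
by rewrite /b11 /=; move: (s1 _) (s2 _) => u v; ring.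
Qed.

Let db22 (x y : R) : is_derive y 1 (fun t => b2 (x, t)) (b22 (x, y)).
Proof.
apply: is_derive_eq (rdM (rd_comp (d_s1 _) (dq2 x y)) (rdZ (- (2 * a)) (rdB (rd_id y) (rd_cst k.2 y)))) _.
by rewrite /b22 /=; move: (s1 _) (s2 _) => u v; ring.
Qed.

Let cx : continuous (fun p : R * R => - (2 * a) * (p.1 - k.1)).
Proof.
move=> p; apply: cvgM; first exact: cvg_cst.
by apply: cvgB; [exact: continuous_coord1|exact: cvg_cst].
Qed.

Let cy : continuous (fun p : R * R => - (2 * a) * (p.2 - k.2)).
Proof.
move=> p; apply: cvgM; first exact: cvg_cst.
by apply: cvgB; [exact: continuous_coord2|exact: cvg_cst].
Qed.

Lemma continuous_r2 : continuous (r2 k).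
Proof.
move=> p; apply: cvgD; apply: cvgM;
  solve [apply: cvgB; [exact: continuous_coord1|exact: cvg_cst]|apply: cvgB; [exact: continuous_coord2|exact: cvg_cst]].
Qed.

Let cq : continuous q.
Proof.
move=> p; apply: cvgB; first exact: cvg_cst.
by apply: cvgM; [exact: cvg_cst|exact: continuous_r2].
Qed.

Let cm2 : continuous (fun t => m t ^+ 2).
Proof. by move=> t; apply: cvgM; exact: continuous_m. Qed.

Let c_cube : continuous cube.
Proof. by move=> t; apply: cvgM; [exact: cvg_id|exact: cm2]. Qed.

Let c_s1 : continuous s1.
Proof.
by apply: continuous_third => t; apply: cvgM; [exact: cvg_cst|exact: cm2].
Qed.

Let c_s2 : continuous s2.
Proof.
by apply: continuous_third => t; apply: cvgM; [exact: cvg_cst|exact: continuous_m].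
Qed.

Let comp (j : R -> R) : continuous j -> continuous (fun p => j (q p)).
Proof. by move=> cj p; apply: (@cvg_comp _ _ _ q j); [exact: cq|exact: cj]. Qed.

Let cb : continuous b.
Proof. by apply: comp; exact: continuous_third. Qed.

Let cb1 : continuous b1.
Proof. by move=> p; apply: cvgM; [exact: comp c_s1 p|exact: cx]. Qed.

Let cb2 : continuous b2.
Proof. by move=> p; apply: cvgM; [exact: comp c_s1 p|exact: cy]. Qed.

Let cb11 : continuous b11.
Proof.
move=> p; apply: cvgB; apply: cvgM; [exact: comp c_s2 p| |exact: cvg_cst|exact: comp c_s1 p].
by apply: cvgM; exact: cx.
Qed.

Let cb22 : continuous b22.
Proof.
move=> p; apply: cvgB; apply: cvgM; [exact: comp c_s2 p| |exact: cvg_cst|exact: comp c_s1 p].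
by apply: cvgM; exact: cy.
Qed.

Definition bump : c2fun R := C2Fun db1 db11 db2 db22 cb cb1 cb11 cb2 cb22.

Lemma bumpE p : c2 bump p = step (4 - a * r2 k p).
Proof. by []. Qed.

End Radial.

Section Product.
Variables f g : c2fun R.

Definition c2_cst (c : R) : c2fun R :=
  C2Fun (fun x y => rd_cst c x) (fun x y => rd_cst 0 x)
    (fun x y => rd_cst c y) (fun x y => rd_cst 0 y)
    (@continuous_cst2 R c) (@continuous_cst2 R 0) (@continuous_cst2 R 0) (@continuous_cst2 R 0)
    (@continuous_cst2 R 0).

Definition c2_compl : c2fun R :=
  @C2Fun R (fun p => 1 - c2 f p) (fun p => 0 - c2_1 f p) (fun p => 0 - c2_11 f p)
    (fun p => 0 - c2_2 f p) (fun p => 0 - c2_22 f p)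
    (fun x y => rdB (rd_cst 1 x) (c2_d1 f x y)) (fun x y => rdB (rd_cst 0 x) (c2_d11 f x y))
    (fun x y => rdB (rd_cst 1 y) (c2_d2 f x y)) (fun x y => rdB (rd_cst 0 y) (c2_d22 f x y))
    (continuous_sub2 (@continuous_cst2 R 1) (@c2_c R f))
    (continuous_sub2 (@continuous_cst2 R 0) (@c2_c1 R f))
    (continuous_sub2 (@continuous_cst2 R 0) (@c2_c11 R f))
    (continuous_sub2 (@continuous_cst2 R 0) (@c2_c2 R f))
    (continuous_sub2 (@continuous_cst2 R 0) (@c2_c22 R f)).

Definition c2_mul : c2fun R :=
  @C2Fun R (fun p => c2 f p * c2 g p)
    (fun p => c2_1 f p * c2 g p + c2 f p * c2_1 g p)
    (fun p => (c2_11 f p * c2 g p + c2_1 f p * c2_1 g p) +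
      (c2_1 f p * c2_1 g p + c2 f p * c2_11 g p))
    (fun p => c2_2 f p * c2 g p + c2 f p * c2_2 g p)
    (fun p => (c2_22 f p * c2 g p + c2_2 f p * c2_2 g p) +
      (c2_2 f p * c2_2 g p + c2 f p * c2_22 g p))
    (fun x y => rdM (c2_d1 f x y) (c2_d1 g x y))
    (fun x y => rdD (rdM (c2_d11 f x y) (c2_d1 g x y)) (rdM (c2_d1 f x y) (c2_d11 g x y)))
    (fun x y => rdM (c2_d2 f x y) (c2_d2 g x y))
    (fun x y => rdD (rdM (c2_d22 f x y) (c2_d2 g x y)) (rdM (c2_d2 f x y) (c2_d22 g x y)))
    (continuous_mul2 (@c2_c R f) (@c2_c R g))
    (continuous_add2 (continuous_mul2 (@c2_c1 R f) (@c2_c R g))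
      (continuous_mul2 (@c2_c R f) (@c2_c1 R g)))
    (continuous_add2
      (continuous_add2 (continuous_mul2 (@c2_c11 R f) (@c2_c R g))
        (continuous_mul2 (@c2_c1 R f) (@c2_c1 R g)))
      (continuous_add2 (continuous_mul2 (@c2_c1 R f) (@c2_c1 R g))
        (continuous_mul2 (@c2_c R f) (@c2_c11 R g))))
    (continuous_add2 (continuous_mul2 (@c2_c2 R f) (@c2_c R g))
      (continuous_mul2 (@c2_c R f) (@c2_c2 R g)))
    (continuous_add2
      (continuous_add2 (continuous_mul2 (@c2_c22 R f) (@c2_c R g))
        (continuous_mul2 (@c2_c2 R f) (@c2_c2 R g)))
      (continuous_add2 (continuous_mul2 (@c2_c2 R f) (@c2_c2 R g))
        (continuous_mul2 (@c2_c R f) (@c2_c22 R g)))).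

Lemma c2_supp_closed A : closed A -> (forall p, ~ A p -> c2 f p = 0) -> c2_supp f A.
Proof.
move=> cA f0.
have s1 (F F1 : R * R -> R) : (forall x y : R, is_derive x 1 (fun t => F (t, y)) (F1 (x, y))) ->
    (forall p, ~ A p -> F p = 0) -> forall p, ~ A p -> F1 p = 0.
  move=> dF F0 [x y] nA; have [_ <-] := dF x y.
  by have [_ ->] := rd_near0 (near_section1 (near_supp cA F0 nA)).
have s2 (F F2 : R * R -> R) : (forall x y : R, is_derive y 1 (fun t => F (x, t)) (F2 (x, y))) ->
    (forall p, ~ A p -> F p = 0) -> forall p, ~ A p -> F2 p = 0.
  move=> dF F0 [x y] nA; have [_ <-] := dF x y.
  by have [_ ->] := rd_near0 (near_section2 (near_supp cA F0 nA)).
have f1 := s1 _ _ (c2_d1 f) f0; have f11 := s1 _ _ (c2_d11 f) f1.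
have f2 := s2 _ _ (c2_d2 f) f0; have f22 := s2 _ _ (c2_d22 f) f2.
by move=> p nA; split; auto.
Qed.

End Product.

Definition hull (s : seq (c2fun R)) : c2fun R :=
  c2_compl (foldr (fun b acc => c2_mul (c2_compl b) acc) (c2_cst 1) s).

Lemma hullE s p : c2 (hull s) p = 1 - \prod_(b <- s) (1 - c2 b p).
Proof.
rewrite /hull /=; congr (1 - _); elim: s => [|b s IH] /=; first by rewrite big_nil.
by rewrite big_cons IH.
Qed.

HB.instance Definition _ := Topological.on (R * R)%type.

(** Bumps that equal 1 on balls covering [T] are combined by multiplying their
    complements to 1: the result equals 1 as soon as one of them does, and stays
    between 0 and 1. *)
Lemma bump_cover T (rho : R * R -> R) : compact T -> (forall t, 0 < rho t) ->
  exists s : seq (R * R), (forall t, t \in s -> T t) /\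
  exists f, [/\ forall p, 0 <= c2 f p <= 1, forall p, T p -> c2 f p = 1 &
    forall p, c2 f p != 0 -> exists2 t, t \in s & r2 t p <= 4 * rho t ^+ 2].
Proof.
move=> cT rho0; move: cT; rewrite compact_cover => cT.
have [|t Tt|D DT TD] := cT _ T (fun t => [set p | r2 t p < rho t ^+ 2]).
- move=> t _; have := @continuous_r2 t; move/continuousP => /(_ [set x | x < rho t ^+ 2]).
  by apply; exact: open_lt.
- exists t => //=; rewrite /r2 !subrr expr0n /= addr0 exprn_gt0//.
pose b t := bump t (rho t ^+ 2)^-1.
exists (finmap.enum_fset D); split; first by move=> t tD; have := DT t tD; rewrite inE.
exists (hull [seq b t | t <- finmap.enum_fset D]).
have r20 t : 0 < rho t ^+ 2 by rewrite exprn_gt0.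
have bb t p : 0 <= 1 - c2 (b t) p <= 1.
  by have := step_bound (4 - (rho t ^+ 2)^-1 * r2 t p); rewrite /b bumpE => /andP[? ?]; apply/andP; split; lra.
split=> [p|p /TD[t tD tp]|p]; rewrite hullE big_map.
- have p0 : 0 <= \prod_(t <- finmap.enum_fset D) (1 - c2 (b t) p).
    by apply: prodr_ge0 => t _; have /andP[] := bb t p.
  have p1 : \prod_(t <- finmap.enum_fset D) (1 - c2 (b t) p) <= 1.
    by apply: prodr_ile1 => t _; exact: bb.
  by apply/andP; split; lra.
- rewrite (big_rem t)//= step_ge3 ?subrr ?mul0r ?subr0//.
  have : (rho t ^+ 2)^-1 * r2 t p <= 1 by rewrite mulrC ler_pdivrMr// mul1r; exact: ltW.
  lra.
- move=> n0; apply: contrapT => nt; move/eqP: n0; apply.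
  rewrite big_seq big1 ?subrr// => t tD; rewrite /b bumpE step_le0 ?subr0//.
  have : 4 * rho t ^+ 2 < r2 t p by rewrite ltNge; apply/negP => h; apply: nt; exists t.
  by rewrite -(ltr_pdivlMr _ _ (r20 t)) mulrC; lra.
Qed.

Lemma r2_coord k p (e : R) : 0 <= e -> r2 k p <= e ^+ 2 -> `|p.1 - k.1| <= e /\ `|p.2 - k.2| <= e.
Proof.
move=> e0 h; split; rewrite -(ler_pXn2r (n := 2))// ?nnegrE// real_normK ?num_real//;
  apply: le_trans h; rewrite /r2 ?lerDl ?lerDr sqr_ge0//.
Qed.

(** The indicator of a compact set as a limit of twice differentiable functions
    that are all supported in one compact subset of a given neighbourhood and
    dominated by one of their kind. *)
Lemma test_functions T O : compact T -> open O -> T `<=` O ->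
  exists A (M : R) psi (phi : nat -> c2fun R), [/\ closed A, A `<=` O, A `<=` box M &
  [/\ c2_supp psi A, forall n, c2_supp (phi n) A,
    forall n p, 0 <= c2 (phi n) p <= c2 psi p,
    forall n p, T p -> c2 (phi n) p = 1 &
    forall p, ~ T p -> \forall n \near \oo, c2 (phi n) p = 0]].
Proof.
move=> cT oO TO.
have rhoP t : exists rho : R, 0 < rho /\ (T t -> forall p, r2 t p <= 4 * rho ^+ 2 -> O p).
  have [Tt|nT] := pselect (T t); last by exists 1; split.
  have /near_pairP[d d0 H] : \forall q \near t, O q by exact: open_nbhs_nbhs (conj oO (TO _ Tt)).
  exists (d / 4); split=> [|_ p]; first by rewrite divr_gt0.
  have -> : 4 * (d / 4) ^+ 2 = (d / 2) ^+ 2 by field.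
  by move=> /(r2_coord (ltW (divr_gt0 d0 (ltr0n _ 2))))[p1 p2]; apply: H; [move: p1|move: p2]; lra.
have [rho rhoH] := choice rhoP.
have rho0 t : 0 < rho t by have [] := rhoH t.
have [s [sT [psi [psib psi1 psi0]]]] := bump_cover cT rho0.
pose A := [set p | exists2 t, t \in s & r2 t p <= 4 * rho t ^+ 2].
have cA : closed A.
  rewrite (_ : A = \big[setU/set0]_(t <- s) [set p | r2 t p <= 4 * rho t ^+ 2]).
    apply: closed_bigsetU => t _.
    have := @continuous_r2 t; move/continuous_closedP => /(_ [set x | x <= 4 * rho t ^+ 2]).
    by apply; exact: closed_le.
  apply/seteqP; split=> p; rewrite -bigcup_seq.
    by move=> [t ts h]; exists t.
  by move=> [t /= ts h]; exists t.
have AO : A `<=` O by move=> p [t /sT Tt]; have [_] := rhoH t; apply.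
have [M HM] : exists M, forall t, t \in s -> `|t.1| + `|t.2| + 2 * rho t <= M.
  elim: (s) => [|t r [M IH]]; first by exists 0.
  exists (Num.max M (`|t.1| + `|t.2| + 2 * rho t)) => u; rewrite inE => /orP[/eqP ->|/IH h].
    by rewrite le_max lexx orbT.
  by rewrite le_max h.
have AM : A `<=` box M.
  move=> p [t ts]; have -> : 4 * rho t ^+ 2 = (2 * rho t) ^+ 2 by ring.
  have := HM t ts; have := rho0 t => r0 hM.
  have e0 : 0 <= 2 * rho t by rewrite mulr_ge0// ltW.
  move=> /(r2_coord e0)[]; rewrite !ler_norml => /andP[a1 a2] /andP[b1 b2].
  have [x1 x2] : - `|t.1| <= t.1 /\ t.1 <= `|t.1| by split; [rewrite lerNl -normrN ler_norm|exact: ler_norm].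
  have [y1 y2] : - `|t.2| <= t.2 /\ t.2 <= `|t.2| by split; [rewrite lerNl -normrN ler_norm|exact: ler_norm].
  have z1 := normr_ge0 t.1; have z2 := normr_ge0 t.2.
  by split; rewrite /= in_itv /=; apply/andP; split; move: (`|t.1|) (`|t.2|) hM x1 x2 y1 y2 z1 z2 => u v; lra.
have psiA p : ~ A p -> c2 psi p = 0.
  by move=> nA; apply: contrapT => /eqP /psi0.
have E' n : exists f, [/\ forall p, 0 <= c2 f p <= 1, forall p, T p -> c2 f p = 1 &
    forall p, c2 f p != 0 -> exists2 t, T t & r2 t p <= 4 * n.+1%:R^-1 ^+ 2].
  have [|s' [s'T [f [f1 f2 f3]]]] := bump_cover (rho := fun _ => n.+1%:R^-1) cT.
    by move=> _; rewrite invr_gt0.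
  by exists f; split=> // p /f3[t /s'T]; exists t.
have [phi phiH] := choice E'.
exists A, M, psi, (fun n => c2_mul psi (phi n)); split=> //; split.
- exact: c2_supp_closed.
- by move=> n; apply: c2_supp_closed => // p /psiA /= ->; rewrite mul0r.
- move=> n p /=; have /andP[a0 a1] := psib p; have [/(_ p) /andP[b0 b1] _ _] := phiH n.
  by rewrite mulr_ge0//= ler_piMr.
- by move=> n p Tp /=; have [_ e _] := phiH n; rewrite (e _ Tp) psi1// mulr1.
- move=> p nT; have clT : closed T by apply: compact_closed => //; exact: norm_hausdorff.
  have /near_pairP[d d0 H] : \forall q \near p, ~ T q.
    exact: open_nbhs_nbhs (conj (closed_openC clT) nT).
  have : \forall n \near \oo, 2 * n.+1%:R^-1 < d.
    have : (fun n => 2 * n.+1%:R^-1 : R) @ \oo --> (2 * 0 : R) by apply: cvgMr; exact: cvg_harmonic.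
    by rewrite mulr0 => /cvgrPdist_lt /(_ d d0); apply: filterS => n; rewrite sub0r normrN ger0_norm.
  apply: filterS => n nd /=; apply/eqP; rewrite mulf_eq0; apply/orP; right; apply/negPn/negP.
  have [_ _ h] := phiH n; move=> /h[t Tt].
  have -> : 4 * n.+1%:R^-1 ^+ 2 = (2 * n.+1%:R^-1) ^+ 2 :> R by ring.
  have e0 : 0 <= 2 * n.+1%:R^-1 :> R by rewrite mulr_ge0.
  move=> /(r2_coord e0)[h1 h2]; apply: (H t) => //; rewrite distrC; exact: le_lt_trans nd.
Qed.

End BumpFunctions.

(** * Laws of Gaussian sums *)

Section Area. Variable R : realType.
Local Notation mu := (@lebesgue_measure R).
Local Notation l2 := (mu \x mu)%E.
Lemma sigma_finite_area : sigma_finite setT l2.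
Proof.
exists (fun n => box n%:R) => [|n]; last by split; [exact: box_measurable|exact: box_finite].
rewrite predeqE => p; split=> // _.
have [n1 h1] : exists n : nat, `|p.1| <= n%:R.
  by exists (Num.truncn `|p.1|).+1; apply: ltW; rewrite truncnS_gt.
have [n2 h2] : exists n : nat, `|p.2| <= n%:R.
  by exists (Num.truncn `|p.2|).+1; apply: ltW; rewrite truncnS_gt.
have g (x : R) (n m : nat) : `|x| <= n%:R -> (n <= m)%N -> [set` `[- m%:R, m%:R]%R] x.
  by move=> xn nm; rewrite /= in_itv /= -ler_norml; apply: le_trans xn _; rewrite ler_nat.
exists (n1 + n2)%N => //; split; [exact: g h1 (leq_addr _ _)|exact: g h2 (leq_addl _ _)].
Qed.
(** The planar Lebesgue measure under a name of its own, which carries the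
    sigma-finite structure that the Fubini theorems ask for. *)
Definition area : set (measurableTypeR R * measurableTypeR R) -> \bar R := l2.
HB.instance Definition _ := Measure.on area.
HB.instance Definition _ := Measure_isSigmaFinite.Build _ _ _ area sigma_finite_area.
End Area.

Section GaussianLaw.
Variable R : realType.
Local Notation mu := (@lebesgue_measure R).
Local Notation l2 := (mu \x mu)%E.

Import HBNNSimple.

Let integral_normal_nnsfun (m s : R) (h : {nnsfun (measurableTypeR R) >-> R}) :
  (\int[normal_prob m s]_x (h x)%:E = \int[mu]_x ((h x)%:E * (normal_pdf m s x)%:E))%E.
Proof.
pose g x := (normal_pdf m s x)%:E.
have g0 x : (0 <= g x)%E by rewrite lee_fin normal_pdf_ge0.
have mg : measurable_fun setT g by apply/measurable_EFinP; exact: measurable_normal_pdf.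
under [LHS]eq_integral do rewrite fimfunE -fsumEFin//.
rewrite [LHS]ge0_integral_fsum//; last 2 first.
  - by move=> r; exact/measurable_EFinP/measurableT_comp.
  - by move=> n x _; rewrite EFinM nnfun_muleindic_ge0.
under [RHS]eq_integral.
  move=> x xD; rewrite fimfunE -fsumEFin// ge0_mule_fsuml; last first.
    by move=> r; rewrite EFinM nnfun_muleindic_ge0.
  over.
rewrite [RHS]ge0_integral_fsum//; last 2 first.
  - move=> r; apply: emeasurable_funM => //; apply/measurable_EFinP; exact/measurableT_comp.
  - move=> n x _; apply: mule_ge0; last exact: g0.
    by rewrite EFinM nnfun_muleindic_ge0.
apply: eq_fsbigr => r _; set A := h @^-1` [set r].
have mA : measurable A by exact: measurable_sfunP.
have iA : mu.-integrable setT (g \_ A).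
  rewrite -integrable_mkcond//; apply: integrableS (integrable_normal_pdf m s) => //.
rewrite integralZl_indic_nnsfun// integral_indic//= setIT.
rewrite [X in (_ * X)%E](_ : _ = \int[mu]_(x in A) g x)%E//.
rewrite integral_mkcond -integralZl//; apply: eq_integral => x _.
by rewrite patchE EFinM indicE; case: (x \in A); rewrite ?mule1 ?mule0 ?mul0e.
Qed.

Lemma integral_normal_prob (m s : R) (f : measurableTypeR R -> \bar R) :
  measurable_fun setT f -> (forall x, 0 <= f x)%E ->
  (\int[normal_prob m s]_x f x = \int[mu]_x (f x * (normal_pdf m s x)%:E))%E.
Proof.
move=> mf f0; pose g x := (normal_pdf m s x)%:E.
have g0 x : (0 <= g x)%E by rewrite lee_fin normal_pdf_ge0.
have mg : measurable_fun setT g by apply/measurable_EFinP; exact: measurable_normal_pdf.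
pose f_ := nnsfun_approx measurableT mf.
transitivity (lim (\int[normal_prob m s]_x (f_ n x)%:E @[n --> \oo])%E).
  rewrite -monotone_convergence//=.
  - apply: eq_integral => ? /[!inE] xD; apply/esym/cvg_lim => //=.
    exact: cvg_nnsfun_approx.
  - by move=> n; exact/measurable_EFinP/measurable_funTS.
  - by move=> n ? _; rewrite lee_fin.
  - by move=> ? _ ? ? mn; rewrite lee_fin; exact/lefP/nd_nnsfun_approx.
rewrite [RHS](_ : _ = lim (\int[mu]_x ((f_ n x)%:E * g x) @[n --> \oo])%E); last first.
  rewrite -monotone_convergence//=.
  - apply: eq_integral => x _; apply/esym/cvg_lim => //=.
    apply: cvgeMr => //; exact: cvg_nnsfun_approx.
  - by move=> n; apply: emeasurable_funM => //; apply/measurable_EFinP; exact: measurable_funTS.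
  - by move=> n x _; rewrite mule_ge0// lee_fin.
  - by move=> x _ a b ab; apply: lee_wpmul2r => //; rewrite lee_fin; exact/lefP/nd_nnsfun_approx.
by apply: congr_lim; apply/funext => n /=; exact: integral_normal_nnsfun.
Qed.

(** Completing the square. *)
Lemma gdens_mul (V W : R) (s q : R * R) : 0 < V -> 0 < W ->
  gdens V s * gdens W (q.1 - s.1, q.2 - s.2) =
  gdens (V + W) q * gdens (V * W / (V + W)) (s.1 - V / (V + W) * q.1, s.2 - V / (V + W) * q.2).
Proof.
move=> V0 W0; have VW0 : 0 < V + W by rewrite addr_gt0.
have pi0 : pi != 0 :> R by rewrite gt_eqF// pi_gt0.
rewrite /gdens /= mulrACA [RHS]mulrACA -!expRD; congr (_ * expR _).
  by move: (pi : R) pi0 => c c0; field; rewrite c0 !gt_eqF.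
by field; rewrite !gt_eqF.
Qed.

(** After exchanging the integrals, the inner one is that of a Gaussian density,
    hence 1. *)
Lemma gdens_convolution (V W : R) (F : R * R -> \bar R) : 0 < V -> 0 < W ->
  measurable_fun setT F -> (forall p, 0 <= F p)%E ->
  (\int[l2]_s (\int[l2]_p (F (s.1 + p.1, s.2 + p.2)%R * (gdens W p)%:E) * (gdens V s)%:E)
   = \int[l2]_q (F q * (gdens (V + W) q)%:E))%E.
Proof.
move=> V0 W0 mF F0; have VW0 : 0 < V + W by rewrite addr_gt0.
have mg U : measurable_fun setT (fun p : R * R => (gdens U p)%:E).
  by apply/measurable_EFinP; exact: measurable_gdens.
pose H (z : (R * R) * (R * R)) : \bar R :=
  (F z.2 * (gdens V z.1 * gdens W ((z.2.1 - z.1.1)%R, (z.2.2 - z.1.2)%R))%:E)%E.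
have H0 z : (0 <= H z)%E by rewrite mule_ge0// lee_fin mulr_ge0// gdens_ge0// ltW.
have mH : measurable_fun setT H.
  apply: emeasurable_funM; first exact: measurableT_comp.
  apply/measurable_EFinP; apply: measurable_funM.
    by apply: measurableT_comp => //; exact: measurable_gdens.
  apply: (measurableT_comp (measurable_gdens W)); apply: measurable_fun_pair => /=.
    by apply: measurable_funB; do 2 apply: measurableT_comp => //.
  by apply: measurable_funB; do 2 apply: measurableT_comp => //.
transitivity (\int[l2]_s \int[l2]_q H (s, q))%E.
  apply: eq_integral => s _.
  have ms : measurable_fun setT (fun q : R * R => (F q * (gdens W ((q.1 - s.1)%R, (q.2 - s.2)%R))%:E)%E).
    apply: emeasurable_funM => //; apply/measurable_EFinP.
    apply: (measurableT_comp (measurable_gdens W)); apply: measurable_fun_pair => /=.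
      by apply: measurable_funB.
    by apply: measurable_funB.
  have s0 q : (0 <= F q * (gdens W ((q.1 - s.1)%R, (q.2 - s.2)%R))%:E)%E.
    by rewrite mule_ge0// lee_fin gdens_ge0// ltW.
  have := integral2_affine s.1 s.2 (oner_neq0 R) ms s0.
  rewrite expr1n invr1 mul1e => E.
  rewrite (_ : (\int[l2]_p _)%E = (\int[l2]_q (F q * (gdens W ((q.1 - s.1)%R, (q.2 - s.2)%R))%:E))%E); last first.
    rewrite -E; apply: eq_integral => p _; rewrite /= !mul1r !addrK.
    by rewrite (addrC p.1) (addrC p.2) -surjective_pairing.
  have gV0 : (0 <= (gdens V s)%:E)%E by rewrite lee_fin gdens_ge0// ltW.
  rewrite muleC -(ge0_integralZl l2 measurableT ms (fun q _ => s0 q) gV0).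
  by apply: eq_integral => q _; rewrite /H /= EFinM muleCA.
transitivity (\int[l2]_q \int[l2]_s H (s, q))%E.
  exact: (@fubini_tonelli _ _ _ _ R (@area R) (@area R) H mH H0).
apply: eq_integral => q _.
pose U := V * W / (V + W); have U0 : 0 < U by rewrite divr_gt0// mulr_gt0.
pose k : R * R := (- (V / (V + W) * q.1), - (V / (V + W) * q.2)).
have Fq0 : (0 <= F q * (gdens (V + W) q)%:E)%E by rewrite mule_ge0// lee_fin gdens_ge0// ltW.
transitivity (\int[l2]_s ((F q * (gdens (V + W) q)%:E) * (gdens U (1 * s.1 + k.1, 1 * s.2 + k.2))%:E))%E.
  apply: eq_integral => s _; rewrite /H /= gdens_mul// EFinM muleA !mul1r; congr (_ * _)%E.
have mgU : measurable_fun setT (fun s : R * R => (gdens U (1 * s.1 + k.1, 1 * s.2 + k.2))%:E).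
  apply/measurable_EFinP; apply: (measurableT_comp (measurable_gdens U)).
  by apply: measurable_fun_pair; apply: measurable_funD => //; apply: measurable_funM.
have g0 p : (0 <= (gdens U p)%:E)%E by rewrite lee_fin gdens_ge0// ltW.
rewrite ge0_integralZl//.
by rewrite (integral2_affine k.1 k.2 (oner_neq0 R) (mg U) g0) expr1n invr1 mul1e integral_gdens// mule1.
Qed.

(** A centred complex Gaussian variable multiplied by a complex number remains
    one, because its law is invariant under rotation. *)
Lemma gdens_scale (V c1 c2 : R) (F : R * R -> \bar R) : 0 < V -> (c1 != 0) || (c2 != 0) ->
  measurable_fun setT F -> (forall p, 0 <= F p)%E ->
  (\int[l2]_p (F (c1 * p.1 - c2 * p.2, c2 * p.1 + c1 * p.2)%R * (gdens V p)%:E)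
   = \int[l2]_p (F p * (gdens (V * (c1 ^+ 2 + c2 ^+ 2)) p)%:E))%E.
Proof.
move=> V0 c0 mF F0; set n := c1 ^+ 2 + c2 ^+ 2.
have n0 : 0 < n.
  by rewrite lt0r addr_ge0 ?sqr_ge0// andbT paddr_eq0 ?sqr_ge0// !sqrf_eq0 negb_and.
have mG : measurable_fun setT (fun p => F p * (n * gdens (V * n) p)%:E)%E.
  apply: emeasurable_funM => //; apply/measurable_EFinP; apply: measurable_funM => //.
  exact: measurable_gdens.
have G0 p : (0 <= F p * (n * gdens (V * n) p)%:E)%E.
  rewrite mule_ge0// lee_fin; apply: mulr_ge0; first exact: ltW.
  by apply: gdens_ge0; apply: mulr_ge0; exact: ltW.
transitivity (\int[l2]_p (F (c1 * p.1 - c2 * p.2, c2 * p.1 + c1 * p.2)%R *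
   (n * gdens (V * n) ((c1 * p.1 - c2 * p.2)%R, (c2 * p.1 + c1 * p.2)%R))%:E))%E.
  apply: eq_integral => p _; congr (_ * _%:E)%E; rewrite /gdens /= [RHS]mulrA; congr (_ * expR _).
    have pi0 : pi != 0 :> R by rewrite gt_eqF// pi_gt0.
    move: (pi : R) pi0 => c c'; clearbody n; field.
    by rewrite c' !gt_eqF.
  have -> : (c1 * p.1 - c2 * p.2) ^+ 2 + (c2 * p.1 + c1 * p.2) ^+ 2 = n * (p.1 ^+ 2 + p.2 ^+ 2).
    by rewrite /n; ring.
  move: (p.1 ^+ 2 + p.2 ^+ 2) => q; clearbody n; field.
  by rewrite !gt_eqF.
rewrite (integral2_cmul c0 mG G0) -/n.
rewrite -ge0_integralZl//; last by rewrite lee_fin invr_ge0 ltW.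
by apply: eq_integral => p _; rewrite muleCA -EFinM mulrA mulVf ?mul1r// gt_eqF.
Qed.

Lemma integral2_normal (s : R) (F : R * R -> \bar R) : s != 0 ->
  measurable_fun setT F -> (forall p, 0 <= F p)%E ->
  (\int[normal_prob 0 s]_x \int[normal_prob 0 s]_y F (x, y)
   = \int[l2]_p (F p * (gdens (2 * s ^+ 2) p)%:E))%E.
Proof.
move=> s0 mF F0; have V0 : 0 < 2 * s ^+ 2 by rewrite mulr_gt0// exprn_even_gt0.
have pE (x : R) : normal_pdf 0 (Num.sqrt (2 * s ^+ 2 / 2)) x = normal_pdf 0 s x.
  have -> : 2 * s ^+ 2 / 2 = s ^+ 2 by field.
  rewrite sqrtr_sqr !normal_pdfE ?normr_eq0//.
  by rewrite /normal_peak /normal_fun real_normK ?num_real.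
have mpdf : measurable_fun setT (fun x => (normal_pdf 0 s x)%:E).
  by apply/measurable_EFinP; exact: measurable_normal_pdf.
pose G (p : R * R) : \bar R := (F p * (normal_pdf 0 s p.1 * normal_pdf 0 s p.2)%:E)%E.
have mG : measurable_fun setT G.
  apply: emeasurable_funM => //; apply/measurable_EFinP; apply: measurable_funM;
    by apply: measurableT_comp => //; exact: measurable_normal_pdf.
have G0 p : (0 <= G p)%E by rewrite mule_ge0// lee_fin mulr_ge0// normal_pdf_ge0.
have mF1 x : measurable_fun setT (fun y => F (x, y)) by exact: measurableT_comp mF _.
transitivity (\int[normal_prob 0 s]_x \int[mu]_y (F (x, y) * (normal_pdf 0 s y)%:E))%E.
  by apply: eq_integral => x _; exact: (integral_normal_prob 0 s (mF1 x) (fun y => F0 (x, y))).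
rewrite integral_normal_prob; last 2 first.
- pose H (p : R * R) : \bar R := (F p * (normal_pdf 0 s p.2)%:E)%E.
  apply: (@measurable_fun_fubini_tonelli_F _ _ _ _ _ mu H).
    apply: emeasurable_funM => //; exact: (measurableT_comp mpdf measurable_snd).
  by move=> p; rewrite mule_ge0// lee_fin normal_pdf_ge0.
- by move=> x; apply: integral_ge0 => y _; rewrite mule_ge0// lee_fin normal_pdf_ge0.
transitivity (\int[mu]_x \int[mu]_y G (x, y))%E.
  apply: eq_integral => x _; rewrite muleC -ge0_integralZl//.
  - by apply: eq_integral => y _; rewrite /G /= EFinM muleCA.
  - by apply: emeasurable_funM; [exact: mF1|exact: mpdf].
  - by move=> y _; rewrite mule_ge0// lee_fin normal_pdf_ge0.
  - by rewrite lee_fin normal_pdf_ge0.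
rewrite -(@fubini_tonelli1 _ _ _ _ R mu mu G mG G0).
by apply: eq_integral => p _; rewrite /G gdens_normal// !pE.
Qed.

End GaussianLaw.

Section Independence.
Context d (Omega : measurableType d) (R : realType) (P : probability Omega R).

Definition mfun_of d' (U : measurableType d') (f : Omega -> U)
    (mf : measurable_fun setT f) : {mfun Omega >-> U} :=
  HB.pack f (isMeasurableFun.Build _ _ _ _ f mf).

Definition law d' (U : measurableType d') (f : Omega -> U)
    (mf : measurable_fun setT f) : probability U R := distribution P (mfun_of mf).

Lemma integral_law d' (U : measurableType d') (f : Omega -> U) (mf : measurable_fun setT f)
    (G : U -> \bar R) : measurable_fun setT G -> (forall u, 0 <= G u)%E ->
  (\int[law mf]_u G u = \int[P]_w G (f w))%E.
Proof. by move=> mG G0; rewrite (ge0_integral_pushforward mf) // preimage_setT. Qed.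

Variables (I : finType) (X : I -> {RV P >-> R}).
Hypothesis indep : mutually_independent X.

Definition event (J : {set I}) (A : I -> set R) : set Omega :=
  \bigcap_(i in [set` J]) X i @^-1` A i.

Lemma measurable_event (J : {set I}) (A : I -> set R) : (forall i, measurable (A i)) -> measurable (event J A).
Proof.
move=> mA; apply: fin_bigcap_measurable => [|i _]; first exact: finite_finset.
by rewrite -[_ @^-1` _]setTI; exact: measurable_funP.
Qed.

(** [W] is independent of the variables whose index is not in [L]; testing on
    the events of finite families is enough for the induction below. *)
Definition independent_off (L : {set I}) d' (U : measurableType d') (W : Omega -> U) :=
  forall (J : {set I}) (A : I -> set R), (forall j, j \in J -> j \notin L) -> (forall i, measurable (A i)) ->
  forall B, measurable B -> P (event J A `&` W @^-1` B) = (P (event J A) * P (W @^-1` B))%E.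

Lemma event_setU1 (J : {set I}) A i A' : i \notin J ->
  event J A `&` X i @^-1` A' = event (i |: J) (fun j => if j == i then A' else A j).
Proof.
move=> iJ; apply/seteqP; split=> w.
  move=> [wJ wi] j /=; rewrite !inE => /orP[/eqP ->|jJ]; first by rewrite eqxx.
  by case: eqP => [->//|_]; exact: wJ.
move=> H; split=> [j /= jJ|]; last by have := H i; rewrite /= setU11 eqxx; apply.
have := H j; rewrite /= !inE jJ orbT; case: eqP => [ji|_ /(_ isT)//].
by move: iJ; rewrite -ji jJ.
Qed.

Lemma prob_event_setU1 (J : {set I}) (A : I -> set R) i A' : i \notin J -> (forall i, measurable (A i)) -> measurable A' ->
  P (event J A `&` X i @^-1` A') = (P (event J A) * P (X i @^-1` A'))%E.
Proof.
move=> iJ mA mA'; rewrite event_setU1// /event !indep//; last first.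
  by move=> j; case: eqP.
rewrite big_setU1//= eqxx muleC; congr (_ * _)%E; apply: eq_bigr => j jJ.
by case: eqP => // ji; move: iJ; rewrite -ji jJ.
Qed.

Section Step.
Variables (L : {set I}) (d' : measure_display) (U : measurableType d') (W : Omega -> U).
Variables (mW : measurable_fun setT W) (i : I).
Hypotheses (indW : independent_off L W) (iL : i \notin L).

Let V w := (W w, X i w).

Lemma measurable_pair_step : measurable_fun setT V.
Proof. by apply: measurable_fun_pair. Qed.

Let N : probability R R := distribution P (X i).

(** Both sides are finite measures of [D], and they agree on the rectangles, where
    the condition on [X i] is one more factor in the family [A]. *)
Lemma prob_event_pair (J : {set I}) (A : I -> set R) : (forall j, j \in J -> j \notin i |: L) -> (forall i, measurable (A i)) ->
  forall D, measurable D ->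
  P (event J A `&` V @^-1` D) = (P (event J A) * (law mW \x N) D)%E.
Proof.
move=> JiL mA D mD; have mE := measurable_event J mA.
have iJ : i \notin J by apply/negP => /JiL; rewrite setU11.
have JL j : j \in J -> j \notin L by move=> /JiL; rewrite in_setU1 negb_or => /andP[].
have mV := measurable_pair_step.
have pE : P (event J A) \is a fin_num by exact: fin_num_measure.
have e0 : 0 <= fine (P (event J A)) by rewrite fine_ge0.
pose c := NngNum e0.
pose m1 : {measure set (U * R) -> \bar R} := pushforward (mrestr P mE) V.
pose m2 : {measure set (U * R) -> \bar R} := mscale c (law mW \x N)%E.
pose C : set (set (U * R)) :=
  [set C | exists A, measurable A /\ exists B, measurable B /\ C = A `*` B].
have m2E B : m2 B = (P (event J A) * (law mW \x N) B)%E.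
  by rewrite /m2 /= /mscale /= fineK.
have m1E B : m1 mV B = P (event J A `&` V @^-1` B) by rewrite /m1 /= /pushforward /mrestr setIC.
rewrite -m1E -m2E; apply: (measure_unique C (fun=> setT) _ _ _ _ (m1 mV) m2) => //.
- rewrite measurable_prod_measurableType //; congr (<<s _ >>).
  rewrite predeqE; split => [[B mB [B' mB' <-]]|[B [mB [B' [mB' ->]]]]].
    by exists B; split => //; exists B'.
  by exists B => //; exists B'.
- move=> /= _ _ [X1 [mX1 [X2 [mX2 ->]]]] [Y1 [mY1 [Y2 [mY2 ->]]]].
  rewrite -setXI; exists (X1 `&` Y1); split; first exact: measurableI.
  by exists (X2 `&` Y2); split => //; exact: measurableI.
- by move=> n; exists setT; split => //; exists setT; split => //; rewrite setXTT.
- by rewrite bigcup_const.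
- move=> _ [B [mB [A' [mA' ->]]]]; rewrite m1E m2E product_measure1E//.
  rewrite (_ : V @^-1` (B `*` A') = X i @^-1` A' `&` W @^-1` B); last first.
    by apply/seteqP; split=> w /= [].
  rewrite setIA event_setU1// indW//; last 2 first.
  + by move=> j; rewrite in_setU1 => /orP[/eqP ->|/JL].
  + by move=> j; case: eqP.
  rewrite -event_setU1// prob_event_setU1// -muleA [in RHS]muleC.
  by rewrite [in RHS](muleC (law mW B)) [RHS]muleC.
- by move=> n; rewrite m1E; apply: le_lt_trans (probability_le1 _ _) _; rewrite ?ltry//; apply: measurableI => //; rewrite preimage_setT.
Qed.

Lemma prob_pair D : measurable D -> P (V @^-1` D) = (law mW \x N)%E D.
Proof.
move=> mD; have := @prob_event_pair finset.set0 (fun=> setT) _ (fun=> measurableT) D mD.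
rewrite /event (_ : [set` finset.set0] = set0); last by apply/seteqP; split=> // j /=; rewrite inE.
by rewrite bigcap_set0 setTI probability_setT mul1e; apply => j; rewrite inE.
Qed.

Lemma independent_off_pair : independent_off (i |: L) V.
Proof. by move=> J A JL mA D mD; rewrite prob_event_pair// prob_pair. Qed.

Lemma integral_pair (G : U * R -> \bar R) : measurable_fun setT G -> (forall u, 0 <= G u)%E ->
  (\int[P]_w G (W w, X i w) = \int[P]_w \int[N]_y G (W w, y))%E.
Proof.
move=> mG G0; have mV := measurable_pair_step.
rewrite -(integral_law mV mG G0).
transitivity (\int[law mW \x N]_u G u)%E.
  by apply: eq_measure_integral => D mD _; exact: prob_pair.
rewrite (fubini_tonelli1 G mG G0).
rewrite (integral_law mW) //; first exact: measurable_fun_fubini_tonelli_F.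
by move=> u; apply: integral_ge0.
Qed.

End Step.

Lemma independent_off_comp L d1 d2 (U1 : measurableType d1) (U2 : measurableType d2)
    (W : Omega -> U1) (g : U1 -> U2) : measurable_fun setT g ->
  independent_off L W -> independent_off L (fun w => g (W w)).
Proof.
move=> mg iW J A JL mA B mB; have := iW J A JL mA (g @^-1` B).
by apply; rewrite -[_ @^-1` _]setTI; exact: mg.
Qed.

End Independence.

Lemma integral_is_normal d (Omega : measurableType d) (R : realType) (P : probability Omega R)
    (X : {RV P >-> R}) (m s : R) : is_normal X m s ->
  forall f : R -> \bar R, measurable_fun setT f -> (forall y, 0 <= f y)%E ->
  (\int[distribution P X]_y f y = \int[normal_prob m s]_y f y)%E.
Proof.
move=> nX f mf f0; pose i : measurableTypeR R -> R := id.
have mi : measurable_fun setT i by exact: measurable_id.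
pose nu : {measure set R -> \bar R} := pushforward (normal_prob m s) i.
transitivity (\int[nu mi]_y f y)%E.
  by apply: eq_measure_integral => A mA _; exact: nX.
by rewrite (ge0_integral_pushforward mi)// preimage_setT.
Qed.

Section GaussianSum.
Context d (Omega : measurableType d) (R : realType) (P : probability Omega R).
Variables (n : nat) (a b : 'I_n -> {RV P >-> R}) (s : R) (c : 'I_n -> R[i]).
Hypotheses (s0 : s != 0) (indep : mutually_independent (joint_family a b)).
Hypotheses (na : forall j, is_normal (a j) 0 s) (nb : forall j, is_normal (b j) 0 s).
Local Notation mu := (@lebesgue_measure R).
Local Notation l2 := (mu \x mu)%E.

Local Notation X := (joint_family a b).
Local Notation c1 j := (complex.Re (c j)).
Local Notation c2' j := (complex.Im (c j)).

Definition partial_sum (l : seq 'I_n) (w : Omega) : R * R :=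
  (\sum_(j <- l) (c1 j * a j w - c2' j * b j w), \sum_(j <- l) (c2' j * a j w + c1 j * b j w)).

Definition variance (l : seq 'I_n) : R := \sum_(j <- l) 2 * s ^+ 2 * (c1 j ^+ 2 + c2' j ^+ 2).

Definition indices (l : seq 'I_n) : {set 'I_n + 'I_n} :=
  [set k | match k with inl j => j \in l | inr j => j \in l end]%SET.

Lemma variance_ge0 l : 0 <= variance l.
Proof.
apply: sumr_ge0 => j _; apply: mulr_ge0; last by apply: addr_ge0; exact: sqr_ge0.
by rewrite mulr_ge0// sqr_ge0.
Qed.

Lemma measurable_partial_sum l : measurable_fun setT (partial_sum l).
Proof.
apply: measurable_fun_pair; apply: measurable_sum => j.
  by apply: measurable_funB; apply: measurable_funM => //; exact: measurable_funPT.
by apply: measurable_funD; apply: measurable_funM => //; exact: measurable_funPT.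
Qed.

(** The law of a linear combination of the coefficients, adding one complex
    coefficient at a time: independence reduces each step to a convolution of
    Gaussian densities. *)
Lemma partial_sum_law l : uniq l -> independent_off (joint_family a b) (indices l) (partial_sum l) /\
  forall F, measurable_fun setT F -> (forall p, 0 <= F p)%E ->
  (\int[P]_w F (partial_sum l w) =
   if variance l == 0%R then F (0%R, 0%R) else \int[l2]_p (F p * (gdens (variance l) p)%:E))%E.
Proof.
elim: l => [_|j l IH /= /andP[jl ul]].
  have E : partial_sum [::] = cst (0, 0) by apply/funext => w; rewrite /partial_sum !big_nil.
  rewrite E; split.
    move=> J A JL mA B mB; rewrite preimage_cst; case: ifP => _.
      by rewrite setIT probability_setT mule1.
    by rewrite setI0 measure0 mule0.
  move=> F mF F0; rewrite /variance big_nil eqxx.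
  transitivity (F (0%R, 0%R) * P setT)%E; last by rewrite probability_setT mule1.
  exact: (integral_cst P measurableT (F (0, 0))).
have [{}IH1 IH2] := IH ul.
have mS := measurable_partial_sum l.
have il : inl j \notin indices l by rewrite inE.
have ir : inr j \notin inl j |: indices l by rewrite !inE.
have ind1 := independent_off_pair indep mS IH1 il.
have mW1 := @measurable_pair_step _ Omega R P _ X _ _ _ mS (inl j).
have ind2 := independent_off_pair indep mW1 ind1 ir.
have mW2 := @measurable_pair_step _ Omega R P _ X _ _ _ mW1 (inr j).
pose g (u : ((R * R) * R) * R) : R * R :=
  ((c1 j * u.1.2 - c2' j * u.2) + u.1.1.1, (c2' j * u.1.2 + c1 j * u.2) + u.1.1.2).
have mg : measurable_fun setT g.
  have m12 : measurable_fun setT (fun u : ((R * R) * R) * R => u.1.2).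
    exact: measurableT_comp.
  have m111 : measurable_fun setT (fun u : ((R * R) * R) * R => u.1.1.1).
    by do 2 apply: measurableT_comp => //.
  have m112 : measurable_fun setT (fun u : ((R * R) * R) * R => u.1.1.2).
    by do 2 apply: measurableT_comp => //.
  apply: measurable_fun_pair; apply: measurable_funD => //.
    by apply: measurable_funB; apply: measurable_funM.
  by apply: measurable_funD; apply: measurable_funM.
have SE : partial_sum (j :: l) = fun w => g ((partial_sum l w, a j w), b j w).
  by apply/funext => w; rewrite /partial_sum /g /= !big_cons.
have idxE : indices (j :: l) = inr j |: (inl j |: indices l).
  by apply/setP => -[k|k]; rewrite !inE.
split.
  rewrite SE idxE.
  exact: (independent_off_comp mg ind2).
move=> F mF F0; rewrite SE.
pose G u := F (g u).
have mG : measurable_fun setT G by exact: measurableT_comp.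
have G0 u : (0 <= G u)%E by exact: F0.
pose Na : probability R R := distribution P (a j).
pose Nb : probability R R := distribution P (b j).
pose G1 (u : (R * R) * R) : \bar R := (\int[Nb]_y G (u, y))%E.
have mG1 : measurable_fun setT G1 by exact: (measurable_fun_fubini_tonelli_F (m2 := Nb) G mG G0).
have G10 u : (0 <= G1 u)%E by apply: integral_ge0.
pose G2 (p : R * R) : \bar R := (\int[Na]_x G1 (p, x))%E.
have mG2 : measurable_fun setT G2 by exact: (measurable_fun_fubini_tonelli_F (m2 := Na) G1 mG1 G10).
have G20 u : (0 <= G2 u)%E by apply: integral_ge0.
have E1 : (\int[P]_w G ((partial_sum l w, a j w), b j w) = \int[P]_w G1 (partial_sum l w, a j w))%E.
  exact: (integral_pair indep mW1 ind1 ir mG G0).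
have E2 : (\int[P]_w G1 (partial_sum l w, a j w) = \int[P]_w G2 (partial_sum l w))%E.
  exact: (integral_pair indep mS IH1 il mG1 G10).
have [cj|cj] := eqVneq (c1 j ^+ 2 + c2' j ^+ 2) 0.
  have [c10 c20] : c1 j = 0 /\ c2' j = 0.
    by move/eqP: cj; rewrite paddr_eq0 ?sqr_ge0// !sqrf_eq0 => /andP[/eqP-> /eqP->].
  rewrite (_ : variance (j :: l) = variance l); last by rewrite /variance big_cons cj mulr0 add0r.
  rewrite -(IH2 F mF F0); apply: eq_integral => w _.
  by rewrite /g /= c10 c20 !mul0r subr0 !add0r.
have cn0 : (c1 j != 0) || (c2' j != 0).
  by apply: contra_neqT cj; rewrite negb_or !negbK => /andP[/eqP-> /eqP->]; rewrite expr0n addr0.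
have V0 : 0 < 2 * s ^+ 2 by rewrite mulr_gt0// exprn_even_gt0.
have C0 : 0 < c1 j ^+ 2 + c2' j ^+ 2 by rewrite lt0r cj addr_ge0// sqr_ge0.
pose v := 2 * s ^+ 2 * (c1 j ^+ 2 + c2' j ^+ 2).
have v0 : 0 < v by rewrite mulr_gt0.
have G2E (p : R * R) : G2 p = (\int[l2]_q (F ((p.1 + q.1)%R, (p.2 + q.2)%R) * (gdens v q)%:E))%E.
  pose Fp q := F (p.1 + q.1, p.2 + q.2).
  have mFp : measurable_fun setT Fp.
    by apply: (measurableT_comp mF); apply: measurable_fun_pair; apply: measurable_funD.
  rewrite -(gdens_scale V0 cn0 mFp (fun q => F0 _)) -(integral2_normal s0) //.
  - have mGp : measurable_fun setT (fun x => G1 (p, x)) by exact: measurableT_comp mG1 _.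
    rewrite /G2 (integral_is_normal (na j) mGp (fun x => G10 _)); apply: eq_integral => x _.
    have mGx : measurable_fun setT (fun y => G ((p, x), y)) by exact: measurableT_comp mG _.
    rewrite /G1 (integral_is_normal (nb j) mGx (fun y => G0 _)); apply: eq_integral => y _.
    by rewrite /G /Fp /g /=; congr (F (_, _)); rewrite addrC.
  - apply: (measurableT_comp mFp); apply: measurable_fun_pair.
      by apply: measurable_funB; apply: measurable_funM.
    by apply: measurable_funD; apply: measurable_funM.
  - by move=> q; exact: F0.
transitivity (\int[P]_w G2 (partial_sum l w))%E; first by rewrite -E2 -E1.
rewrite (IH2 G2 mG2 G20) (_ : variance (j :: l) = v + variance l); last by rewrite /variance big_cons.
have [vl|vl] := eqVneq (variance l) 0.
  rewrite vl addr0 (gt_eqF v0) G2E; apply: eq_integral => q _.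
  by rewrite !add0r -surjective_pairing.
have vl0 : 0 < variance l by rewrite lt0r vl variance_ge0.
rewrite gt_eqF ?addr_gt0// addrC -(gdens_convolution vl0 v0 mF F0).
by apply: eq_integral => p _; rewrite G2E.
Qed.

End GaussianSum.

(** * The Laplacian of the mean logarithmic potential *)

Section MeanLogPotential.
Variable R : realType.
Local Notation C := R[i].
Local Notation mu := (@lebesgue_measure R).
Local Notation l2 := (mu \x mu)%E.
Implicit Types (p k : R * R).

Lemma rd_sum (I : Type) (r : seq I) (F : I -> R -> R) (G : I -> R) (x : R) :
  (forall i, is_derive x 1 (F i) (G i)) ->
  is_derive x 1 (fun t => \sum_(i <- r) F i t) (\sum_(i <- r) G i).
Proof.
move=> dF; elim: r => [|i r IH].
  rewrite big_nil (_ : (fun t => _) = fun=> 0); first exact: rd_cst.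
  by apply/funext => t; rewrite big_nil.
rewrite big_cons (_ : (fun t => _) = fun t => F i t + \sum_(j <- r) F j t); first exact: rdD.
by apply/funext => t; rewrite big_cons.
Qed.

Lemma continuous_sumr (I : Type) (r : seq I) (F : I -> R * R -> R) :
  (forall i, continuous (F i)) -> continuous (fun p => \sum_(i <- r) F i p).
Proof.
move=> cF; elim: r => [|i r IH].
  rewrite (_ : (fun p => _) = fun=> 0); first by move=> p; exact: cvg_cst.
  by apply/funext => p; rewrite big_nil.
rewrite (_ : (fun p => _) = fun p => F i p + \sum_(j <- r) F j p).
  by move=> p; apply: cvgD; [exact: cF|exact: IH].
by apply/funext => p; rewrite big_cons.
Qed.

Section RadialDensity.
Variable kap : R.

Let q (v : R) : R := expR (- kap / v) / (2 * v).
Let q1 (v : R) : R := expR (- kap / v) * (kap / v ^+ 2) / (2 * v) - expR (- kap / v) * (2 * v ^+ 2)^-1.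

Let dq (v : R) : 0 < v -> is_derive v 1 q (q1 v).
Proof.
move=> v0; have vn0 : v != 0 by rewrite gt_eqF.
have v2n0 : 2 * v != 0 by rewrite mulf_neq0.
apply: is_derive_eq (rdM (rd_exp (rdZ (- kap) (rdV (F := fun v => v) vn0 (rd_id v))))
  (rdV (F := fun v => 2 * v) v2n0 (rdZ 2 (rd_id v)))) _.
rewrite /q1; move: (expR _) => e; field.
by rewrite ?vn0.
Qed.

Let cq1 (v : R) : 0 < v -> {for v, continuous q1}.
Proof.
move=> v0; have vn0 : v != 0 by rewrite gt_eqF.
have cV (j : R -> R) : {for v, continuous j} -> j v != 0 -> {for v, continuous (fun v => (j v)^-1)}.
  by move=> cj jv; apply: cvgV.
have cid : {for v, continuous (fun v : R => v)} by exact: cvg_id.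
have c2 : {for v, continuous (fun v : R => v ^+ 2)} by apply: cvgM; exact: cid.
have ce : {for v, continuous (fun v : R => expR (- kap / v))}.
  apply: (@cvg_comp _ _ _ (fun v => - kap / v) (@expR R)); last exact: continuous_expR.
  by apply: cvgM; [exact: cvg_cst|exact: cV].
apply: cvgB; apply: cvgM.
- apply: cvgM => //; apply: cvgM; first exact: cvg_cst.
  by apply: (cV (fun v => v ^+ 2)) => //; rewrite expf_neq0.
- by apply: (cV (fun v => 2 * v)); [apply: cvgM; [exact: cvg_cst|exact: cid]|rewrite mulf_neq0].
- exact: ce.
- apply: (cV (fun v => 2 * v ^+ 2)); last by rewrite mulf_neq0// expf_neq0.
  by apply: cvgM; [exact: cvg_cst|exact: c2].
Qed.

(* [f1], [f2], [f3] are the successive derivatives of [f]. *)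
Variables (n : nat) (f f1 f2 f3 : 'I_n.+1 -> C -> C) (sig : R).
Hypotheses (d0 : forall j z, cdiff (f j) z (f1 j z))
  (d1 : forall j z, cdiff (f1 j) z (f2 j z)) (d2 : forall j z, cdiff (f2 j) z (f3 j z)).
Hypothesis sig0 : 0 < sig ^+ 2.
Local Notation "'RE' z" := (complex.Re z) (at level 8).
Local Notation "'IM' z" := (complex.Im z) (at level 8).

Let s2 : R := 2 * sig ^+ 2.
Let s20 : 0 < s2. Proof. by rewrite mulr_gt0. Qed.
Let f1E j z : cderiv (f j) z = f1 j z. Proof. exact: cderiv_cdiff. Qed.

Let V p : R := s2 * B0 f (plane p).
Let be1 p : R := \sum_j (RE (f j (plane p)) * RE (f1 j (plane p)) + IM (f j (plane p)) * IM (f1 j (plane p))).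
Let be2 p : R := \sum_j (IM (f j (plane p)) * RE (f1 j (plane p)) - RE (f j (plane p)) * IM (f1 j (plane p))).
Let ga1 p : R := \sum_j
  ((RE (f1 j (plane p)) * RE (f1 j (plane p)) + RE (f j (plane p)) * RE (f2 j (plane p))) +
   (IM (f1 j (plane p)) * IM (f1 j (plane p)) + IM (f j (plane p)) * IM (f2 j (plane p)))).
Let ga2 p : R := \sum_j
  ((RE (f1 j (plane p)) * RE (f1 j (plane p)) - IM (f j (plane p)) * IM (f2 j (plane p))) +
   (IM (f1 j (plane p)) * IM (f1 j (plane p)) - RE (f j (plane p)) * RE (f2 j (plane p)))).

Lemma B0_ReIm z : B0 f z = \sum_j (RE (f j z) ^+ 2 + IM (f j z) ^+ 2).
Proof. by apply: eq_bigr => j _; rewrite sqr_cmod. Qed.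

Let be12 p : be1 p ^+ 2 + be2 p ^+ 2 = cmod (B1 f (plane p)) ^+ 2.
Proof.
rewrite sqr_cmod /B1; congr (_ + _).
  rewrite raddf_sum; congr (_ ^+ 2); apply: eq_bigr => j _.
  by rewrite f1E; case: (f j _) => a b; case: (f1 j _) => c e /=; ring.
rewrite raddf_sum -sqrrN -sumrN; congr (_ ^+ 2); apply: eq_bigr => j _.
by rewrite f1E; case: (f j _) => a b; case: (f1 j _) => c e /=; ring.
Qed.

Let ga12 p : ga1 p + ga2 p = 2 * B2 f (plane p).
Proof.
rewrite /ga1 /ga2 /B2 mulr_sumr -big_split /=; apply: eq_bigr => j _.
by rewrite f1E sqr_cmod; ring.
Qed.

Let vl (z w : C) : RE ('i * w) = - IM w /\ IM ('i * w) = RE w.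
Proof. by case: w => a b /=; split; ring. Qed.

Let dV1 (x y : R) : is_derive x 1 (fun t => V (t, y)) (s2 * (2 * be1 (x, y))).
Proof.
rewrite (_ : (fun t => V (t, y)) = fun t => s2 * \sum_j (RE (f j (t +i* y)) ^+ 2 + IM (f j (t +i* y)) ^+ 2)).
  apply: rdZ; rewrite /be1 mulr_sumr; apply: rd_sum => j.
  have [e1 e2] := cdiff_hline (d0 j (x +i* y)).
  by apply: is_derive_eq (rdD (rdX2 e1) (rdX2 e2)) _; rewrite /plane /=; ring.
by apply/funext => t; rewrite /V B0_ReIm.
Qed.

Let dV2 (x y : R) : is_derive y 1 (fun t => V (x, t)) (s2 * (2 * be2 (x, y))).
Proof.
rewrite (_ : (fun t => V (x, t)) = fun t => s2 * \sum_j (RE (f j (x +i* t)) ^+ 2 + IM (f j (x +i* t)) ^+ 2)).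
  apply: rdZ; rewrite /be2 mulr_sumr; apply: rd_sum => j.
  have [e1 e2] := cdiff_vline (d0 j (x +i* y)).
  have [l1 l2] := vl 0 (f1 j (x +i* y)); rewrite l1 in e1; rewrite l2 in e2.
  by apply: is_derive_eq (rdD (rdX2 e1) (rdX2 e2)) _; rewrite /plane /=; ring.
by apply/funext => t; rewrite /V B0_ReIm.
Qed.

Let dbe1 (x y : R) : is_derive x 1 (fun t => be1 (t, y)) (ga1 (x, y)).
Proof.
apply: rd_sum => j; have [a1 a2] := cdiff_hline (d0 j (x +i* y)).
by have [b1 b2] := cdiff_hline (d1 j (x +i* y)); exact: (rdD (rdM a1 b1) (rdM a2 b2)).
Qed.

Let dbe2 (x y : R) : is_derive y 1 (fun t => be2 (x, t)) (ga2 (x, y)).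
Proof.
apply: rd_sum => j; have [a1 a2] := cdiff_vline (d0 j (x +i* y)).
have [b1 b2] := cdiff_vline (d1 j (x +i* y)).
have [l1 l2] := vl 0 (f1 j (x +i* y)); rewrite l1 in a1; rewrite l2 in a2.
have [k1 k2] := vl 0 (f2 j (x +i* y)); rewrite k1 in b1; rewrite k2 in b2.
by apply: is_derive_eq (rdB (rdM a2 b1) (rdM a1 b2)) _; rewrite /plane /=; ring.
Qed.

Let cRe (g : C -> C) (g' : C -> C) : (forall z, cdiff g z (g' z)) -> continuous (fun p => RE (g (plane p))).
Proof. by move=> dg p; have [] := cdiff_plane (dg (plane p)). Qed.
Let cIm (g : C -> C) (g' : C -> C) : (forall z, cdiff g z (g' z)) -> continuous (fun p => IM (g (plane p))).
Proof. by move=> dg p; have [] := cdiff_plane (dg (plane p)). Qed.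

Lemma continuous_B0_aux : continuous (fun p : R * R => B0 f (plane p)).
Proof.
rewrite (_ : (fun p => _) = fun p => \sum_j (RE (f j (plane p)) * RE (f j (plane p)) +
  IM (f j (plane p)) * IM (f j (plane p)))).
  by apply: continuous_sumr => j; apply: continuous_add2; apply: continuous_mul2; solve [exact: cRe (d0 j)|exact: cIm (d0 j)].
by apply/funext => p; rewrite B0_ReIm.
Qed.

Let cV : continuous V.
Proof. by move=> p; apply: cvgM; [exact: cvg_cst|exact: continuous_B0_aux]. Qed.

Let cbe1 : continuous be1.
Proof.
apply: continuous_sumr => j; apply: continuous_add2; apply: continuous_mul2;
  solve [exact: cRe (d0 j)|exact: cIm (d0 j)|exact: cRe (d1 j)|exact: cIm (d1 j)].
Qed.
Let cbe2 : continuous be2.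
Proof.
apply: continuous_sumr => j; apply: continuous_sub2; apply: continuous_mul2;
  solve [exact: cRe (d0 j)|exact: cIm (d0 j)|exact: cRe (d1 j)|exact: cIm (d1 j)].
Qed.
Let cga1 : continuous ga1.
Proof.
apply: continuous_sumr => j; apply: continuous_add2; apply: continuous_add2; apply: continuous_mul2;
  solve [exact: cRe (d0 j)|exact: cIm (d0 j)|exact: cRe (d1 j)|exact: cIm (d1 j)|exact: cRe (d2 j)|exact: cIm (d2 j)].
Qed.
Let cga2 : continuous ga2.
Proof.
apply: continuous_sumr => j; apply: continuous_add2; apply: continuous_sub2; apply: continuous_mul2;
  solve [exact: cRe (d0 j)|exact: cIm (d0 j)|exact: cRe (d1 j)|exact: cIm (d1 j)|exact: cRe (d2 j)|exact: cIm (d2 j)].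
Qed.

Variables (K1 K2 : R).
Hypothesis kapE : kap = K1 ^+ 2 + K2 ^+ 2.

(** The mean logarithmic potential, a function of the variance only, has
    Laplacian 2 pi times the expected density of zeros. *)
Lemma green_mean_log_aux A M (phi : c2fun R) : closed A -> A `<=` box M -> c2_supp phi A ->
  (forall p, A p -> 0 < B0 f (plane p)) ->
  l2.-integrable setT (EFin \o (fun p => c2 phi p * (2 * pi * expected_density f sig K1 K2 (plane p)))) /\
  (\int[l2]_p (lap phi p * gpot (K1, K2) (V p))%:E
   = \int[l2]_p (c2 phi p * (2 * pi * expected_density f sig K1 K2 (plane p)))%:E)%E.
Proof.
move=> cA AM sA B0A; have VA p : A p -> 0 < V p by move=> /B0A h; rewrite mulr_gt0.
pose w1 p := q (V p) * (s2 * (2 * be1 p)).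
pose w2 p := q (V p) * (s2 * (2 * be2 p)).
pose w11 p := (q1 (V p) * (s2 * (2 * be1 p))) * (s2 * (2 * be1 p)) + q (V p) * (s2 * (2 * ga1 p)).
pose w22 p := (q1 (V p) * (s2 * (2 * be2 p))) * (s2 * (2 * be2 p)) + q (V p) * (s2 * (2 * ga2 p)).
have dg (v : R) : 0 < v -> is_derive v 1 (gpot (K1, K2)) (q v).
  by move=> v0; rewrite /q kapE; exact: (gpot_is_derive (K1, K2) v0).
have comp (j : R -> R) p : A p -> {for V p, continuous j} -> {for p, continuous (fun p => j (V p))}.
  by move=> Ap cj; apply: (@cvg_comp _ _ _ V j); [exact: cV|exact: cj].
have cq v : 0 < v -> {for v, continuous q} by move=> v0; apply: differentiable_continuous; apply/derivable1_diffP; have [] := dq v0.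
have cg v : 0 < v -> {for v, continuous (gpot (K1, K2))}.
  by move=> v0; apply: differentiable_continuous; apply/derivable1_diffP; have [] := dg _ v0.
have lin (g : R * R -> R) p : continuous g -> {for p, continuous (fun p => s2 * (2 * g p))}.
  by move=> cg'; do 2 (apply: cvgM; first exact: cvg_cst); exact: cg'.
have wE p : A p -> w11 p + w22 p = 2 * pi * expected_density f sig K1 K2 (plane p).
  move=> Ap; have b0 := B0A _ Ap.
  have -> : w11 p + w22 p = q1 (V p) * (s2 ^+ 2 * 4) * (be1 p ^+ 2 + be2 p ^+ 2) +
      q (V p) * s2 * 2 * (ga1 p + ga2 p).
    by rewrite /w11 /w22; move: (q1 _) (q _) (be1 p) (be2 p) (ga1 p) (ga2 p) => *; ring.
  rewrite be12 ga12 /q1 /q /V /expected_density -kapE.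
  rewrite (_ : - kap / (s2 * B0 f (plane p)) = - (kap / (2 * sig ^+ 2 * B0 f (plane p)))); last by rewrite mulNr.
  have pi0 : pi != 0 :> R by rewrite gt_eqF// pi_gt0.
  have s2n0 : sig ^+ 2 != 0 by rewrite gt_eqF.
  have bn0 : B0 f (plane p) != 0 by rewrite gt_eqF.
  rewrite /s2; move: (expR _) => e; move: (cmod _) => b1; move: (B2 _ _) => b2.
  move: (B0 f _) bn0 => b0' bn0; move: (sig ^+ 2) s2n0 => s s0'; move: (pi : R) pi0 => c c0.
  by field; rewrite ?c0 ?s0' ?bn0.
have c11 p : A p -> {for p, continuous w11}.
  move=> Ap; have v0 := VA _ Ap; apply: cvgD; apply: cvgM.
  - by apply: cvgM; [exact: (comp q1 p Ap (cq1 v0))|exact: lin].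
  - exact: lin.
  - exact: (comp q p Ap (cq _ v0)).
  - exact: lin.
have c22 p : A p -> {for p, continuous w22}.
  move=> Ap; have v0 := VA _ Ap; apply: cvgD; apply: cvgM.
  - by apply: cvgM; [exact: (comp q1 p Ap (cq1 v0))|exact: lin].
  - exact: lin.
  - exact: (comp q p Ap (cq _ v0)).
  - exact: lin.
have phi0 p : ~ A p -> c2 phi p = 0 by case/sA.
have hE p : c2 phi p * (2 * pi * expected_density f sig K1 K2 (plane p)) = c2 phi p * (w11 p + w22 p).
  by have [Ap|/phi0 ->] := pselect (A p); [rewrite wE|rewrite !mul0r].
have -> : (fun p => c2 phi p * (2 * pi * expected_density f sig K1 K2 (plane p))) =
    fun p => c2 phi p * (w11 p + w22 p) by apply/funext.
split.
  apply: (@integrable_continuous_box R _ M) => [|p nb]; last by rewrite phi0 ?mul0r// => /AM.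
  apply: (continuous_suppM cA (@c2_c R phi) phi0) => p Ap.
  by apply: cvgD; [exact: c11|exact: c22].
under [RHS]eq_integral do rewrite hE.
apply: (@green_supp R A M phi _ w1 w11 w2 w22 cA AM sA).
- by move=> x y Axy; exact: (rd_comp (F := gpot (K1, K2)) (G := fun t => V (t, y)) (dg _ (VA _ Axy)) (dV1 x y)).
- move=> x y Axy.
  exact: (rdM (rd_comp (F := q) (G := fun t => V (t, y)) (dq (VA _ Axy)) (dV1 x y)) (rdZ s2 (rdZ 2 (dbe1 x y)))).
- by move=> x y Axy; exact: (rd_comp (F := gpot (K1, K2)) (G := fun t => V (x, t)) (dg _ (VA _ Axy)) (dV2 x y)).
- move=> x y Axy.
  exact: (rdM (rd_comp (F := q) (G := fun t => V (x, t)) (dq (VA _ Axy)) (dV2 x y)) (rdZ s2 (rdZ 2 (dbe2 x y)))).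
- by move=> p Ap; exact: (comp _ p Ap (cg _ (VA _ Ap))).
- by move=> p Ap; apply: cvgM; [exact: (comp q p Ap (cq _ (VA _ Ap)))|exact: lin].
- exact: c11.
- by move=> p Ap; apply: cvgM; [exact: (comp q p Ap (cq _ (VA _ Ap)))|exact: lin].
- exact: c22.
Qed.

End RadialDensity.

Lemma continuous_B0 n (f : 'I_n.+1 -> C -> C) : (forall j, entire (f j)) ->
  continuous (fun p : R * R => B0 f (plane p)).
Proof. by move=> ef; apply: continuous_B0_aux => j; apply: (proj1 (entireP _)); exact: ef. Qed.

Lemma green_mean_log n (f : 'I_n.+1 -> C -> C) (sig K1 K2 : R) A M (phi : c2fun R) :
  (forall j, entire (f j)) -> 0 < sig ^+ 2 ->
  closed A -> A `<=` box M -> c2_supp phi A -> (forall p, A p -> 0 < B0 f (plane p)) ->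
  l2.-integrable setT (EFin \o (fun p => c2 phi p * (2 * pi * expected_density f sig K1 K2 (plane p)))) /\
  (\int[l2]_p (lap phi p * gpot (K1, K2) (2 * sig ^+ 2 * B0 f (plane p)))%:E
   = \int[l2]_p (c2 phi p * (2 * pi * expected_density f sig K1 K2 (plane p)))%:E)%E.
Proof.
move=> ef s0 cA AM sA BA.
have d0 j z : cdiff (f j) z (cderiv (f j) z) by exact: (proj1 (entireP _) (ef j) z).
have e1 j : entire (cderiv (f j)) by exact: entire_cderiv.
have d1 j z : cdiff (cderiv (f j)) z (cderiv (cderiv (f j)) z).
  exact: (proj1 (entireP _) (e1 j) z).
have e2 j : entire (cderiv (cderiv (f j))) by exact: entire_cderiv.
have d2 j z : cdiff (cderiv (cderiv (f j))) z (cderiv (cderiv (cderiv (f j))) z).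
  exact: (proj1 (entireP _) (e2 j) z).
exact: (green_mean_log_aux d0 d1 d2 s0 (erefl _) cA AM sA BA).
Qed.

End MeanLogPotential.

(** * Expected potentials of test functions *)

Section CountingFubini.
Context d (Omega : measurableType d) (R : realType) (P : probability Omega R).
Variables (N : nat) (sigma K1 K2 : R) (a b : 'I_N.+1 -> {RV P >-> R}).
Variable f : 'I_N.+1 -> R[i] -> R[i].
Hypotheses (sig0 : 0 < sigma ^+ 2) (indep : mutually_independent (joint_family a b)).
Hypotheses (na : forall j, is_normal (a j) 0 sigma) (nb : forall j, is_normal (b j) 0 sigma).
Hypothesis ef : forall j, entire (f j).
Local Notation C := R[i].
Local Notation mu := (@lebesgue_measure R).
Local Notation l2 := (mu \x mu)%E.
Local Notation k := (K1, K2).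
Implicit Types (p q : R * R) (phi : c2fun R).

(** The value at [p] of the random sum, as a point of the plane. *)
Definition value p (w : Omega) : R * R :=
  partial_sum a b (fun j => f j (plane p)) (index_enum 'I_N.+1) w.

Lemma plane_value p w : plane (value p w) = random_sum f a b w (plane p).
Proof.
rewrite /plane /value /partial_sum /random_sum; apply/eqP.
rewrite eq_complex !raddf_sum /=; apply/andP; split; apply/eqP; apply: eq_bigr => j _.
  by case: (f j _) => u v /=; ring.
by case: (f j _) => u v /=; ring.
Qed.

Definition value_var p : R := 2 * sigma ^+ 2 * B0 f (plane p).

Lemma value_law p (F : R * R -> \bar R) : 0 < B0 f (plane p) ->
  measurable_fun setT F -> (forall q, 0 <= F q)%E ->
  (\int[P]_w F (value p w) = \int[l2]_q (F q * (gdens (value_var p) q)%:E))%E.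
Proof.
move=> b0 mF F0; have s0 : sigma != 0 by apply: contraTneq sig0 => ->; rewrite expr0n ltxx.
have [_ H] := @partial_sum_law _ _ _ _ _ a b sigma (fun j => f j (plane p)) s0 indep na nb
  (index_enum 'I_N.+1) (index_enum_uniq _).
have E : variance sigma (fun j => f j (plane p)) (index_enum 'I_N.+1) = value_var p.
  by rewrite /variance /value_var B0_ReIm mulr_sumr.
by move: (H F mF F0); rewrite E gt_eqF// mulr_gt0// mulr_gt0.
Qed.

Lemma measurable_value p : measurable_fun setT (value p).
Proof. exact: measurable_partial_sum. Qed.

Lemma continuous_plane j :
  continuous (fun p => complex.Re (f j (plane p))) /\ continuous (fun p => complex.Im (f j (plane p))).
Proof. by split=> p; have [] := cdiff_plane (proj1 (entireP _) (@ef j) (plane p)). Qed.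

Lemma measurable_value2 : measurable_fun setT (fun z : Omega * (R * R) => value z.2 z.1).
Proof.
have mre j : measurable_fun setT (fun z : Omega * (R * R) => complex.Re (f j (plane z.2))).
  have m1 := continuous_measurable_plane (proj1 (continuous_plane j)).
  exact: (measurableT_comp m1 measurable_snd).
have mim j : measurable_fun setT (fun z : Omega * (R * R) => complex.Im (f j (plane z.2))).
  have m1 := continuous_measurable_plane (proj2 (continuous_plane j)).
  exact: (measurableT_comp m1 measurable_snd).
have ma (X : {RV P >-> R}) : measurable_fun setT (fun z : Omega * (R * R) => X z.1).
  by apply: measurableT_comp.
apply: measurable_fun_pair; apply: measurable_sum => j.
  by apply: measurable_funB; apply: measurable_funM.
by apply: measurable_funD; apply: measurable_funM.
Qed.

(** The law of the value has a density, but the logarithm has no sign: its positive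
    and negative parts are treated separately. *)
Lemma mean_lndist_value p : 0 < B0 f (plane p) ->
  (\int[P]_w (lndist k (value p w))%:E = (gpot k (value_var p))%:E)%E.
Proof.
move=> b0; have v0 : 0 < value_var p by rewrite mulr_gt0// mulr_gt0.
set v := value_var p in v0 *.
pose D q := gdens v q * lndist k q.
have iD : l2.-integrable setT (EFin \o D) by exact: integrable_gdens_lndist.
have g0 q : 0 <= gdens v q by rewrite gdens_ge0// ltW.
have mln : measurable_fun setT (EFin \o lndist k).
  by apply/measurable_EFinP; exact: measurable_lndist.
have posE q : ((EFin \o D)^\+ q = (EFin \o lndist k)^\+ q * (gdens v q)%:E)%E.
  rewrite !funeposE /= /D -!EFin_max -EFinM; congr EFin.
  have [x0|x0] := leP 0 (lndist k q).
    by rewrite (max_l (mulr_ge0 (g0 q) x0)) mulrC.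
  by rewrite (max_r (mulr_ge0_le0 (g0 q) (ltW x0))) mul0r.
have negE q : ((EFin \o D)^\- q = (EFin \o lndist k)^\- q * (gdens v q)%:E)%E.
  rewrite !funenegE /= /D -!EFin_max -EFinM; congr EFin.
  have [x0|x0] := leP 0 (lndist k q).
    have p0 := mulr_ge0 (g0 q) x0.
    by rewrite max_r ?oppr_le0// max_r ?oppr_le0// mul0r.
  have p0 := mulr_ge0_le0 (g0 q) (ltW x0).
  by rewrite max_l ?oppr_ge0// max_l ?oppr_ge0 ?(ltW x0)// mulNr mulrC.
rewrite /gpot /Rintegral fineK; last exact: integrable_fin_num.
rewrite [RHS]integralE [LHS]integralE; congr (_ - _)%E.
  transitivity (\int[P]_w ((EFin \o lndist k)^\+ (value p w)))%E.
    by apply: eq_integral => w _; rewrite !funeposE.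
  rewrite value_law//; last first.
    exact: measurable_funepos.
  by apply: eq_integral => q _; rewrite -posE.
transitivity (\int[P]_w ((EFin \o lndist k)^\- (value p w)))%E.
  by apply: eq_integral => w _; rewrite !funenegE.
rewrite value_law//; last first.
  exact: measurable_funeneg.
by apply: eq_integral => q _; rewrite -negE.
Qed.

(** By Fubini this is integrable in [w] for every test function; outside a
    negligible event it is the sum of [phi] over the solutions. *)
Definition potential phi (w : Omega) : \bar R :=
  ((2 * pi)^-1%:E * \int[l2]_p (lap phi p * lndist k (value p w))%:E)%E.

(** Integrability over the product comes from [gdens_le]: on the support of [phi]
    the densities are dominated by a single Gaussian divided by the variance,
    which is bounded away from 0 there. *)
Lemma fubini_potential A M phi : closed A -> A `<=` box M -> c2_supp phi A ->
  (forall p, A p -> 0 < B0 f (plane p)) ->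
  [/\ P.-integrable setT (potential phi),
    l2.-integrable setT (EFin \o (fun p => c2 phi p * expected_density f sigma K1 K2 (plane p))) &
    (\int[P]_w potential phi w
     = \int[l2]_p (c2 phi p * expected_density f sigma K1 K2 (plane p))%:E)%E].
Proof.
move=> cA AM sA BA; pose V := value_var.
have VA p : A p -> 0 < V p by move=> /BA h; rewrite mulr_gt0// mulr_gt0.
have cV : continuous V by move=> p; apply: cvgM; [exact: cvg_cst|exact: continuous_B0].
have [U U0 HU] := continuous_box_bounded M cV.
have [iphi E] := green_mean_log K1 K2 ef sig0 cA AM sA BA.
have l0 p : ~ A p -> lap phi p = 0 by case/sA => _ _ e1 _ e2; rewrite /lap e1 e2 addr0.
pose g (z : Omega * (R * R)) : \bar R := (lap phi z.2 * lndist k (value z.2 z.1))%:E.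
have mg : measurable_fun setT g.
  apply/measurable_EFinP; apply: measurable_funM.
    have ml := continuous_measurable_plane (@continuous_lap R phi).
    exact: (measurableT_comp ml measurable_snd).
  exact: (measurableT_comp (measurable_lndist k) measurable_value2).
pose U1 := U + 1; have U10 : 0 < U1 by rewrite ltr_wpDl.
pose c := (\int[l2]_q (`|gdens U1 q * lndist k q|)%:E)%E.
have mgl : measurable_fun setT (fun q => (`|gdens U1 q * lndist k q|)%:E).
  apply/measurable_EFinP; apply: measurableT_comp => //.
  by apply: measurable_funM; [exact: measurable_gdens|exact: measurable_lndist].
have cfin : (c < +oo)%E by have /integrableP[] := integrable_gdens_lndist k U10.
have c0 : (0 <= c)%E by exact: integral_ge0.
have ilV : l2.-integrable setT (EFin \o (fun p => lap phi p * (V p)^-1)).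
  apply: (@integrable_continuous_box R _ M) => [|p nbp]; last by rewrite l0 ?mul0r// => /AM.
  apply: (continuous_suppM cA (@continuous_lap R phi) l0) => p Ap.
  by apply: cvgV; [rewrite gt_eqF// VA|exact: cV].
have mln : measurable_fun setT (fun q => `|lndist k q|%:E).
  by apply/measurable_EFinP; apply: measurableT_comp => //; exact: measurable_lndist.
have bd p : (\int[P]_w `|g (w, p)| <= (U1%:E * c) * `|(lap phi p * (V p)^-1)%:E|)%E.
  have [Ap|nA] := pselect (A p); last first.
    rewrite integral0_eq; first by rewrite mule_ge0// mule_ge0// lee_fin ltW.
    by move=> w _; rewrite /g /= l0// mul0r normr0.
  have v0 := VA _ Ap.
  have -> : (\int[P]_w `|g (w, p)| = `|lap phi p|%:E * \int[P]_w `|lndist k (value p w)|%:E)%E.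
    rewrite -ge0_integralZl//; last first.
      apply/measurable_EFinP; apply: measurableT_comp => //.
      by apply: (measurableT_comp (measurable_lndist k)); exact: measurable_value.
    by apply: eq_integral => w _; rewrite /g /= normrM EFinM.
  rewrite (value_law (F := fun q => `|lndist k q|%:E) (BA _ Ap))//.
  have -> : `|(lap phi p / V p)%:E|%E = (`|lap phi p| * (V p)^-1)%:E.
    by rewrite /= normrM normfV (gtr0_norm v0).
  rewrite -/(V p) EFinM muleCA; apply: lee_wpmul2l => //.
  rewrite muleC muleA -EFinM.
  have vU : (0 <= ((V p)^-1 * U1)%:E)%E.
    by rewrite lee_fin; apply: mulr_ge0; rewrite ?invr_ge0 ltW.
  rewrite /c -(ge0_integralZl l2 measurableT mgl _ vU)//.
  apply: ge0_le_integral => //.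
  - by move=> q _; rewrite -EFinM lee_fin mulr_ge0// gdens_ge0// ltW.
  - apply: emeasurable_funM => //; apply/measurable_EFinP; exact: measurable_gdens.
  - exact: emeasurable_funM.
  move=> q _ /=; rewrite -!EFinM lee_fin (normrM (gdens U1 q)) (ger0_norm (gdens_ge0 q (ltW U10))).
  rewrite mulrA [leRHS]mulrC; apply: ler_wpM2l => //; rewrite (mulrC (V p)^-1).
  apply: gdens_le => //; apply: (@le_trans _ _ U); last by rewrite lerDl.
  by have := HU p (AM _ Ap); rewrite gtr0_norm.
have ig : (P \x @area R)%E.-integrable setT g.
  apply/(@integrable21ltyP _ _ _ _ _ P (@area R) g mg).
  apply: (@le_lt_trans _ _ (\int[l2]_p ((U1%:E * c) * `|(lap phi p * (V p)^-1)%:E|))%E).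
    apply: ge0_le_integral => //.
    - by move=> p _; exact: integral_ge0.
    - apply: (@measurable_fun_fubini_tonelli_G _ _ _ _ _ P (abse \o g)).
        exact: measurableT_comp.
      by move=> z /=.
    - apply: emeasurable_funM => //; apply: measurableT_comp => //.
      by have /integrableP[] := ilV.
  have mlV : measurable_fun setT (fun p => (`|lap phi p * (V p)^-1|)%:E).
    apply/measurable_EFinP; apply: measurableT_comp => //.
    by have /integrableP[/measurable_EFinP] := ilV.
  have Uc0 : (0 <= U1%:E * c)%E by rewrite mule_ge0// lee_fin ltW.
  have lV0 p : setT p -> (0 <= (`|lap phi p * (V p)^-1|)%:E)%E by rewrite lee_fin.
  rewrite (ge0_integralZl l2 measurableT mlV lV0 Uc0).
  apply: lte_mul_pinfty => //.
  - by rewrite fin_numM// ge0_fin_numE.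
  - by have /integrableP[] := ilV.
have i1 := integrable_fubini_F ig.
have F := Fubini ig.
have pi20 : 2 * pi != 0 :> R by rewrite mulf_neq0// gt_eqF// pi_gt0.
pose h p := expected_density f sigma K1 K2 (plane p).
have ih : l2.-integrable setT (EFin \o (fun p => c2 phi p * h p)).
  have := integrableZl measurableT (2 * pi)^-1 iphi.
  congr integrable; apply/funext => p /=; rewrite -EFinM; congr EFin.
  by rewrite mulrCA (mulrA _ (2 * pi)) mulVf// mul1r.
split=> //; first exact: integrableZl i1.
rewrite /potential integralZl//.
transitivity ((2 * pi)^-1%:E * \int[l2]_p (c2 phi p * (2 * pi * h p))%:E)%E.
  congr (_ * _)%E; rewrite -E; transitivity (\int[@area R]_p \int[P]_w g (w, p))%E; first exact: F.
  apply: eq_integral => p _; have [Ap|nA] := pselect (A p); last first.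
    rewrite l0// mul0r; apply: integral0_eq => w _.
    by rewrite /g /= l0// mul0r.
  have ip : P.-integrable setT (fun w => (lndist k (value p w))%:E).
    apply/integrableP; split.
      apply/measurable_EFinP; apply: (measurableT_comp (measurable_lndist k)).
      exact: measurable_value.
    rewrite -[ltLHS]/(\int[P]_w `|lndist k (value p w)|%:E)%E.
    rewrite (value_law (F := fun q => `|lndist k q|%:E) (BA _ Ap))//.
    have /integrableP[_] := integrable_gdens_lndist k (VA _ Ap).
    congr (_ < _)%E; apply: eq_integral => q _ /=.
    by rewrite (normrM (gdens _ q)) (ger0_norm (gdens_ge0 q (ltW (VA _ Ap)))) mulrC EFinM.
  rewrite EFinM -(mean_lndist_value (BA _ Ap)) -integralZl//.
rewrite -integralZl//; apply: eq_integral => p _; rewrite -EFinM; congr EFin.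
by rewrite mulrCA (mulrA _ (2 * pi)) mulVf// mul1r.
Qed.

End CountingFubini.

(** * The expected number of solutions *)

Section CompactPlane.
Variable R : realType.
Local Notation C := R[i].

Lemma compact_plane (T : set C) : ccompact T -> compact (@plane R @^-1` T : set (R * R)).
Proof.
move=> cT; pose g (z : C^o) : R * R := (complex.Re z, complex.Im z).
have cg : continuous g.
  move=> z U /near_pairP[d d0 H]; apply/near_cmodP; exists d => // w zw; apply: H => /=.
    by apply: le_lt_trans zw; rewrite -cmodN opprB -raddfB ge_Re_cmod.
  by apply: le_lt_trans zw; rewrite -cmodN opprB -raddfB ge_Im_cmod.
rewrite (_ : _ @^-1` _ = g @` (T : set C^o)).
  by apply: continuous_compact => //; exact: continuous_subspaceT.
apply/seteqP; split=> [p Tp|_ [[x y] Tz <-]] //.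
by exists (plane p) => //; rewrite /g /=; case: p {Tp}.
Qed.

Lemma plane_inj : injective (@plane R).
Proof. by move=> [x y] [x' y'] [-> ->]. Qed.

End CompactPlane.

Section RandomZeros.
Context d (Omega : measurableType d) (R : realType) (P : probability Omega R).
Variables (N : nat) (sigma K1 K2 : R) (a b : 'I_N.+1 -> {RV P >-> R}).
Variable f : 'I_N.+1 -> R[i] -> R[i].
Hypothesis ef : forall j, entire (f j).
Local Notation C := R[i].
Local Notation mu := (@lebesgue_measure R).
Local Notation l2 := (mu \x mu)%E.
Local Notation K := (K1 +i* K2).
Local Notation k := (K1, K2).
Local Notation S w := (random_sum f a b w).

Lemma entire_random_sum w : entire (S w).
Proof.
apply: (cdiff_entire (g := fun z => \sum_(j < N.+1) (a j w +i* b j w) * cderiv (f j) z)) => z.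
by apply: cdiff_sum => j; apply: cdiffZ; exact: (proj1 (entireP _) (@ef j) z).
Qed.

Lemma entire_random_sumB w : entire (fun z => S w z - K).
Proof.
apply: (cdiff_entire (g := fun z => cderiv (S w) z - 0)) => u.
apply: cdiffB; last exact: cdiff_cst.
exact: (proj1 (entireP _) (@entire_random_sum w) u).
Qed.

(** The points 1/(m+1) accumulate, so that an entire function equal to [K] at all
    of them is constant; testing countably many points makes the degenerate event
    measurable. *)
Definition probe (m : nat) : R * R := (m.+1%:R^-1, 0).

Definition degenerate : set Omega := [set w | forall m, value a b f (probe m) w = k].

Lemma degenerateP w : degenerate w <-> S w = fun=> K.
Proof.
have vE p : value a b f p w = k <-> S w (plane p) = K.
  by rewrite -plane_value; split=> [->|]; [|exact: (@plane_inj _ _ k)].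
split=> [Z|Sw m]; last by apply/vE; rewrite Sw.
apply: contrapT => nc.
have [z nz] : exists z, S w z - K != 0.
  apply: contrapT => nz; apply: nc; apply/funext => z; apply/eqP; rewrite -subr_eq0.
  by apply/negPn/negP => h; apply: nz; exists z.
have eg := @entire_random_sumB w.
have [s [u [_ fac _ u0]]] := entire_finite_factor 1 eg (ex_intro _ z nz).
have roots m : plane (probe m) \in s.
  have c1 : cmod (plane (probe m)) <= 1.
    rewrite (_ : plane (probe m) = (m.+1%:R^-1)%:C)// cmod_real ger0_norm//.
    by rewrite invf_le1// ler1n.
  have := fac (plane (probe m)); rewrite (proj1 (vE _) (Z m)) subrr => /esym/eqP.
  rewrite mulf_eq0 (negbTE (u0 _ c1)) orbF prodf_seq_eq0 => /hasP[c cs /= ].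
  by rewrite subr_eq0 => /eqP ->.
have H := uniq_leq_size (s1 := [seq plane (probe i) | i <- iota 0 (size s).+1]) (s2 := s).
rewrite size_map size_iota ltnn in H; suff : false by []; apply: H.
  rewrite map_inj_uniq ?iota_uniq// => i j [] /invr_inj /eqP.
  by rewrite eqr_nat => /eqP[].
by move=> c /mapP[i _ ->].
Qed.

Lemma measurable_degenerate : measurable degenerate.
Proof.
rewrite (_ : degenerate = \bigcap_m (value a b f (probe m) @^-1` [set k])).
  apply: bigcapT_measurable => m; rewrite -[_ @^-1` _]setTI.
  apply: measurable_value => //.
  rewrite (_ : [set k] = [set K1] `*` [set K2]).
    by apply: measurableX; exact: measurable_set1.
  by apply/seteqP; split=> [p ->//|[x y] [/= -> ->]].
by apply/seteqP; split=> w h m; [move=> _; exact: h|exact: (h m)].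
Qed.

Section Counting.
Variables (T : set C) (A : set (R * R)) (M : R).
Hypotheses (T0 : T !=set0) (cA : closed A) (AM : A `<=` box M) (TA : @plane R @^-1` T `<=` A).
Local Notation count w := (num_solutions (S w) K T).

(** Off the degenerate event, all the test functions see the same finite list
    of zeros, and the potentials are sums over that list. *)
Lemma potential_zeros w : ~ degenerate w -> exists s : seq C,
  count w = (\sum_(c <- s) \1_T c)%:E /\
  forall phi : c2fun R, c2_supp phi A ->
    potential K1 K2 a b f phi w = (\sum_(c <- s) c2 phi (complex.Re c, complex.Im c))%:E.
Proof.
move=> nd; have eg := @entire_random_sumB w.
have [z nz] : exists z, S w z - K != 0.
  apply: contrapT => nz; apply: nd; apply/degenerateP; apply/funext => z; apply/eqP.
  by rewrite -subr_eq0; apply/negPn/negP => h; apply: nz; exists z.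
have [s [u [eu fac _ u0]]] := entire_finite_factor (2 * M) eg (ex_intro _ z nz).
have boxM p : box M p -> cmod (plane p) <= 2 * M.
  move=> [h1 h2]; apply: le_trans (le_cmod_ReIm _) _; rewrite mulr2n mulrDl mul1r.
  by apply: lerD; [move: h1|move: h2]; rewrite /= in_itv /= ler_norml.
exists s; split.
  apply: (num_solutions_prod eu fac u0) => c Tc.
  have : A (complex.Re c, complex.Im c) by apply: TA; rewrite /plane /=; case: c Tc.
  by move=> /AM /boxM; rewrite /plane /=; case: (c).
move=> phi sA.
have uA p : A p -> u (plane p) != 0 by move=> /AM /boxM; exact: u0.
have pi20 : 2 * pi != 0 :> R by rewrite mulf_neq0// gt_eqF// pi_gt0.
rewrite /potential (_ : (\int[l2]_p _)%E = (2 * pi * \sum_(c <- s) c2 phi (complex.Re c, complex.Im c))%:E).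
  by rewrite -EFinM mulrA mulVf// mul1r.
rewrite -(integral_lap_ln_cmod s eu cA AM sA uA); apply: eq_integral => p _.
by rewrite -fac -plane_value -(lndist_cmod K).
Qed.

Variables (psi : c2fun R) (phi : nat -> c2fun R).
Hypotheses (sphi : forall n, c2_supp (phi n) A) (spsi : c2_supp psi A)
  (bphi : forall n p, 0 <= c2 (phi n) p <= c2 psi p)
  (phi1 : forall n p, T (plane p) -> c2 (phi n) p = 1)
  (phi0 : forall p, ~ T (plane p) -> \forall n \near \oo, c2 (phi n) p = 0).

Lemma near_indic c : \forall n \near \oo, c2 (phi n) (complex.Re c, complex.Im c) = \1_T c.
Proof.
have cE : plane (complex.Re c, complex.Im c) = c by case: c.
have [Tc|nT] := pselect (T c).
  by apply: nearW => n; rewrite phi1 ?cE// indicE mem_set.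
rewrite indicE memNset//; apply: phi0; by rewrite cE.
Qed.

Lemma potential_cvg w : ~ degenerate w -> (fun n => potential K1 K2 a b f (phi n) w) @ \oo --> count w.
Proof.
move=> /potential_zeros[s [-> E]]; apply: cvg_near_cst.
suff : \forall n \near \oo, \sum_(c <- s) c2 (phi n) (complex.Re c, complex.Im c) = \sum_(c <- s) \1_T c.
  by apply: filterS => n h; rewrite E// h.
elim: s {E} => [|c s IH]; first by apply: nearW => n; rewrite !big_nil.
have H := near_indic c; near=> n; rewrite !big_cons; congr (_ + _); first by near: n.
by near: n.
Unshelve. all: by end_near.
Qed.

Lemma potential_degenerate theta w : degenerate w -> potential K1 K2 a b f theta w = 0%E.
Proof.
move=> /degenerateP Sw; rewrite /potential integral0_eq ?mule0// => p _.
have -> : value a b f p w = k.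
  by apply: plane_inj; rewrite plane_value Sw.
by rewrite /lndist /r2 !subrr expr0n /= addr0 ln0// mul0r mulr0.
Qed.

Lemma count_degenerate w : degenerate w -> count w = +oo%E.
Proof. by move=> /degenerateP ->; exact: num_solutions_cst. Qed.

(** The count is a pointwise limit of measurable functions once the infinite
    value on the degenerate event, where all the potentials vanish, is added by
    hand. *)
Lemma measurable_count :
  (forall n, measurable_fun setT (potential K1 K2 a b f (phi n))) ->
  measurable_fun setT (fun w => count w).
Proof.
move=> mp; pose Y n w := (potential K1 K2 a b f (phi n) w + +oo * (\1_degenerate w)%:E)%E.
have mI : measurable_fun setT (fun w => (\1_degenerate w : R)%:E).
  by apply/measurable_EFinP; apply: measurable_indic; exact: measurable_degenerate.
apply: (@emeasurable_fun_cvg _ _ _ _ Y) => [n|w _].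
  by apply: emeasurable_funD; [exact: mp|exact: emeasurable_funM].
have [D|nD] := pselect (degenerate w).
  rewrite count_degenerate//; apply: cvg_near_cst; apply: nearW => n.
  by rewrite /Y potential_degenerate// indicE mem_set// mule1 add0e.
apply: cvg_trans (potential_cvg nD); apply: near_eq_cvg; apply: nearW => n.
by rewrite /Y indicE memNset// mule0 adde0.
Qed.

End Counting.
End RandomZeros.

Theorem theorem3 (d : measure_display) (Omega : measurableType d)
    (R : realType) (P : probability Omega R)
    (N : nat) (sigma K1 K2 : R)
    (a b : 'I_N.+1 -> {RV P >-> R})
    (f : 'I_N.+1 -> R[i] -> R[i])
    (T : set R[i]) :
  (1 < N)%N ->
  0 < sigma ^+ 2 ->
  mutually_independent (joint_family a b) ->
  (forall j, is_normal (a j) 0 sigma) ->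
  (forall j, is_normal (b j) 0 sigma) ->
  (forall j, entire (f j)) ->
  (forall j (x : R), complex.Im (f j x%:C) = 0) ->
  ccompact T ->
  (forall z, T z -> 0 < B0 f z) ->
  let count := fun w : Omega =>
    num_solutions (random_sum f a b w) (K1 +i* K2) T in
  measurable_fun [set: Omega] count /\
  (\int[P]_w count w = integral_dxdy T (expected_density f sigma K1 K2))%E.
Proof.
move=> _ sig0 indep na nb ef _ cT B0T count.
have [T0|/set0P T0] := eqVneq T set0.
  have c0 w : count w = 0%E by rewrite /count /num_solutions T0 set0I esum_set0.
  split.
    by rewrite (_ : count = cst 0%E)//; apply/funext.
  by rewrite integral0_eq// /integral_dxdy T0 preimage_set0 integral_set0.
pose h p := expected_density f sigma K1 K2 (plane p).
pose T' : set (R * R) := @plane R @^-1` T.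
pose O : set (R * R) := [set p | 0 < B0 f (plane p)].
have oO : open O.
  have := continuous_B0 ef; move/continuousP => /(_ [set x | 0 < x]).
  by apply; exact: open_gt.
have TO : T' `<=` O by move=> p /B0T.
have cT' := compact_plane cT.
have [A [M [psi [phi [cA AO AM [spsi sphi bphi phi1 phi0]]]]]] := test_functions cT' oO TO.
have TA : T' `<=` A.
  move=> p Tp; apply: contrapT => nA; have [p0 _ _ _ _] := sphi 0%N p nA.
  by have := phi1 0%N p Tp; rewrite p0 => /eqP; rewrite eq_sym oner_eq0.
have fub theta (st : c2_supp theta A) :=
  fubini_potential K1 K2 sig0 indep na nb ef cA AM st AO.
have mcount : measurable_fun setT count.
  apply: (measurable_count ef T0 cA AM TA sphi phi1 phi0) => n.
  by have [/measurable_int + _ _] := fub _ (sphi n).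
split=> //.
have [t Tt] := T0.
(* The degenerate event forces the value at the point t of T to be K. *)
have P0 : P (degenerate K1 K2 a b f) = 0%E.
  pose p0 : R * R := (complex.Re t, complex.Im t).
  have pt : plane p0 = t by rewrite /p0 /plane; case: (t).
  have b0 : 0 < B0 f (plane p0) by rewrite pt; exact: B0T.
  have mk : measurable [set (K1, K2)].
    rewrite (_ : [set _] = [set K1] `*` [set K2]).
      by apply: measurableX; exact: measurable_set1.
    by apply/seteqP; split=> [p ->//|[x y] [/= -> ->]].
  have mv := measurable_value a b f p0.
  apply/eqP; rewrite eq_le measure_ge0 andbT.
  apply: (@le_trans _ _ (P (value a b f p0 @^-1` [set (K1, K2)]))).
    apply: le_measure; rewrite ?inE.
    - exact: measurable_degenerate.
    - by rewrite -[_ @^-1` _]setTI; exact: mv.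
    move=> w /(proj1 (@degenerateP _ _ _ _ _ K1 K2 a b f ef w)) Sw /=.
    by apply: plane_inj; rewrite plane_value Sw.
  have mF : measurable_fun setT (fun q : R * R => (\1_[set (K1, K2)] q : R)%:E).
    by apply/measurable_EFinP; exact: measurable_indic.
  have E := value_law sig0 indep na nb b0 mF (fun q => _).
  rewrite (_ : P _ = \int[P]_w (\1_[set (K1, K2)] (value a b f p0 w))%:E)%E; last first.
    rewrite -[LHS]/((fun A => P A) _) -(setIT (_ @^-1` _)) -integral_indic//.
    by rewrite -[_ @^-1` _]setTI; exact: mv.
  rewrite E; last by move=> q; rewrite lee_fin.
  rewrite le_eqVlt; apply/orP; left; apply/eqP.
  transitivity (\int[lebesgue_measure \x lebesgue_measure]_(q in [set: R * R]) (cst 0 q))%E; last exact: integral0.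
  apply: ae_eq_integral => //.
    by apply: emeasurable_funM => //; apply/measurable_EFinP; exact: measurable_gdens.
  by apply: (ae_neq (k := (K1, K2))) => q qk _; rewrite indicE memNset ?mul0e.
have nd : {ae P, forall w, ~ degenerate K1 K2 a b f w}.
  exists (degenerate K1 K2 a b f); split=> //; first exact: measurable_degenerate.
  by move=> w /= /contrapT.
have [ipsi ihpsi Epsi] := fub _ spsi.
have [_ _ cvgE] : [/\ P.-integrable setT count,
    [sequence \int[P]_w (`|potential K1 K2 a b f (phi n) w - count w|)]_n%E @ \oo --> 0%E
    & [sequence \int[P]_w potential K1 K2 a b f (phi n) w]_n%E @ \oo --> (\int[P]_w count w)%E].
  apply: (@dominated_convergence _ _ _ P setT measurableT _ _ (potential K1 K2 a b f psi)) => //.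
  - by move=> n; have [/measurable_int + _ _] := fub _ (sphi n).
  - apply: filterS nd => w nw _.
    exact: (potential_cvg ef cA AM TA sphi phi1 phi0 nw).
  - apply: filterS nd => w nw n _.
    have [s [_ Es]] := potential_zeros ef cA AM TA nw.
    rewrite !Es// /= lee_fin ger0_norm; last by apply: sumr_ge0 => c _; have /andP[] := bphi n (complex.Re c, complex.Im c).
    by apply: ler_sum => c _; have /andP[] := bphi n (complex.Re c, complex.Im c).
pose hT p : \bar R := ((\1_T' p : R) * h p)%:E.
have cvgh p : (fun n => (c2 (phi n) p * h p)%:E) @ \oo --> hT p.
  apply: cvg_near_cst; rewrite /hT; have [Tp|nT] := pselect (T' p).
    by apply: nearW => n; rewrite phi1// indicE mem_set.
  by rewrite indicE memNset//; have := phi0 p nT; apply: filterS => n ->.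
have mh n : measurable_fun setT (fun p => (c2 (phi n) p * h p)%:E).
  by have [_ /measurable_int + _] := fub _ (sphi n).
have mhT : measurable_fun setT hT.
  by apply: (@emeasurable_fun_cvg _ _ _ _ (fun n p => (c2 (phi n) p * h p)%:E)).
have [_ _ cvgH] : [/\ (lebesgue_measure \x lebesgue_measure)%E.-integrable setT hT,
    [sequence \int[lebesgue_measure \x lebesgue_measure]_p (`|(c2 (phi n) p * h p)%:E - hT p|)]_n%E @ \oo --> 0%E
    & [sequence \int[lebesgue_measure \x lebesgue_measure]_p (c2 (phi n) p * h p)%:E]_n%E @ \oo
       --> (\int[lebesgue_measure \x lebesgue_measure]_p hT p)%E].
  apply: (@dominated_convergence _ _ _ (lebesgue_measure \x lebesgue_measure)%E setT measurableT _ _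
    (fun p => `|(c2 psi p * h p)%:E|%E)) => //.
  - by apply: aeW => p _; exact: cvgh.
  - exact: (integrable_abse ihpsi).
  - apply: aeW => p n _ /=; rewrite lee_fin !normrM ler_wpM2r//.
    by have /andP[h1 h2] := bphi n p; rewrite !ger0_norm// (le_trans h1 h2).
have EE : [sequence \int[P]_w potential K1 K2 a b f (phi n) w]_n%E =
    [sequence \int[lebesgue_measure \x lebesgue_measure]_p (c2 (phi n) p * h p)%:E]_n%E.
  by apply/funext => n; have [_ _ e] := fub _ (sphi n); exact: e.
rewrite EE in cvgE.
rewrite (cvg_unique (@ereal_hausdorff R) cvgE cvgH) /integral_dxdy.
rewrite [RHS]integral_mkcond; apply: eq_integral => p _; rewrite /hT patchE indicE.
by case: (p \in T'); rewrite ?mul1r ?mul0r.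
Qed.
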